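(* Let $K$ be an oriented, non-split alternating link in $S^3$, and let $P_K(x,y,z,w)\in\mathbb{Z}[x^{-1},y^{-1},z,w]$ be the spanning-tree polynomial defined in the context. Then each of the following four sequences is trapezoidal: (1) the even-degree coefficients of the Laurent polynomial $P_K(t^{-1},t,1,1)$; (2) the odd-degree coefficients of $P_K(t^{-1},t,1,1)$; (3) the even-degree coefficients of $P_K(1,1,t^{-1},t)$; (4) the odd-degree coefficients of $P_K(1,1,t^{-1},t)$.
   Context: Trapezoidal. A finite sequence $a_0,a_1,\dots,a_n$ of non-negative integers is trapezoidal if there are indices $0\le i_1\le i_2\le n$ with $a_0<a_1<\cdots<a_{i_1}=a_{i_1+1}=\cdots=a_{i_2}>\cdots>a_{n-1}>a_n$. The sequence of even-degree (respectively odd-degree) coefficients of a Laurent polynomial in $t$ lists, in order, the coefficients of $t^j$ for $j$ even (respectively odd), from the smallest to the largest such $j$ with nonzero coefficient; if there are no such $j$ the sequence is empty and the claim is vacuous. All links are oriented and non-split. A link is alternating if it has a diagram in which each component alternates between over- and undercrossings (an alternating diagram). Crossing signs: rotate the picture so both strands point upward; the crossing is positive if the overstrand runs from lower left to upper right, negative if it runs from lower right to upper left. Tait digraph. Let $D\subset\mathbb{R}^2$ be an alternating diagram of a non-split link. Regions of $D$ are the components of the complement of the underlying 4-valent plane graph. Choose the checkerboard shading of the regions such that at every crossing, when the picture is rotated so that the overstrand runs from lower left to upper right, the top and bottom regions are the shaded ones. The Tait digraph $G=(V,E)$ is the plane digraph with one vertex in each shaded region and one edge through each crossing, joining the vertices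 of the two shaded regions at that crossing (loops and multiple edges allowed), directed to match the overcrossing: rotating so that the overstrand is directed from lower left to upper right, the edge points from the bottom region to the top region. An edge is positive or negative according to the sign of its crossing; $E=E_+\sqcup E_-$. Activities. Fix a root vertex $r\in V$ and a basepoint $q\in\mathbb{R}^2\setminus G$. Let $T$ be a spanning tree of $G$ (viewed as a set of edges). An edge $e\in T$ is internally semi-active if it points away from the component of $T\setminus\{e\}$ containing $r$, and internally semi-passive otherwise. For $e\in E\setminus T$, let $\mathrm{Cyc}_T(e)$ be the unique cycle in $T\cup\{e\}$, oriented counter-clockwise around $q$ in $\mathbb{R}^2\cup\{\infty\}$ (so that the side containing $q$ lies on its left); $e$ is externally semi-active if its direction agrees with this orientation, and externally semi-passive otherwise. Let $\iota_+(T)$, $\overline{\iota}_+(T)$ be the numbers of internally semi-active, respectively semi-passive, edges in $T\cap E_+$, and $\varepsilon_-(T)$, $\overline{\varepsilon}_-(T)$ the numbers of externally semi-active, respectively semi-passive, edges in $E_-\setminus T$. The polynomial. For an alternating diagram $D$ of $K$ with Tait digraph $G$, a root $r$, and a basepoint $q$ in a face of $G$ adjacent to $r$ (its boundary contains $r$), $$P_K(x,y,z,w)=\sum_{T}x^{-\iota_+(T)}y^{-\overline{\iota}_+(T)}z^{\varepsilon_-(T)}w^{\overline{\varepsilon}_-(T)},$$ summed over all spanning trees $T$ of $G$. It does not depend on the choice of alternating diagram or of adjacent pair $(r,q)$. *)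

(* Defs.v *)
From HB Require Import structures.
From mathcomp Require Import all_boot all_order all_algebra.

Set Implicit Arguments.
Unset Strict Implicit.
Unset Printing Implicit Defensive.

Import Order.TTheory GRing.Theory Num.Theory.

(* Oriented link diagrams, up to isotopy of the sphere, as planar-diagram     *)
(* codes. Each crossing has four ends; the end (c, o, b) lies on the          *)
(* overstrand iff o, and b says whether that strand leaves c through it.      *)
(* glue d is the other end of the arc of the diagram that starts at d.        *)
(* A code with no crossings stands for the crossingless diagram of the        *)
(* unknot.                                                                    *)
Record pd_code := PDCode {
  crossing : finType;
  positive : pred crossing;
  glue : crossing * bool * bool -> crossing * bool * bool
}.

Section Diagram.
Variable D : pd_code.

Definition dart : finType := (crossing D * bool * bool)%type.
Implicit Types d : dart.

Definition cross d : crossing D := d.1.1.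
Definition over d : bool := d.1.2.
Definition outgoing d : bool := d.2.

Definition over_in (c : crossing D) : dart := (c, true, false).
Definition over_out (c : crossing D) : dart := (c, true, true).

(* The next end counter-clockwise at the same crossing. With both strands     *)
(* pointing up, the ends are, counter-clockwise from the lower left,          *)
(*   positive: over-in, under-in, over-out, under-out;                        *)
(*   negative: under-in, over-in, under-out, over-out.                        *)
Definition rot d : dart :=
  (cross d, ~~ over d,
   if positive (cross d) == over d then outgoing d else ~~ outgoing d).

(* face walks along the boundary of the region to the left of d, as seen when *)
(* leaving the crossing through d: follow the arc, then turn left, i.e. take  *)
(* the next end clockwise (rot has order 4).                                  *)
Definition face d : dart := iter 3 rot (glue d).

(* A region is the set of its corners; the corner between d and rot d is      *)
(* recorded by d.                                                             *)
Definition region d : {set dart} := [set d' | fconnect face d d'].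

Definition linked : rel dart :=
  [rel d d' | (cross d == cross d') || (d' == glue d)].

(* The last clause is Euler's formula: the underlying 4-valent graph lies in  *)
(* the sphere (in one sphere for each connected component).                   *)
Definition link_diagram : Prop :=
  [/\ involutive (@glue D),
      forall d, outgoing (glue d) = ~~ outgoing d
    & (#|crossing D| + fcard face {: dart} =
       fcard (@glue D) {: dart} + 2 * n_comp linked {: dart})%N].

(* A diagram of a non-split link is connected; conversely, a connected        *)
(* alternating diagram represents a non-split link (Menasco).                 *)
Definition connected_diagram : Prop := forall d d', connect linked d d'.

Definition alternating : Prop := forall d, over (glue d) = ~~ over d.

(* Rotate a crossing so that the overstrand runs from lower left to upper     *)
(* right. The top and bottom corners are those that follow an over end        *)
(* counter-clockwise, so these are the shaded ones; in an alternating diagram *)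
(* all the corners of a region agree. The crossingless diagram has one shaded *)
(* and one unshaded region, neither of which has corners.                     *)
Definition regions (shaded : bool) : {set {set dart}} :=
  if #|crossing D| == 0%N then [set set0]
  else [set region d | d : dart & over d == shaded].

End Diagram.

(* Digraphs with signed edges embedded in the sphere: edge e runs from src e  *)
(* to tgt e, with the face lface e on its left and rface e on its right.      *)
Record plane_digraph := PlaneDigraph {
  vsort : finType;
  esort : finType;
  fsort : finType;
  vertices : {set vsort};
  faces : {set fsort};
  src : esort -> vsort;
  tgt : esort -> vsort;
  lface : esort -> fsort;
  rface : esort -> fsort;
  epos : pred esort
}.

Section PlaneDigraph.
Variable G : plane_digraph.
Implicit Types (S T C : {set esort G}) (e : esort G).
Implicit Types (u v r : vsort G) (f g q : fsort G).

Definition adj S : rel (vsort G) :=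
  [rel u v | [exists e in S,
     ((src e == u) && (tgt e == v)) || ((src e == v) && (tgt e == u))]].

Definition degree S v : nat :=
  (#|[set e in S | src e == v]| + #|[set e in S | tgt e == v]|)%N.

Definition is_cycle C : bool :=
  [&& C != set0,
      [forall v, (degree C v == 0%N) || (degree C v == 2%N)]
    & [forall e in C, forall e' in C, connect (adj C) (src e) (src e')]].

Definition spanning_tree T : bool :=
  [forall u in vertices G, forall v in vertices G, connect (adj T) u v] &&
  [forall C : {set esort G}, is_cycle C ==> ~~ (C \subset T)].

Definition Cyc T e : {set esort G} :=
  odflt set0 [pick C : {set esort G} | is_cycle C && (C \subset e |: T)].

(* Two faces lie on the same side of a cycle C iff they are joined by a path  *)
(* in the sphere that meets the graph only in edges outside C.                *)
Definition dual_adj C : rel (fsort G) :=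
  [rel f g | [exists e, (e \notin C) &&
     (((lface e == f) && (rface e == g)) || ((lface e == g) && (rface e == f)))]].

Definition same_side C f g : bool := connect (dual_adj C) f g.

Definition int_active r T e : bool := connect (adj (T :\ e)) r (src e).

(* The orientation of Cyc T e that has q on its left agrees with e iff the    *)
(* face to the left of e is on the same side as q.                            *)
Definition ext_active q T e : bool := same_side (Cyc T e) q (lface e).

Definition iota_pos r T : nat :=
  #|[set e in T | epos e & int_active r T e]|.
Definition iotabar_pos r T : nat :=
  #|[set e in T | epos e & ~~ int_active r T e]|.
Definition eps_neg q T : nat :=
  #|[set e in ~: T | ~~ epos e & ext_active q T e]|.
Definition epsbar_neg q T : nat :=
  #|[set e in ~: T | ~~ epos e & ~~ ext_active q T e]|.

(* For a connected graph; without edges, its only face surrounds its only     *)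
(* vertex.                                                                    *)
Definition on_boundary r q : bool :=
  (#|esort G| == 0%N) ||
  [exists e, ((src e == r) || (tgt e == r)) && ((lface e == q) || (rface e == q))].

Definition tree_poly (F : fieldType) r q (x y z w : F) : F :=
  (\sum_(T : {set esort G} | spanning_tree T)
     x ^- iota_pos r T * y ^- iotabar_pos r T *
     z ^+ eps_neg q T * w ^+ epsbar_neg q T)%R.

End PlaneDigraph.

(* Turn a crossing so that the directed overstrand runs from lower left to    *)
(* upper right. Its bottom, right, top and left corners follow the            *)
(* lower left (over_in), lower right, upper right (over_out) and upper left   *)
(* ends. As the Tait digraph of a connected diagram is connected, each of its *)
(* faces contains exactly one unshaded region, which stands for it.           *)
Definition tait (D : pd_code) : plane_digraph := {|
  vertices := regions D true;
  faces := regions D false;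
  src := fun c : crossing D => region (over_in c);
  tgt := fun c => region (over_out c);
  lface := fun c => region (rot (over_out c));
  rface := fun c => region (rot (over_in c));
  epos := @positive D
|}.

Local Open Scope ring_scope.

(* Laurent polynomials over int live in the field of rational functions.      *)
Definition tvar : {fraction {poly int}} := tofrac 'X.

(* f is the sum over j of (a j) * t ^ j, the support of a being finite.       *)
Definition laurent_coefs (f : {fraction {poly int}}) (a : int -> int) : Prop :=
  exists n : nat,
    (forall j : int, (n < `|j|)%N -> a j = 0) /\
    f = \sum_(k < n.*2.+1) (a (k%:Z - n%:Z))%:~R * tvar ^ (k%:Z - n%:Z).

(* s lists the a j with j odd (resp. even) from the smallest to the largest   *)
(* such j with a j != 0; s is empty if there are none.                        *)
Definition parity_seq (isodd : bool) (a : int -> int) (s : seq int) : Prop :=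
  exists m : int,
    [/\ odd `|m|%N = isodd,
        s = mkseq (fun k => a (m + (2 * k)%N%:Z)) (size s),
        forall j : int, odd `|j|%N = isodd -> a j != 0 ->
          exists2 k : nat, (k < size s)%N & j = m + (2 * k)%N%:Z
      & s != [::] -> head 0 s != 0 /\ last 0 s != 0].

Definition trapezoidal (s : seq int) : Prop :=
  (forall k : nat, 0 <= s`_k) /\
  (s = [::] \/
   exists i1 i2 : nat,
     [/\ (i1 <= i2 < size s)%N,
         forall k : nat, (k < i1)%N -> s`_k < s`_k.+1,
         forall k : nat, (i1 <= k < i2)%N -> s`_k = s`_k.+1
       & forall k : nat, (i2 <= k)%N -> (k.+1 < size s)%N -> s`_k > s`_k.+1]).

(* The a and s are uniquely determined by f.                                  *)
Definition trapezoidal_coefs (isodd : bool) (f : {fraction {poly int}}) : Prop :=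
  exists (a : int -> int) (s : seq int),
    [/\ laurent_coefs f a, parity_seq isodd a s & trapezoidal s].

(* Main.v *)
(* Rooting a spanning tree at [r] orients its edges towards [r]; the exponent of t is then the
   number of edges of one sign traversed backwards minus the number of those traversed forwards.
   Going around a region of an alternating diagram, one sees that the edges of this sign form an
   Eulerian digraph; the other edges only matter as undirected ones. For (3) and (4) the same
   holds in the dual graph, where the complements of the spanning trees are spanning trees and
   the signs are exchanged.

   So let phi be the sum of X^(number of backward steps) over the rooted spanning trees of a
   connected Eulerian digraph with n + 1 vertices and N edges other than loops. It does not depend
   on the root, and counting graphs with a single cycle in two ways gives
     N (1 - X) phi = sum over K of (a - b) (X^b - X^a) phi_(G/K),
   over the cycles K with a forward and b < a backward steps. By induction phi_(G/K) is
   palindromic and unimodal, so all summands contribute nonnegatively to the increments of phi up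
   to degree n / 2. Once the increment vanishes it stays zero, unless a cycle K with b backward
   steps first contributes in degree b; but then the increment in degree b - 1 was already
   positive, because a directed ear attached to K gives a shorter cycle to contract. Deletion and
   contraction reduce undirected edges to this case: the trees with l undirected edges give a
   trapezoidal sequence of length n - l + 1, and all these sequences, for l of fixed parity, have
   the same centre. *)

Require Import Defs.
From HB Require Import structures.
From mathcomp Require Import all_boot all_order all_algebra.
From mathcomp Require Import zify.

Set Implicit Arguments.
Unset Strict Implicit.
Unset Printing Implicit Defensive.

Import Order.TTheory GRing.Theory Num.Theory.

Local Open Scope ring_scope.

(** * Rooted forests *)

(** A rooted tree is stored as its set of steps towards the root, so that its statistic is a product
    of step weights. The cycle identity comes from functional graphs with one cycle and a marked
    step on it, weighted by the sign of that step. Opening the graph at the marked step gives a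
    rooted tree; removing the whole cycle gives a forest rooted on it, that is, a tree of G/K. The
    factor N (1 - X) is the sum of sign times weight over all steps, and it splits off because all
    roots give the same polynomial; X^b - X^a arises by pairing K with its reverse.

    Symmetry and unimodality pass through this identity easily. The obstacle is flatness: a cycle
    with b > 0 might start to contribute when the sum has already stopped growing. Excluding this
    requires strict increments in the contracted graphs, so the induction carries two further
    clauses, in the degrees b - 1 and b.

    With undirected edges, the sequences for l, l + 2, ... are added around a common centre. A
    skipped l could put an increase after a plateau, so the l that occur are shown to form an
    interval. *)

Section Steps.
Variables (V E : finType) (s t : E -> V).
Implicit Types (A : {set E}) (X : {set V}) (P U K : {set E * bool}).
Implicit Types (d : E * bool) (u v : V).

(* A step [(e, b)] traverses the edge [e], forwards iff [b]; [rv] traverses it the other way. *)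
Definition rv d : E * bool := (d.1, ~~ d.2).
Definition fr d : V := if d.2 then s d.1 else t d.1.
Definition to d : V := fr (rv d).

Definition live A : {set E * bool} := [set d | (d.1 \in A) && (fr d != to d)].

Definition nxt P : rel V := [rel u v | [exists d in P, (fr d == u) && (to d == v)]].

(** Acyclicity is implied: steps out of a vertex are unique, so a vertex on a directed cycle could
    never reach [X], where no step starts. *)
Definition forest A X P : bool :=
  [&& P \subset live A,
      [forall v, #|[set d in P | fr d == v]| == (v \notin X)]
    & [forall v, [exists x in X, connect (nxt P) v x]]].

(** A functional graph in which every walk leads to [v]; it has exactly one cycle, and [v] lies on
    it. *)
Definition unicyc A U v : bool :=
  [&& U \subset live A, [forall u, #|[set d in U | fr d == u]| == 1%N]
    & [forall u, connect (nxt U) u v]].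

(** Consisting of steps and not of edges, a cycle may go back and forth along one edge. Such a cycle
    has one step of each direction and drops out of the signed sums. *)
Definition cyc A K : bool :=
  [&& K != set0, K \subset live A,
      [forall d in K, forall d' in K, (fr d == fr d') ==> (d == d')],
      [forall d in K, exists d' in K, fr d' == to d]
    & [forall d in K, forall d' in K, connect (nxt K) (fr d) (fr d')]].

Lemma rvK : involutive rv.
Proof. by case=> e b; rewrite /rv negbK. Qed.

Lemma to_rv d : to (rv d) = fr d.
Proof. by rewrite /to rvK. Qed.

Lemma nxtP P u v :
  reflect (exists d, [/\ d \in P, fr d = u & to d = v]) (nxt P u v).
Proof.
apply: (iffP existsP) => [[d /andP[dP /andP[/eqP du /eqP dv]]]|[d [dP <- <-]]].
  by exists d.
by exists d; rewrite dP !eqxx.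
Qed.

Lemma nxt_step P d : d \in P -> nxt P (fr d) (to d).
Proof. by move=> dP; apply/nxtP; exists d. Qed.

Lemma sub_nxt P U u v : P \subset U -> connect (nxt P) u v -> connect (nxt U) u v.
Proof.
move=> /subsetP PU; apply: connect_sub => x y /nxtP[d [dP <- <-]].
by apply/connect1/nxt_step/PU.
Qed.

Lemma forestP A X P : reflect
  [/\ P \subset live A, forall v, #|[set d in P | fr d == v]| = (v \notin X)
    & forall v, exists2 x, x \in X & connect (nxt P) v x] (forest A X P).
Proof.
apply: (iffP and3P) => -[PA cP rP]; split => //.
- by move=> v; apply/eqP/(forallP cP).
- by move=> v; have /existsP[x /andP[]] := forallP rP v; exists x.
- by apply/forallP => v; apply/eqP.
- by apply/forallP => v; have [x xX c] := rP v; apply/existsP; exists x; rewrite xX.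
Qed.

Lemma unicycP A U v : reflect
  [/\ U \subset live A, forall u, #|[set d in U | fr d == u]| = 1%N
    & forall u, connect (nxt U) u v] (unicyc A U v).
Proof.
apply: (iffP and3P) => -[PA cP rP]; split => //.
- by move=> u; apply/eqP/(forallP cP).
- exact/forallP.
- by apply/forallP => u; apply/eqP.
- exact/forallP.
Qed.

Lemma cycP A K : reflect
  [/\ K != set0, K \subset live A, {in K &, injective fr},
      forall d, d \in K -> exists2 d', d' \in K & fr d' = to d
    & {in K &, forall d d', connect (nxt K) (fr d) (fr d')}] (cyc A K).
Proof.
apply: (iffP and5P) => -[K0 KA iK cK rK]; split => //.
- move=> d d' dK d'K /eqP e.
  by apply/eqP; move/forall_inP/(_ _ dK)/forall_inP/(_ _ d'K)/implyP: iK; apply.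
- by move=> d dK; have /exists_inP[d' d'K /eqP] := forall_inP cK d dK; exists d'.
- by move=> d d' dK d'K; move/forall_inP/(_ _ dK)/forall_inP/(_ _ d'K): rK.
- by apply/forall_inP => d dK; apply/forall_inP => d' d'K; apply/implyP => /eqP e; apply/eqP/iK.
- by apply/forall_inP => d /cK[d' d'K e]; apply/exists_inP; exists d' => //; apply/eqP.
- by apply/forall_inP => d dK; apply/forall_inP => d' d'K; apply: rK.
Qed.

Lemma fiber1 P v : #|[set d in P | fr d == v]| = 1%N ->
  exists2 d, d \in P /\ fr d = v & forall d', d' \in P -> fr d' = v -> d' = d.
Proof.
move/eqP/cards1P => [d e].
have := set11 d; rewrite -e inE => /andP[dP /eqP dv].
exists d => // d' d'P d'v; apply/set1P; rewrite -e inE d'P d'v eqxx //.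
Qed.

Lemma fiberU P U v : [disjoint P & U] ->
  #|[set d in P :|: U | fr d == v]| =
  (#|[set d in P | fr d == v]| + #|[set d in U | fr d == v]|)%N.
Proof.
move=> dis; rewrite -cardsUI -[LHS]addn0; congr (_ + _)%N.
  by apply: eq_card => d; rewrite !inE andb_orl.
apply/esym/eqP; rewrite cards_eq0 -subset0; apply/subsetP => d.
rewrite !inE => /andP[/andP[dP _] /andP[dU _]].
by move: dis; rewrite -setI_eq0 => /eqP/setP/(_ d); rewrite !inE dP dU.
Qed.

(** The walk from the end of a step back to its start is non-empty, and its last step enters that
    start. So every start is an end, and counting against the injective [fr] does the rest. *)
Lemma cyc_img A K : cyc A K ->
  {in K &, injective to} /\ to @: K = fr @: K.
Proof.
case/cycP => _ KA iK cK rK.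
have sub : fr @: K \subset to @: K.
  apply/subsetP => v /imsetP[d dK ->].
  have [d1 d1K e1] := cK _ dK.
  have := rK _ _ d1K dK; rewrite e1 => /connectP[p].
  case/lastP: p => [/= _ e|p x].
    by move/subsetP: KA => /(_ _ dK); rewrite inE e eqxx andbF.
  rewrite rcons_path last_rcons => /andP[_ /nxtP[d2 [d2K _ d2x]]] ->.
  by apply/imsetP; exists d2.
have cE : #|to @: K| = #|K|.
  by apply/eqP; rewrite eqn_leq leq_imset_card -(card_in_imset iK) subset_leq_card.
split; first by apply/imset_injP; rewrite cE.
by apply/eqP; rewrite eq_sym eqEcard sub cE (card_in_imset iK) leqnn.
Qed.

Lemma cyc_rv A K : cyc A K -> cyc A (rv @: K).
Proof.
move=> cK; have [iT e] := cyc_img cK; case/cycP: (cK) => K0 KA iK nK rK; apply/cycP; split.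
- by rewrite imset_eq0.
- apply/subsetP => _ /imsetP[d /(subsetP KA) + ->]; rewrite !inE to_rv -/(to d) => /andP[-> h].
  by rewrite eq_sym.
- by move=> _ _ /imsetP[d dK ->] /imsetP[d' d'K ->] /iT ->.
- move=> _ /imsetP[d dK ->]; rewrite to_rv.
  have : fr d \in to @: K by rewrite e imset_f.
  by case/imsetP => d' d'K ->; exists (rv d') => //; rewrite imset_f.
- move=> _ _ /imsetP[d dK ->] /imsetP[d' d'K ->]; rewrite -!/(to _).
  have [d1 d1K <-] := nK _ dK; have [d2 d2K <-] := nK _ d'K.
  have : connect [rel x y | nxt K y x] (fr d1) (fr d2) by rewrite connect_rev /= rK.
  rewrite (@eq_connect _ _ (nxt (rv @: K))) // => x y /=.
  apply/idP/idP => /nxtP[d3 [d3K <- <-]].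
    by rewrite -to_rv; apply/nxt_step/imset_f.
  by case/imsetP: d3K => d4 d4K ->; rewrite to_rv; apply: nxt_step.
Qed.

Lemma fr_rv_cyc A K : cyc A K -> fr @: (rv @: K) = fr @: K.
Proof.
move=> cK; have [_ <-] := cyc_img cK.
by rewrite -imset_comp.
Qed.

(** The walk is cut at its first visit to [Y]. *)
Lemma connect_avoid (Y : pred V) P U u v :
  (forall d, d \in U -> ~~ Y (fr d) -> d \in P) ->
  connect (nxt U) u v -> Y v -> exists2 y, Y y & connect (nxt P) u y.
Proof.
move=> h /connectP[p pth ->] {v}.
elim: p u pth => [|x p IH] u /=; first by move=> _ Yu; exists u.
case/andP => /nxtP[d [dU <- <-]] pth /(IH _ pth)[y Yy c].
have [Yd|nYd] := boolP (Y (fr d)); first by exists (fr d).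
by exists y => //; apply: connect_trans c; apply/connect1/nxt_step/h.
Qed.

(** A step out of the root closes a cycle through it. Together with [unicyc_forest] this is a
    bijection. *)
Lemma forest_unicyc A v P d :
  forest A [set v] P -> d \in live A -> fr d = v -> unicyc A (d |: P) v /\ d \notin P.
Proof.
case/forestP => PA cP rP dA dv.
have dP : d \notin P.
  apply/negP => dP; have := cP v; rewrite set11 => /eqP; rewrite cards_eq0 => /eqP/setP/(_ d).
  by rewrite !inE dP dv eqxx.
split=> //; apply/unicycP; split.
- by rewrite subUset sub1set dA.
- move=> u; rewrite fiberU ?disjoints1 // cP inE.
  have -> : #|[set d' in [set d] | fr d' == u]| = (u == v).
    rewrite eq_sym -dv; case: eqVneq => [<-|ne] /=.
      rewrite -(cards1 d); apply: eq_card => d'; rewrite !inE.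
      by case: eqP => // ->; rewrite eqxx.
    apply/eqP; rewrite cards_eq0; apply/eqP/setP => d'; rewrite !inE.
    by case: eqP => // ->; apply/negbTE.
  by case: eqP.
- by move=> u; have [x /set1P -> c] := rP u; apply: sub_nxt c; apply: subsetU1.
Qed.

Lemma unicyc_forest A v U d :
  unicyc A U v -> d \in U -> fr d = v -> forest A [set v] (U :\ d).
Proof.
case/unicycP => UA cU rU dU dv; apply/forestP; split.
- by apply: subset_trans UA; apply: subsetDl.
- move=> u; have := cU u; rewrite -{1}(setD1K dU) fiberU; last first.
    by rewrite disjoints1 !inE eqxx.
  rewrite inE; case: eqVneq => [->|ne] /=; last first.
    have -> : [set d' in [set d] | fr d' == u] = set0.
      apply/setP => d'; rewrite !inE; case: eqP => // ->; rewrite dv eq_sym.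
      exact/negbTE.
    by rewrite cards0.
  have -> : [set d' in [set d] | fr d' == v] = [set d].
    by apply/setP => d'; rewrite !inE; case: eqP => // ->; rewrite dv eqxx.
  by rewrite cards1 => -[].
- move=> u; apply: (@connect_avoid (mem [set v]) (U :\ d) U u v _ (rU u) (set11 v)).
  by move=> d' d'U; rewrite /= !inE d'U andbT; apply: contra => /eqP ->; rewrite dv.
Qed.

(** All walks lead to [fr d] exactly when it lies on the cycle. *)
Definition cycof A U : {set E * bool} := [set d in U | unicyc A U (fr d)].

Lemma unicyc_next A U d : d \in U -> unicyc A U (fr d) -> unicyc A U (to d).
Proof.
move=> dU /unicycP[UA cU rU]; apply/unicycP; split=> // u.
by apply: connect_trans (rU u) _; apply/connect1/nxt_step.
Qed.

Lemma cycof_cyc A U : cycof A U != set0 -> cyc A (cycof A U).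
Proof.
move=> K0; have [d0] := set0Pn _ K0; rewrite inE => /andP[_ /unicycP[UA cU _]].
apply/cycP; split => //.
- by apply: subset_trans UA; apply/subsetP => d; rewrite inE => /andP[].
- move=> d d'; rewrite !inE => /andP[dU _] /andP[d'U _] e.
  have [d1 _ h] := fiber1 (cU (fr d)).
  exact: etrans (h d dU erefl) (esym (h d' d'U (esym e))).
- move=> d; rewrite inE => /andP[dU ud].
  have [d1 [d1U e1] _] := fiber1 (cU (to d)).
  by exists d1; rewrite // inE d1U e1 (unicyc_next dU).
- move=> d d'; rewrite !inE => /andP[dU ud] /andP[d'U /unicycP[_ _ /(_ (fr d))]].
  case/connectP => p + ->; move: ud; move: (fr d) => {d dU} u.
  elim: p u => [|x p IH] u uu /=; first by rewrite connect0.
  case/andP => /nxtP[d [dU du dx]] pth.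
  apply: connect_trans (IH x _ pth).
    by rewrite -du -dx; apply/connect1/nxt_step; rewrite inE dU du.
  by rewrite -dx; apply: unicyc_next => //; rewrite du.
Qed.

(** Hanging a forest on a cycle creates no other cycle. With [cycof_forest], this decomposes
    functional graphs according to their cycle. *)
Lemma cycofU A K P : cyc A K -> forest A (fr @: K) P ->
  [disjoint K & P] /\ cycof A (K :|: P) = K.
Proof.
move=> cK /forestP[PA cP rP]; case/cycP: (cK) => K0 KA iK nK rK.
have PK d : d \in P -> fr d \notin fr @: K.
  move=> dP; apply/negP => fK; have := cP (fr d); rewrite fK => /eqP.
  by rewrite cards_eq0 => /eqP/setP/(_ d); rewrite !inE dP eqxx.
have dis : [disjoint K & P].
  rewrite -setI_eq0; apply/eqP/setP => d; rewrite !inE; apply/negP => /andP[dK /PK].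
  by rewrite imset_f.
have uK d : d \in K -> unicyc A (K :|: P) (fr d).
  move=> dK; apply/unicycP; split.
  - by rewrite subUset KA.
  - move=> u; rewrite fiberU // cP; case: (boolP (u \in fr @: K)) => [/imsetP[d1 d1K ->]|uK].
      rewrite addn0 -(cards1 d1); apply: eq_card => d2; rewrite !inE.
      by apply/andP/eqP => [[d2K /eqP /iK -> //]|->]; rewrite d1K eqxx.
    rewrite [X in (X + _)%N](_ : _ = 0%N) //.
    apply/eqP; rewrite cards_eq0; apply/eqP/setP => d1; rewrite !inE.
    by apply: contraNF uK => /andP[d1K /eqP <-]; rewrite imset_f.
  - move=> u; have [x /imsetP[d1 d1K ->] c] := rP u.
    apply: connect_trans (sub_nxt (subsetUr _ _) c) _.
    by apply: sub_nxt (subsetUl _ _) _; apply: rK.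
split=> //; apply/setP => d; rewrite !inE.
(* A step of [P] on the cycle would be reachable from [K], but walks that start on [K] stay
   there. *)
have [dK|dK] := boolP (d \in K); first by rewrite uK.
apply/negP => /= /andP[dP /unicycP[_ _ r]].
have [d0 d0K] := set0Pn _ K0.
have : fr d0 \in fr @: K by rewrite imset_f.
have /connectP[p + e] := r (fr d0); move: e; move: (fr d0) => u.
elim: p u => [|x p IH] u /= e; first by move=> _; rewrite -e => fK; have := PK _ dP; rewrite fK.
case/andP => /nxtP[d1 [+ <- d1x]] pth fK; rewrite inE => /orP[d1K|d1P]; last first.
  by have := PK _ d1P; rewrite fK.
by apply: IH pth _ => //; rewrite -d1x; have [d2 d2K <-] := nK _ d1K; rewrite imset_f.
Qed.

Lemma cycof_forest A U K : K != set0 -> cycof A U = K -> forest A (fr @: K) (U :\: K).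
Proof.
move=> K0 e; have [d0] := set0Pn _ K0; rewrite -e inE => /andP[d0U ud0].
have /unicycP[UA cU r] := ud0; rewrite e.
have fK d : d \in U -> fr d \in fr @: K -> d \in K.
  move=> dU /imsetP[d1 d1K ed]; have [d2 _ h] := fiber1 (cU (fr d)).
  have d1U : d1 \in U by move: d1K; rewrite -e inE => /andP[].
  by rewrite (h d dU erefl) -(h d1 d1U (esym ed)).
have KU : K \subset U by rewrite -e; apply/subsetP => d; rewrite inE => /andP[].
apply/forestP; split.
- by apply: subset_trans UA; apply: subsetDl.
- move=> u; case: (boolP (u \in fr @: K)) => /= uK; last first.
    rewrite -(cU u); apply: eq_card => d; rewrite !inE.
    have [dK|//] := boolP (d \in K); apply/esym/negbTE; apply: contra uK.
    by case/andP => _ /eqP <-; rewrite imset_f.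
  apply/eqP; rewrite cards_eq0; apply/eqP/setP => d; rewrite !inE.
  apply/negP => /andP[/andP[dK dU] /eqP du]; case/negP: dK; apply: fK => //.
  by rewrite du.
- move=> u; have d0K : fr d0 \in fr @: K by rewrite imset_f // -e inE d0U.
  have := @connect_avoid (mem (fr @: K)) (U :\: K) U u (fr d0) _ (r u) d0K.
  apply=> d dU; rewrite /= inE dU andbT; apply: contra => dK.
  by rewrite imset_f.
Qed.

(** * Weighted double counting of functional graphs *)

Section Weights.
Variables (R : comNzRingType) (w : E * bool -> R).

Definition forest_sum A X : R := \sum_(P | forest A X P) \prod_(d in P) w d.

Lemma unicyc_sum A v (h : E * bool -> R) :
  \sum_(d in live A | fr d == v) h d * (w d * forest_sum A [set v]) =
  \sum_(U | unicyc A U v) \sum_(d in U | fr d == v) h d * \prod_(d' in U) w d'.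
Proof.
rewrite (exchange_big_dep (fun d => (d \in live A) && (fr d == v))) /=; last first.
  move=> U d /unicycP[UA _ _] /andP[dU ->]; rewrite andbT.
  exact: (subsetP UA).
apply: eq_bigr => d /andP[dA /eqP dv]; rewrite /forest_sum !mulr_sumr.
rewrite [RHS](reindex_onto (fun P => d |: P) (fun U => U :\ d)) /=; last first.
  by move=> U /andP[_ /andP[dU _]]; rewrite setD1K.
apply: eq_big => [P|P fP]; last first.
  have [_ dP] := forest_unicyc fP dA dv.
  by rewrite big_setU1.
apply/idP/andP => [fP|].
  have [-> dP] := forest_unicyc fP dA dv; split; first by rewrite setU11 dv eqxx.
  by rewrite setU1K.
case=> /andP[uU _] /eqP <-; apply: unicyc_forest uU _ dv; exact: setU11.
Qed.

(** Both sides sum over functional graphs with a marked step on their cycle: the left side opens the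
    graph at this step, the right side splits off the whole cycle. *)
Lemma cycle_sum A (h : E * bool -> R) :
  \sum_v \sum_(d in live A | fr d == v) h d * (w d * forest_sum A [set v]) =
  \sum_(K | cyc A K) (\sum_(d in K) h d) * (\prod_(d in K) w d) * forest_sum A (fr @: K).
Proof.
under eq_bigr do rewrite unicyc_sum.
rewrite (exchange_big_dep xpredT) //=.
transitivity (\sum_U (\sum_(d in cycof A U) h d) * \prod_(d in U) w d).
  apply: eq_bigr => U _; rewrite mulr_suml.
  rewrite (exchange_big_dep (mem (cycof A U))) /=; last first.
    by move=> v d uU /andP[dU /eqP e]; rewrite inE dU e.
  apply: eq_bigr => d; rewrite inE => /andP[dU uU].
  rewrite (big_pred1 (fr d)) // => v /=; rewrite dU eq_sym andbC /=.
  by case: eqP => //= ->.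
rewrite (partition_big (cycof A) xpredT) //= (bigID (cyc A)) /= [X in _ + X]big1 ?addr0; last first.
  move=> K nK; rewrite big1 // => U /eqP e.
  have [K0|K0] := eqVneq K set0; first by rewrite e K0 big_set0 mul0r.
  by case/negP: nK; rewrite -e; apply: cycof_cyc; rewrite e.
apply: eq_bigr => K cK; rewrite -mulrA /forest_sum !mulr_sumr.
have K0 : K != set0 by case/cycP: cK.
rewrite (reindex_onto (fun P => K :|: P) (fun U => U :\: K)) /=; last first.
  move=> U /eqP e; rewrite setDE setUIr setUCr setIT; apply/setUidPr.
  by rewrite -e; apply/subsetP => d; rewrite inE => /andP[].
apply: eq_big => [P|P fP].
  apply/andP/idP => [[/eqP e /eqP <-]|fP]; first exact: cycof_forest.
  have [dis ->] := cycofU cK fP; split=> //.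
  by rewrite setDUl setDv set0U; apply/eqP/setDidPl; rewrite disjoint_sym.
have e : cycof A (K :|: P) = K by case/andP: fP => /eqP.
have dis : [disjoint K & P].
  case/andP: fP => _ /eqP <-; rewrite disjoint_sym -setI_eq0 setIC.
  by apply/eqP/setP => d; rewrite !inE; case: (d \in K).
rewrite e; congr (_ * _); rewrite -bigU //=.
by apply: eq_bigl => d; rewrite !inE.
Qed.

(** The balance equation of the Markov chain tree theorem. Both sides sum over functional graphs
    whose cycle passes through [v]; the left side removes the cycle step into [v], the right side
    the step out of [v]. *)
Lemma harmonic A v :
  \sum_(d in live A | to d == v) w d * forest_sum A [set fr d] =
  (\sum_(d in live A | fr d == v) w d) * forest_sum A [set v].
Proof.
rewrite mulr_suml.
transitivity (\sum_(U | unicyc A U v) \prod_(d in U) w d); last first.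
  have := unicyc_sum A v (fun=> 1); under eq_bigr do rewrite mul1r.
  move=> ->; apply: eq_bigr => U /unicycP[_ cU _].
  rewrite -mulr_suml sumr_const (_ : #|_| = 1%N) ?mul1r // -(cU v).
  by apply: eq_card => d; rewrite !inE.
transitivity (\sum_(d | (d \in live A) && (to d == v))
   \sum_(U | unicyc A U (fr d) && (d \in U)) \prod_(d' in U) w d').
  apply: eq_bigr => d /andP[dA _]; rewrite /forest_sum mulr_sumr.
  rewrite [RHS](reindex_onto (fun P => d |: P) (fun U => U :\ d)) /=; last first.
    by move=> U /andP[_ dU]; rewrite setD1K.
  apply: eq_big => [P|P fP]; last first.
    have [_ dP] := forest_unicyc fP dA erefl.
    by rewrite big_setU1.
  apply/idP/andP => [fP|].
    have [-> dP] := forest_unicyc fP dA erefl; split; first by rewrite setU11.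
    by rewrite setU1K.
  case=> /andP[uU _] /eqP <-; apply: unicyc_forest uU _ erefl; exact: setU11.
rewrite (exchange_big_dep (unicyc A ^~ v)) /=; last first.
  by move=> d U /andP[_ /eqP <-] /andP[uU dU]; apply: unicyc_next.
(* The cycle of [U] enters [v] exactly once, so each [U] is counted once. *)
apply: eq_bigr => U uU; rewrite sumr_const (_ : #|_| = 1%N) //.
have /unicycP[UA cU _] := uU.
have [d0 [d0U e0] _] := fiber1 (cU v).
have d0K : d0 \in cycof A U by rewrite inE d0U e0.
have cK : cyc A (cycof A U) by apply: cycof_cyc; apply/set0Pn; exists d0.
have [iT e] := cyc_img cK.
have : fr d0 \in to @: cycof A U by rewrite e imset_f.
case/imsetP => d1 d1K; rewrite e0 => e1.
rewrite -(cards1 d1); apply: eq_card => d; rewrite !inE unfold_in.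
apply/idP/eqP => [/andP[/andP[dA /eqP dv] /andP[uf dU]]|->]; last first.
  move: d1K; rewrite inE -e1 eqxx => /andP[d1U ->]; rewrite d1U (subsetP UA) //.
by apply: iT => //; [rewrite inE dU uf | rewrite dv e1].
Qed.

End Weights.
End Steps.
Arguments rv {E} d.

(** * Contraction and change of root *)

Section Contraction.
Variables (V E : finType) (s t : E -> V) (X : {set V}).
Implicit Types (A : {set E}) (P : {set E * bool}).

(** [None] is the vertex to which [X] shrinks. The edge type stays the same; edges inside [X] become
    loops, which [live] discards. *)
Definition ctr (v : V) : option {v | v \notin X} := insub v.
Let s' := fun e => ctr (s e).
Let t' := fun e => ctr (t e).

Lemma ctr_in v : v \in X -> ctr v = None.
Proof. by move=> vX; rewrite /ctr insubF ?vX. Qed.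

Lemma ctr_inj u v : v \notin X -> ctr u = ctr v -> u = v.
Proof.
move=> vX; rewrite /ctr (insubT (fun v => v \notin X) vX).
by case: insubP => // z _ <- [->].
Qed.

Lemma ctr_None v : (ctr v == None) = (v \in X).
Proof.
have [/ctr_in ->|vX] := boolP (v \in X); first by rewrite eqxx.
by rewrite /ctr (insubT (fun v => v \notin X) vX).
Qed.

Lemma ctr_val (v : {v | v \notin X}) : ctr (val v) = Some v.
Proof. by rewrite /ctr valK. Qed.

Lemma card_ctr : #|{: option {v | v \notin X}}| = (#|V| - #|X|).+1.
Proof.
rewrite card_option card_sig -(cardsC X) addKn; congr _.+1.
by apply: eq_card => v; rewrite !inE.
Qed.

Lemma fr_ctr d : fr s' t' d = ctr (fr s t d).
Proof. by case: d => e []. Qed.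

Lemma to_ctr d : to s' t' d = ctr (to s t d).
Proof. exact: fr_ctr. Qed.

Lemma nxt_ctr P u v : nxt s t P u v -> nxt s' t' P (ctr u) (ctr v).
Proof. by case/nxtP => d [dP <- <-]; rewrite -fr_ctr -to_ctr; apply: nxt_step. Qed.

Lemma connect_ctr P u v :
  connect (nxt s t P) u v -> connect (nxt s' t' P) (ctr u) (ctr v).
Proof.
case/connectP => p + ->; elim: p u => [|x p IH] u /=; first by rewrite connect0.
by case/andP => /nxt_ctr/connect1 c /IH; apply: connect_trans.
Qed.

Lemma live_ctr A : live s' t' A \subset live s t A.
Proof.
apply/subsetP => d; rewrite !inE fr_ctr to_ctr => /andP[->] /=.
by apply: contra => /eqP ->.
Qed.

Lemma live_ctrP A d :
  (d \in live s' t' A) = (d \in live s t A) && ((fr s t d \notin X) || (to s t d \notin X)).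
Proof.
rewrite !inE fr_ctr to_ctr -andbA; congr (_ && _).
apply/idP/andP => [h|[h1 h2]].
  split; first by apply: contra h => /eqP ->.
  by rewrite -negb_and; apply: contra h => /andP[/ctr_in -> /ctr_in ->].
apply: contra h1 => /eqP e; apply/eqP; case/orP: h2 => [h2|h2]; last exact: ctr_inj.
exact/esym/ctr_inj.
Qed.

(** Steps of a forest start outside [X], where [ctr] is injective, so the same set of steps is a
    tree of the contraction. *)
Lemma forest_ctr A P : X != set0 ->
  forest s' t' A [set None] P = forest s t A X P.
Proof.
case/set0Pn => x0 x0X; apply/forestP/forestP => -[PA cP rP]; split.
- exact: subset_trans PA (live_ctr A).
- move=> v; have [vX|vX] := boolP (v \in X).
    have := cP None; rewrite set11 => /eqP; rewrite cards_eq0 => /eqP/setP h.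
    apply/eqP; rewrite cards_eq0; apply/eqP/setP => d; have := h d.
    rewrite !inE fr_ctr => h1; apply/negP => /andP[dP /eqP dv].
    by move: h1; rewrite dP dv ctr_in ?eqxx.
  have := cP (ctr v); rewrite inE ctr_None vX /= => <-.
  apply: eq_card => d; rewrite !inE fr_ctr; congr (_ && _).
  by apply/eqP/eqP => [->|/ctr_inj->].
- move=> v; have [_ /set1P -> /connectP[p]] := rP (ctr v).
  elim: p v => [|x p IH] v /=.
    by move=> _ /esym/eqP; rewrite ctr_None => vX; exists v.
  case/andP => /nxtP[d [dP]]; rewrite fr_ctr to_ctr => dv <- pth /(IH _ pth)[y yX c].
  have [vX|vX] := boolP (v \in X); first by exists v.
  exists y => //; apply: connect_trans c; apply: connect1.
  by rewrite -(ctr_inj vX dv); apply: nxt_step.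
- apply/subsetP => d dP; rewrite live_ctrP (subsetP PA) //=; apply/orP; left.
  apply/negP => fX; have := cP (fr s t d); rewrite fX => /eqP.
  by rewrite cards_eq0 => /eqP/setP/(_ d); rewrite !inE dP eqxx.
- case=> [v|]; last first.
    rewrite set11; apply/eqP; rewrite cards_eq0; apply/eqP/setP => d; rewrite !inE fr_ctr ctr_None.
    apply/negP => /andP[dP fX]; have := cP (fr s t d); rewrite fX => /eqP.
    by rewrite cards_eq0 => /eqP/setP/(_ d); rewrite !inE dP eqxx.
  rewrite inE -(ctr_val v) ctr_None (valP v); have := cP (val v); rewrite (valP v) => <-.
  apply: eq_card => d; rewrite !inE fr_ctr; congr (_ && _).
  by apply/eqP/eqP => [/ctr_inj->|->] //; apply: (valP v).
- move=> v; exists None; first exact: set11.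
  have [w ->] : exists w, v = ctr w.
    by case: v => [v|]; [exists (val v); rewrite ctr_val | exists x0; rewrite ctr_in].
  by have [x xX /connect_ctr] := rP w; rewrite (ctr_in xX).
Qed.

Lemma forest_sum_ctr (R : comNzRingType) (w : E * bool -> R) A : X != set0 ->
  forest_sum s' t' w A [set None] = forest_sum s t w A X.
Proof. by move=> X0; apply: eq_bigl => P; apply: forest_ctr. Qed.

End Contraction.

(** * Independence of the root by a maximum principle *)

Section RootIndependence.
Variables (V E : finType) (s t : E -> V).
Implicit Types (A : {set E}) (P : {set E * bool}).

Definition conn A : Prop := forall u v, connect (nxt s t (live s t A)) u v.

Lemma live_rv A d : (rv d \in live s t A) = (d \in live s t A).
Proof. by rewrite !inE /to rvK [fr s t d == _]eq_sym. Qed.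

Lemma conn_sym A u v :
  connect (nxt s t (live s t A)) u v -> connect (nxt s t (live s t A)) v u.
Proof.
have cs : connect_sym (nxt s t (live s t A)).
  apply: sym_connect_sym => x y; apply/nxtP/nxtP => -[d [dA <- <-]];
  by exists (rv d); rewrite live_rv /to rvK.
by rewrite cs.
Qed.

Lemma forest_conn A r P : forest s t A [set r] P -> conn A.
Proof.
case/forestP => PA _ rP u v.
have h x : connect (nxt s t (live s t A)) x r.
  by have [_ /set1P ->] := rP x; apply: sub_nxt.
exact: connect_trans (h u) (conn_sym (h v)).
Qed.

Lemma forest_sum_nconn (R : comNzRingType) (w : E * bool -> R) A r :
  forest_sum s t w A [set r] != 0 -> conn A.
Proof.
move=> h; case: (pickP (forest s t A [set r])) => [P /forest_conn //|h0].
by rewrite /forest_sum big_pred0 ?eqxx in h.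
Qed.

(** By [harmonic] and the balance of [w], the value at a vertex is a weighted mean of the values at
    the starts of the steps into it. So a maximum spreads backwards along steps and, in a connected
    graph, everywhere. Without connectivity all values vanish. *)
Lemma forest_sum_root_int (w : E * bool -> int) A u v :
  (forall d, d \in live s t A -> 0 < w d) ->
  (forall x, \sum_(d in live s t A | fr s t d == x) w d =
             \sum_(d in live s t A | to s t d == x) w d) ->
  forest_sum s t w A [set u] = forest_sum s t w A [set v].
Proof.
move=> wpos bal; pose f x := forest_sum s t w A [set x]; rewrite -/(f u) -/(f v).
have f0 x : ~ conn A -> f x = 0.
  by move=> nc; apply/eqP/negPn; apply/negP => /forest_sum_nconn.
suff main : conn A -> forall x, f x = f v.
  have [/forest_sum_nconn/main -> //|/negPn/eqP fu] := boolP (f u != 0).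
  have [/forest_sum_nconn/main -> //|/negPn/eqP -> //] := boolP (f v != 0).
move=> cA.
have [x0 _ max0] := @arg_maxP _ int V v xpredT f isT.
suff {v} h x : f x = f x0 by move=> x; rewrite !h.
have step d : d \in live s t A -> f (to s t d) = f x0 -> f (fr s t d) = f x0.
  move=> dA e; have := harmonic s t w A (to s t d); rewrite -/(f _) bal => /eqP.
  rewrite eq_sym mulr_suml -subr_eq0 -sumrB => /eqP sum0.
  have ge0 d' : (d' \in live s t A) && (to s t d' == to s t d) ->
      0 <= w d' * f (to s t d) - w d' * forest_sum s t w A [set fr s t d'].
    move=> /andP[d'A /eqP d'd]; rewrite -mulrBr mulr_ge0 ?(ltW (wpos _ _)) //.
    by rewrite subr_ge0 -/(f _) e; apply: max0.
  have /eqP := psumr_eq0P ge0 sum0 (introT andP (conj dA (eqxx (to s t d)))).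
  rewrite -mulrBr mulf_eq0 gt_eqF ?wpos //= subr_eq0 => /eqP h.
  by rewrite -e h.
have /connectP[p + e] := cA x x0.
elim: p x e => [|y p IH] x /= e; first by rewrite e.
case/andP => /nxtP[d [dA <- dy]] pth; apply: step => //; rewrite dy; exact: IH.
Qed.

End RootIndependence.

(** * The cycle identity *)

Lemma poly_eq_nat (R : idomainType) (p q : {poly R}) :
  injective (fun n : nat => n%:R : R) ->
  (forall n, p.[n.+1%:R] = q.[n.+1%:R]) -> p = q.
Proof.
move=> injR pq; apply/eqP; rewrite -subr_eq0; apply/eqP.
pose rs := [seq n.+1%:R : R | n <- iota 0 (size (p - q))].
apply: (@roots_geq_poly_eq0 _ _ rs); last by rewrite size_map size_iota.
  by apply/allP => _ /mapP[n _ ->]; rewrite rootE !hornerE pq subrr.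
by rewrite map_inj_uniq ?iota_uniq // => m n /injR[].
Qed.

Lemma forest_sum_rmorph (V E : finType) (s t : E -> V) (R R' : comNzRingType)
    (f : {rmorphism R -> R'}) (w : E * bool -> R) A X :
  f (forest_sum s t w A X) = forest_sum s t (f \o w) A X.
Proof. by rewrite rmorph_sum; apply: eq_bigr => P _; rewrite rmorph_prod. Qed.

Section Weights.
Variables (V E : finType) (s t : E -> V) (pos : pred E).
Implicit Types (A : {set E}) (K P : {set E * bool}).

Definition sg (d : E * bool) : int :=
  if pos d.1 then (if d.2 then 1 else -1) else 0.

(* The edges outside [pos] are undirected; loops cancel in the sum. *)
Definition eulerian A : Prop :=
  forall v, \sum_(d | (d.1 \in A) && (fr s t d == v)) sg d = 0.

(* The inner variable counts backward steps, the outer one steps along undirected edges. *)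
Definition wt (d : E * bool) : {poly {poly int}} :=
  if pos d.1 then (if d.2 then 1 else 'X)%:P else 'X.

Lemma sg_rv d : sg (rv d) = - sg d.
Proof. by case: d => e []; rewrite /sg /=; case: pos; rewrite ?oppr0 ?opprK. Qed.

Lemma eulerian_live A v : eulerian A ->
  \sum_(d in live s t A | fr s t d == v) sg d = 0.
Proof.
move/(_ v); rewrite (bigID (fun d => fr s t d != to s t d)) /=.
rewrite [X in _ + X](_ : _ = 0) ?addr0 => [e|].
  apply: etrans _ e; apply: eq_bigl => d.
  by rewrite !inE -!andbA; congr (_ && _); rewrite andbC.
(* Reversal permutes the steps along loops at [v] and changes their signs. *)
set S := LHS; suff : S = - S.
  by move/eqP; rewrite -addr_eq0 -mulr2n -mulr_natl mulf_eq0 /= => /eqP.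
rewrite {2}/S (reindex_inj (inv_inj (@rvK E))) /= -sumrN; apply: eq_big => d.
  rewrite /to rvK negbK [RHS]andbC [fr s t (rv d) == fr _ _ _]eq_sym negbK.
  by rewrite andbC; case: eqP => //= ->.
by rewrite sg_rv opprK.
Qed.

(** Positive integer values of both variables reduce this to integer weights. These are balanced,
    since the weights of [d] and [rv d] differ by [sg d] times one minus the inner variable. *)
Lemma forest_sum_root A u v : eulerian A -> forest_sum s t wt A [set u] = forest_sum s t wt A [set v].
Proof.
move=> eA; apply: poly_eq_nat => [m n|n].
  by move/eqP; rewrite -!polyC_natr (inj_eq (@polyC_inj _)) eqr_nat => /eqP.
apply: poly_eq_nat => [m n' /eqP|m]; first by rewrite eqr_nat => /eqP.
rewrite -!horner_evalE !forest_sum_rmorph; set w := _ \o _.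
have wE d : w d = if pos d.1 then (if d.2 then 1 else m.+1%:R) else n.+1%:R.
  by rewrite /w /= /wt; case: pos; case: d.2;
     rewrite /= /horner_eval ?hornerC ?hornerX ?hornerC // -polyC_natr hornerC.
apply: forest_sum_root_int => [d _|x].
  by rewrite wE; case: pos; case: d.2; rewrite ?ltr0Sn.
rewrite [RHS](reindex_inj (inv_inj (@rvK E))) /=.
under [in RHS]eq_bigl do rewrite live_rv to_rv.
apply/eqP; rewrite -subr_eq0 -sumrB.
rewrite (eq_bigr (fun d => sg d * (1 - m.+1%:R))) => [|d _]; last first.
  rewrite !wE /sg /=; case: pos; case: d.2 => /=; rewrite ?mul1r ?mul0r ?subrr //.
  by rewrite mulN1r opprB.
by rewrite -mulr_suml eulerian_live // mul0r.
Qed.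

End Weights.

Lemma eulerian_ctr (V E : finType) (s t : E -> V) pos A (X : {set V}) :
  eulerian s t pos A ->
  eulerian (fun e => ctr X (s e)) (fun e => ctr X (t e)) pos A.
Proof.
move=> eA y; rewrite (partition_big (fr s t) (fun v => ctr X v == y)) /=.
  rewrite big1 // => v /eqP vy; rewrite -[RHS](eA v); apply: eq_bigl => d.
  by rewrite fr_ctr -andbA; congr (_ && _); case: (eqVneq (fr s t d) v) => [->|]; rewrite ?vy ?eqxx ?andbF.
by move=> d /andP[_]; rewrite fr_ctr.
Qed.

Lemma conn_ctr (V E : finType) (s t : E -> V) A (X : {set V}) : X != set0 ->
  conn s t A -> conn (fun e => ctr X (s e)) (fun e => ctr X (t e)) A.
Proof.
move=> /set0Pn[x0 x0X] cA u v.
have sur w : exists w', w = ctr X w'.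
  by case: w => [w|]; [exists (val w); rewrite ctr_val | exists x0; rewrite ctr_in].
have [[u' ->] [v' ->]] := (sur u, sur v).
have := connect_ctr X (cA u' v'); apply: connect_sub => x y /nxtP[d [dA <- <-]].
have [->|ne] := eqVneq (fr (fun e => ctr X (s e)) (fun e => ctr X (t e)) d)
                       (to (fun e => ctr X (s e)) (fun e => ctr X (t e)) d).
  exact: connect0.
apply/connect1/nxt_step; rewrite inE ne andbT.
by move: dA; rewrite inE => /andP[].
Qed.

Section Identity.
Variables (V E : finType) (s t : E -> V).
Implicit Types (A : {set E}) (K P : {set E * bool}).

Definition w1 (d : E * bool) : {poly int} := if d.2 then 1 else 'X.
Definition fwd K : nat := #|[set d in K | d.2]|.
Definition bwd K : nat := #|[set d in K | ~~ d.2]|.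

Lemma wtE : wt (E := E) predT =1 polyC \o w1.
Proof. by move=> d; rewrite /wt /w1 /=; case: d.2. Qed.

Lemma forest_sum1_root A u v : eulerian s t predT A -> forest_sum s t w1 A [set u] = forest_sum s t w1 A [set v].
Proof.
move=> /(forest_sum_root u v); have h X : forest_sum s t (wt predT) A X = (forest_sum s t w1 A X)%:P.
  rewrite (forest_sum_rmorph s t (polyC : {rmorphism {poly int} -> {poly {poly int}}})).
  apply: eq_bigr => P _; apply: eq_bigr => d _; exact: wtE.
by rewrite !h => /polyC_inj.
Qed.

Lemma imset_rvK : involutive (fun K : {set E * bool} => rv @: K).
Proof.
move=> K; rewrite -imset_comp -[RHS]imset_id; apply: eq_imset => d /=.
exact: rvK.
Qed.

Lemma fwd_rv K : fwd (rv @: K) = bwd K.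
Proof.
rewrite /fwd /bwd -(card_imset (mem [set d in K | ~~ d.2]) (inv_inj (@rvK E))).
apply: eq_card => d; rewrite !inE -[d](rvK d) (mem_imset _ _ (inv_inj (@rvK E))).
by rewrite (mem_imset _ _ (inv_inj (@rvK E))) !inE.
Qed.

Lemma bwd_rv K : bwd (rv @: K) = fwd K.
Proof.
by rewrite -fwd_rv imset_rvK.
Qed.

Lemma sgr_sum K :
  \sum_(d in K) (sg predT d)%:~R = (fwd K)%:R - (bwd K)%:R :> {poly int}.
Proof.
rewrite (bigID (fun d => d.2)) /= (eq_bigr (fun=> 1)) => [|d /andP[_ h]]; last by rewrite /sg h.
rewrite [X in _ + X](eq_bigr (fun=> -1)) => [|d /andP[_ /negbTE h]]; last by rewrite /sg h.
by rewrite !sumr_const mulNrn /fwd /bwd !cardsE.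
Qed.

Lemma w1_prod K : \prod_(d in K) w1 d = 'X^(bwd K).
Proof.
rewrite (bigID (fun d => d.2)) /= big1 ?mul1r => [|d /andP[_ h]]; last by rewrite /w1 h.
rewrite (eq_bigr (fun=> 'X)) => [|d /andP[_ /negbTE h]]; last by rewrite /w1 h.
by rewrite prodr_const /bwd cardsE.
Qed.

(** This is [cycle_sum] with the sign of the marked step for [h]. Reversing a cycle changes the sign
    and exchanges [fwd] and [bwd], which pairs up the cycles; those with [fwd = bwd] contribute
    zero. *)
Lemma cycle_identity A r : eulerian s t predT A ->
  #|[set d in live s t A | d.2]|%:R * (1 - 'X) * forest_sum s t w1 A [set r] =
  \sum_(K | cyc s t A K && (bwd K < fwd K)%N)
    (fwd K - bwd K)%:R * ('X^(bwd K) - 'X^(fwd K)) * forest_sum s t w1 A (fr s t @: K).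
Proof.
move=> eA; have := cycle_sum s t w1 A (fun d => (sg predT d)%:~R).
under eq_bigr do under eq_bigr do rewrite (forest_sum1_root _ r eA) mulrA.
have -> : \sum_v \sum_(d in live s t A | fr s t d == v)
    (sg predT d)%:~R * w1 d * forest_sum s t w1 A [set r] =
    #|[set d in live s t A | d.2]|%:R * (1 - 'X) * forest_sum s t w1 A [set r].
  under eq_bigr do rewrite -mulr_suml.
  rewrite -mulr_suml -(partition_big (fr s t) xpredT) //=; congr (_ * _).
  rewrite (bigID (fun d => d.2)) /= mulrBr mulr1; congr (_ + _).
    rewrite (eq_bigr (fun=> 1)) => [|d /andP[_ h]]; last by rewrite /sg /w1 h mulr1.
    by rewrite sumr_const cardsE.
  rewrite (reindex_inj (inv_inj (@rvK E))) /=.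
  under eq_bigl do rewrite live_rv negbK.
  rewrite (eq_bigr (fun=> - 'X)) => [|d /andP[_ h]]; last first.
    by rewrite /sg /w1 /= h /= mulrNz mulN1r.
  by rewrite sumr_const cardsE mulNrn mulr_natl.
move=> ->; rewrite (bigID (fun K => bwd K < fwd K)%N) /=.
rewrite [X in _ + X](bigID (fun K => fwd K < bwd K)%N) /=.
rewrite [X in _ + (_ + X)]big1 ?addr0 => [|K /andP[/andP[_ h1] h2]]; last first.
  rewrite sgr_sum (_ : fwd K = bwd K) ?subrr ?mul0r //.
  by apply/eqP; rewrite eqn_leq leqNgt h1 leqNgt h2.
rewrite [X in _ + X](reindex_inj (inv_inj imset_rvK)) /=.
rewrite [X in _ + X](eq_bigl (fun K => cyc s t A K && (bwd K < fwd K)%N)); last first.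
  move=> K; rewrite fwd_rv bwd_rv -andbA; congr (_ && _).
    by apply/idP/idP => /cyc_rv //; rewrite imset_rvK.
  by rewrite -leqNgt; apply/andP/idP => [[]|h] //; rewrite ltnW.
rewrite -big_split /=; apply: eq_bigr => K /andP[cK ltK].
rewrite !sgr_sum !w1_prod fwd_rv bwd_rv (fr_rv_cyc cK) -mulrDl natrB ?(ltnW ltK) //.
by rewrite -[(bwd K)%:R - _]opprB mulNr -mulrBr.
Qed.

End Identity.
Arguments w1 {E} d.

(** * Cycles and ears *)

Lemma count_rot (T : Type) (a : pred T) i (c : seq T) : count a (rot i c) = count a c.
Proof. by rewrite /rot count_cat addnC -count_cat cat_take_drop. Qed.

Lemma map_uniq_inj (T T' : eqType) (f : T -> T') c :
  uniq (map f c) -> {in c &, injective f}.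
Proof.
elim: c => // z c IH /= /andP[zc uc] x y.
rewrite !inE => /predU1P[->|xc] /predU1P[->|yc] e //.
- by case/negP: zc; rewrite e map_f.
- by case/negP: zc; rewrite -e map_f.
- exact: IH.
Qed.

Section CycleLemma.
Variables (T : eqType) (g : pred T).
Let nu (c : seq T) : int := (count g c)%:Z - (count (predC g) c)%:Z.

Let nu_cat c1 c2 : nu (c1 ++ c2) = nu c1 + nu c2.
Proof. by rewrite /nu !count_cat; lia. Qed.

(* Rotate to end at a maximum of the partial sums. *)
Lemma cycle_lemma (Q : seq T -> Prop) c :
  (forall i c, Q c -> Q (rot i c)) -> Q c ->
  has (predC g) c -> (count (predC g) c <= count g c)%N ->
  exists c', [/\ Q c', count g c' = count g c, count (predC g) c' = count (predC g) c,
     exists d c'', c' = d :: c'' /\ ~~ g d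
   & forall c2 c1, c' = c2 ++ c1 -> (count (predC g) c1 <= count g c1)%N].
Proof.
move=> Qrot Qc hc le.
(* A preliminary rotation to a head outside [g] covers the case of a maximum at full length, where
   the second rotation does nothing. *)
have {Qc hc le} [c0 [Qc0 e1 e2 [d0 [c00 [ec0 gd0]]] le]] : exists c', [/\ Q c',
    count g c' = count g c, count (predC g) c' = count (predC g) c,
    exists d c'', c' = d :: c'' /\ ~~ g d & 0 <= nu c'].
  exists (rot (find (predC g) c) c); rewrite /nu !count_rot; split=> //; last by lia.
    exact: Qrot.
  move: hc; rewrite has_find => lt; case: c lt {Qc le} => // x0 c lt.
  rewrite /rot (drop_nth x0 lt) /=; do 2!eexists; split=> //.
  by have := @nth_find _ x0 (predC g) (x0 :: c); rewrite has_find lt => /(_ isT).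
rewrite -e1 -e2; set m := size c0; pose s j := nu (take j c0).
have m0 : (0 < m)%N by rewrite /m ec0.
have [j _ maxj] := @arg_maxP _ int 'I_m (Ordinal m0) xpredT (fun j => s j.+1) isT.
have sj i : (0 < i <= m)%N -> s i <= s j.+1.
  by case: i => // i ltm; apply: (maxj (Ordinal ltm)).
have sm : s m = nu c0 by rewrite /s take_size.
exists (rot j.+1 c0); rewrite !count_rot; split=> //; first exact: Qrot.
  have [ltj|] := ltnP j.+1 m; last first.
    move=> lej; rewrite (_ : j.+1 = m) ?rot_size; first by exists d0, c00.
    by apply/eqP; rewrite eqn_leq lej ltn_ord.
  rewrite /rot (drop_nth d0 ltj) /=; do 2!eexists; split=> //.
  apply/negP => gd; have := sj j.+2; rewrite ltj => /(_ isT).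
  rewrite /s (take_nth d0 ltj) -cats1 nu_cat -[X in _ <= X]addr0 lerD2l.
  by rewrite /nu /= gd.
move=> c2 c1; rewrite /rot => e.
suff : 0 <= nu c1 by rewrite /nu; lia.
(* A suffix inside the second block is the maximal partial sum minus another one. For a longer
   suffix, the complementary prefix [c2] continues beyond the maximum, so [nu c2 <= 0] while the
   total is nonnegative. *)
have [le1|lt1] := leqP (size c1) j.+1.
  have ec1 : c1 = drop (j.+1 - size c1) (take j.+1 c0).
    have := congr1 (drop (size c2)) e; rewrite (@drop_size_cat _ (size c2) c2 c1 erefl) => h1; apply: etrans (esym h1) _.
    have sz := congr1 size e; rewrite !size_cat size_take size_drop -/m in sz.
    have szt : (if (j.+1 < m)%N then j.+1 else m) = j.+1 by have := ltn_ord j; case: ifP; lia.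
    rewrite szt in sz; have := ltn_ord j => ltj; rewrite drop_cat size_drop -/m.
    have [h|h] := ltnP (size c2) (m - j.+1); first by lia.
    by congr drop; lia.
  have : nu (take j.+1 c0) = nu (take (j.+1 - size c1) c0) + nu c1.
    rewrite -nu_cat; congr nu; rewrite {2}ec1.
    by rewrite -{1}(cat_take_drop (j.+1 - size c1) (take j.+1 c0)) take_takel ?leq_subr.
  rewrite -/(s _) -/(s _) => es.
  case: (posnP (j.+1 - size c1)) => [z|p].
    have : s m <= s j.+1 by apply: sj; rewrite m0 leqnn.
    have s0 : s 0%N = 0 by rewrite /s take0.
    by rewrite sm es z s0; lia.
  by have := sj (j.+1 - size c1)%N; rewrite p; have := ltn_ord j; lia.
have ec : nu c2 + nu c1 = nu c0.
  by rewrite -nu_cat -e nu_cat addrC -nu_cat cat_take_drop.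
have ec2 : c2 = take (size c2) (drop j.+1 c0).
  have := congr1 (take (size c2)) e; rewrite (@take_size_cat _ (size c2) c2 c1 erefl) => h1; apply: etrans (esym h1) _.
  have sz := congr1 size e; rewrite !size_cat size_take size_drop -/m in sz.
  have szt : (if (j.+1 < m)%N then j.+1 else m) = j.+1 by have := ltn_ord j; case: ifP; lia.
  rewrite szt in sz.
  rewrite take_cat size_drop -/m; case: ifP => // h.
  by rewrite (_ : (size c2 - (m - j.+1) = 0)%N) ?take0 ?cats0 ?take_oversize ?size_drop -/m //; lia.
have : s (j.+1 + size c2)%N = s j.+1 + nu c2.
  by rewrite {2}ec2 /s -nu_cat takeD.
have := sj (j.+1 + size c2)%N; have sz := congr1 size e.
rewrite !size_cat size_take size_drop -/m in sz.
have szt : (if (j.+1 < m)%N then j.+1 else m) = j.+1 by have := ltn_ord j; case: ifP; lia.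
rewrite szt in sz.
have : (j.+1 + size c2 <= m)%N by have := ltn_ord j; lia.
move=> -> /(_ isT) h1 h2; have : nu c2 <= 0 by lia.
by lia.
Qed.

End CycleLemma.

Section Cycles.
Variables (V E : finType) (s t : E -> V).
Implicit Types (A : {set E}) (K P Q : {set E * bool}) (c R : seq (E * bool)).
Notation fr := (fr s t).
Notation to := (to s t).

Definition link : rel (E * bool) := [rel d d' | to d == fr d'].

(** The listed form allows rotation and cutting into arcs; the sums range over the unordered form
    [cyc]. *)
Definition scyc A c : bool :=
  [&& c != [::], all (mem (live s t A)) c, cycle link c & uniq (map fr c)].

Lemma scyc_rot A i c : scyc A c -> scyc A (rot i c).
Proof.
case/and4P => c0 cA cc uc; apply/and4P; split.
- by rewrite -size_eq0 size_rot size_eq0.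
- by rewrite (eq_all_r (mem_rot i c)).
- by rewrite rot_cycle.
- by rewrite map_rot rot_uniq.
Qed.

Lemma link_connect P d c d' : path link d c -> {subset d :: c <= P} ->
  d' \in d :: c -> connect (nxt s t P) (fr d) (fr d').
Proof.
elim: c d => [|x c IH] d /=; first by move=> _ _; rewrite inE => /eqP ->.
case/andP => /eqP dx pth sub; rewrite inE => /predU1P[-> //|d'c].
apply: connect_trans (IH x pth _ d'c); last by move=> y yc; apply: sub; rewrite inE yc orbT.
by rewrite -dx; apply/connect1/nxt_step/sub/mem_head.
Qed.

Lemma scyc_cyc A c : scyc A c -> cyc s t A [set d in c].
Proof.
case/and4P => c0 cA cc uc.
have next_in d : d \in c -> next c d \in c /\ to d = fr (next c d).
  by move=> dc; rewrite mem_next dc; split=> //; apply/eqP/(next_cycle cc dc).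
apply/cycP; split.
- by case: c c0 {cA cc uc next_in} => // d c _; apply/set0Pn; exists d; rewrite inE mem_head.
- by apply/subsetP => d; rewrite inE => /(allP cA).
- by move=> x y; rewrite !inE; apply: map_uniq_inj.
- by move=> d; rewrite inE => /next_in[h1 h2]; exists (next c d); rewrite // inE.
- move=> d d'; rewrite !inE => dc d'c.
  have [i c' ec] := rot_to dc.
  have : cycle link (d :: c') by rewrite -ec rot_cycle.
  rewrite /= rcons_path => /andP[pth _]; apply: (link_connect pth).
    by move=> x; rewrite -ec mem_rot inE.
  by rewrite -ec mem_rot.
Qed.

Lemma scyc_fr c : fr @: [set d in c] = [set v in map fr c].
Proof.
apply/setP => v; rewrite inE; apply/imsetP/mapP => [[d dc ->]|[d dc ->]];
by exists d => //; move: dc; rewrite inE.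
Qed.

Lemma scyc_card A c : scyc A c -> #|[set v in map fr c]| = size c.
Proof.
case/and4P => _ _ _ uc; rewrite cardsE; move/card_uniqP: uc => ->.
by rewrite size_map.
Qed.

Lemma scyc_uniq A c : scyc A c -> uniq c.
Proof. by case/and4P => _ _ _ /map_uniq. Qed.

Lemma scyc_fwd A c : scyc A c -> fwd [set d in c] = count (fun d => d.2) c.
Proof.
move=> /scyc_uniq uc; rewrite /fwd -size_filter -(card_uniqP (filter_uniq _ uc)).
by apply: eq_card => d; rewrite !inE mem_filter andbC.
Qed.

Lemma scyc_bwd A c : scyc A c -> bwd [set d in c] = count (fun d => ~~ d.2) c.
Proof.
move=> /scyc_uniq uc; rewrite /bwd -size_filter -(card_uniqP (filter_uniq _ uc)).
by apply: eq_card => d; rewrite !inE mem_filter andbC.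
Qed.

Lemma cyc_scyc A K : cyc s t A K -> exists2 c, scyc A c & K = [set d in c].
Proof.
move=> cK; have [iT e] := cyc_img cK; case/cycP: cK => K0 KA iF nK rK.
pose f d := odflt d [pick d' in K | fr d' == to d].
have fP d : d \in K -> f d \in K /\ fr (f d) = to d.
  move=> dK; rewrite /f; case: pickP => [d' /andP[d'K /eqP //]|/= h].
  by have [d' d'K e'] := nK d dK; have := h d'; rewrite d'K e' eqxx.
have f_in : {in K, forall d, f d \in K} by move=> d /fP[].
have f_inj : {in K &, injective f}.
  by move=> d d' dK d'K ef; apply: iT => //; rewrite -(fP d dK).2 -(fP d' d'K).2 ef.
have [d0 d0K] := set0Pn _ K0.
have oK : {subset orbit f d0 <= K}.
  move=> x; rewrite -fconnect_orbit => /connectP[p + ->].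
  elim: p d0 d0K => [|y p IH] d0 d0K //= /andP[/eqP <- pth].
  by apply: IH pth; apply: f_in.
have Ko d : d \in K -> d \in orbit f d0.
  move=> dK; rewrite -fconnect_orbit; have /connectP[p] := rK _ _ d0K dK.
  elim: p d0 d0K {oK} => [|y p IH] d0 d0K /=.
    by move=> _ /iF -> //; apply: connect0.
  case/andP => /nxtP[d1 [d1K /iF -> // <-]] pth e1.
  have [fK fe] := fP _ d0K; apply: connect_trans (fconnect1 _ _) _.
  by apply: IH fK _ _; rewrite fe.
exists (orbit f d0); last by apply/setP => d; rewrite inE; apply/idP/idP => [/Ko|/oK].
apply/and4P; split.
- by rewrite -size_eq0 size_orbit -lt0n order_gt0.
- by apply/allP => d /oK/(subsetP KA).
- have := cycle_orbit_in f_in f_inj d0K.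
  apply: (sub_in_cycle (P := mem K)) => [x y xK yK /= /eqP <-|]; last by apply/allP.
  by rewrite /link /= (fP x xK).2.
- by rewrite map_inj_in_uniq ?orbit_uniq // => x y /oK xK /oK yK; apply: iF.
Qed.

Definition fwd_steps A : {set E * bool} := [set d in live s t A | d.2].

(** No forward step leaves the set [S] of vertices reachable from [to d]. Balance gives as many
    steps into [S] as out of it, so none enters, and [d], which ends in [S], also starts there. *)
Lemma fwd_steps_strong A d : eulerian s t predT A -> d \in fwd_steps A ->
  connect (nxt s t (fwd_steps A)) (to d) (fr d).
Proof.
move=> eA dA; pose S := [set v | connect (nxt s t (fwd_steps A)) (to d) v].
suff : fr d \in S by rewrite inE.
have sub : [set d in fwd_steps A | fr d \in S] \subset [set d in fwd_steps A | to d \in S].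
  apply/subsetP => x; rewrite !inE => /andP[xA c]; rewrite xA /=.
  by apply: connect_trans c _; apply/connect1/nxt_step; rewrite !inE.
have eq : #|[set d in fwd_steps A | fr d \in S]| = #|[set d in fwd_steps A | to d \in S]|.
  have : \sum_(v in S) \sum_(x in live s t A | fr x == v) sg predT x = 0.
    by rewrite big1 // => v _; apply: eulerian_live.
  rewrite (exchange_big_dep (mem (live s t A))) /=; last by move=> v x _ /andP[].
  rewrite (eq_bigr (fun x => if fr x \in S then sg predT x else 0)); last first.
    move=> x xA; rewrite xA /=; case: ifP => h.
      rewrite (big_pred1 (fr x)) // => v /=; case: (eqVneq (fr x) v) => [<-|ne].
        by rewrite h.
      by rewrite andbF.
    by rewrite big_pred0 // => v; case: eqP => [<-|]; rewrite ?h ?andbF.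
  rewrite -big_mkcondr /= (bigID (fun x => x.2)) /=.
  rewrite (eq_bigr (fun=> 1)) => [|x /andP[_ h]]; last by rewrite /sg h.
  rewrite [X in _ + X](reindex_inj (inv_inj (@rvK E))) /=.
  rewrite [X in _ + X](eq_bigl (fun x => (x \in live s t A) && (to x \in S) && x.2)); last first.
    by move=> x; rewrite live_rv negbK.
  rewrite [X in _ + X](eq_bigr (fun=> -1)) => [|x /andP[_ h]]; last by rewrite /sg /= h.
  rewrite !sumr_const mulNrn => /eqP; rewrite subr_eq0 !natz => /eqP[].
  move=> h; transitivity #|[pred x | (x \in live s t A) && (fr x \in S) && x.2]|.
    by apply: eq_card => x; rewrite !inE andbAC.
  rewrite h; apply: eq_card => x.
  by rewrite -[LHS]/((x \in live s t A) && (to x \in S) && x.2) !inE andbAC.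
have : d \in [set d in fwd_steps A | to d \in S] by rewrite inE dA inE connect0.
move: sub; rewrite subEproper => /predU1P[<-|/proper_card]; last by rewrite eq ltnn.
by rewrite inE => /andP[].
Qed.

Lemma first_hit Q (S : {set V}) u p :
  path (nxt s t Q) u p -> last u p \in S -> u \notin S ->
  exists r R, [/\ fr r = u, path link r R /\ all (mem Q) (r :: R),
    to (last r R) \in S, all (fun d => fr d \notin S) (r :: R)
    & subseq (map fr (r :: R)) (u :: p)].
Proof.
elim: p u => [|v p IH] u /=; first by move=> _ ->.
case/andP => /nxtP[d [dQ du dv]] pth lS uS.
have [vS|vS] := boolP (v \in S).
  by exists d, [::]; rewrite /= dQ du dv uS eqxx.
have [r [R [er [pR aR] lR fR sR]]] := IH v pth lS vS.
exists d, (r :: R); split=> //=.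
- by have -> : link d r by [apply/eqP; rewrite er]; split; rewrite ?pR ?dQ.
- by rewrite du uS.
- by rewrite du eqxx.
Qed.

(** A forward step out of [y] extends to a directed walk back to [y], which is made simple and cut
    at its first visit to [S]. The end may be [y] itself; then the ear is a directed cycle. *)
Lemma ear A (S : {set V}) y d0 : eulerian s t predT A -> y \in S ->
  d0 \in fwd_steps A -> fr d0 = y \/ to d0 = y ->
  exists r R, [/\ fr r = y, path link r R /\ all (mem (fwd_steps A)) (r :: R),
    to (last r R) \in S, all (fun d => fr d \notin S) R
    & uniq (map fr (r :: R))].
Proof.
move=> eA yS d0A ey.
have [d1 d1A e1] : exists2 d1, d1 \in fwd_steps A & fr d1 = y.
  case: ey => ey; first by exists d0.
  have := fwd_steps_strong eA d0A; rewrite ey => /connectP[[|z p] /=].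
    move=> _ e; move: d0A; rewrite !inE => /andP[/andP[_ +] _].
    by rewrite e ey eqxx.
  by case/andP => /nxtP[d [dA <- _]] _ _; exists d.
have [tS|tS] := boolP (to d1 \in S).
  by exists d1, [::]; rewrite /= d1A.
have := fwd_steps_strong eA d1A => /connectP[p0 pth0 e0].
case/shortenP: pth0 e0 => p pth up _ ep.
have [] := @first_hit (fwd_steps A) S (to d1) p pth _ tS; first by rewrite -ep e1.
move=> r [R [er [pR aR] lR fR sR]].
exists d1, (r :: R); split=> //=.
- by have -> : link d1 r by [apply/eqP; rewrite er]; split; rewrite ?pR ?d1A.
- have := subseq_uniq sR up; rewrite /= => ->; rewrite andbT -[_ :: _]/(map fr (r :: R)).
  apply/mapP => -[d dR e]; have := allP fR d dR; rewrite -e e1 yS //.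
Qed.

End Cycles.

(** * Trapezoidal polynomials *)

(** The number [n] fixes the centre [n / 2]. The last two clauses stop at the middle, and symmetry
    continues them beyond it. *)
Definition trapez (n : nat) (p : {poly int}) : Prop :=
  [/\ (size p <= n.+1)%N, forall i, (i <= n)%N -> p`_i = p`_(n - i), 0 < p`_0,
      forall i, (i.+1.*2 <= n)%N -> p`_i <= p`_i.+1
    & forall i, (i.+2.*2 <= n)%N -> p`_i = p`_i.+1 -> p`_i.+1 = p`_i.+2].

Section Trapez.
Variables (n : nat) (p : {poly int}).
Hypothesis tp : trapez n p.

Lemma trapez_out i : (n < i)%N -> p`_i = 0.
Proof. by case: tp => sz _ _ _ _ h; rewrite nth_default // (leq_trans sz). Qed.

Lemma trapez_half i j : (i <= j)%N -> (j.*2 <= n)%N -> p`_i <= p`_j.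
Proof.
case: tp => _ _ _ mono _; elim: j => [|j IH]; first by rewrite leqn0 => /eqP ->.
rewrite leq_eqVlt => /predU1P[-> //|lt] le.
by apply: le_trans (mono _ le); apply: IH => //; lia.
Qed.

(** The hypotheses say that [j] is at most as far from the centre as [i]. *)
Lemma trapez_le i j : (i <= j)%N -> (i + j <= n)%N -> p`_i <= p`_j.
Proof.
move=> le le'; have [h|h] := leqP j.*2 n; first exact: trapez_half.
case: tp => _ sym _ _ _; rewrite (sym j); last by lia.
by apply: trapez_half; lia.
Qed.

Lemma trapez_gt0 i : (i <= n)%N -> 0 < p`_i.
Proof.
case: tp => _ _ p0 _ _ le; apply: lt_le_trans p0 _; apply: trapez_le => //.
Qed.

Lemma trapez_ge0 i : 0 <= p`_i.
Proof.
have [/trapez_gt0/ltW //|/trapez_out -> //] := leqP i n.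
Qed.

Lemma trapez_plateau i j : (i.+1.*2 <= n)%N -> p`_i = p`_i.+1 ->
  (i <= j)%N -> (i + j <= n)%N -> p`_j = p`_i.
Proof.
case: tp => _ sym _ _ plat le e.
have half k : (i <= k)%N -> (k.*2 <= n)%N -> p`_k = p`_i.
  move=> lek; rewrite -(subnKC lek); elim: {lek}(k - i)%N => [|l IH] hk; first by rewrite addn0.
  case: l IH hk => [|l] IH hk; first by rewrite addn1.
  have step l' : (l' <= l)%N -> p`_(i + l') = p`_(i + l').+1.
    elim: l' => [|l' IH'] hl; first by rewrite addn0.
    by rewrite !addnS; apply: plat; [lia | apply: IH'; lia].
  rewrite -IH; last by lia.
  rewrite !addnS -plat ?step //; lia.
move=> lej le'; have [h|h] := leqP j.*2 n; first exact: half.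
by rewrite sym ?half; lia.
Qed.

End Trapez.

(** * Increments and the contribution of a single cycle *)

Definition dl (p : {poly int}) i : int := ((1 - 'X) * p)`_i.

Lemma dl0 p : dl p 0 = p`_0.
Proof. by rewrite /dl mulrBl mul1r coefB coefXM subr0. Qed.

Lemma dlS p i : dl p i.+1 = p`_i.+1 - p`_i.
Proof. by rewrite /dl mulrBl mul1r coefB coefXM. Qed.

Definition term (a b : nat) (f : {poly int}) i : int := (('X^b - 'X^a) * f)`_i.

Lemma termE a b f i :
  term a b f i = (if (i < b)%N then 0 else f`_(i - b)) - (if (i < a)%N then 0 else f`_(i - a)).
Proof. by rewrite /term mulrBl coefB !coefXnM. Qed.

Lemma term_shift a b f i :
  term a b f (i + b) = f`_i - (if (i + b < a)%N then 0 else f`_(i + b - a)).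
Proof. by rewrite termE ltnNge leq_addl addnK. Qed.

Section Terms.
Variables (a b m : nat) (f : {poly int}).
Hypotheses (lt_ba : (b < a)%N) (tf : trapez m f).

(** The bound puts [i - b] at most as far from the centre of [f] as [i - a]. *)
Lemma term_ge0 i : (i.*2 < m + a + b)%N -> 0 <= term a b f i.
Proof.
move=> le; rewrite termE; case: ltnP => h1; case: ltnP => h2; rewrite ?subr0 //; try lia.
  exact: (trapez_ge0 tf).
by rewrite subr_ge0; apply: (trapez_le tf); lia.
Qed.

Lemma term_head : 0 < term a b f b.
Proof. by rewrite termE ltnn lt_ba subr0 subnn; apply: (trapez_gt0 tf). Qed.

(** If the term vanishes past degree [a], then [f] agrees at [i - a] and [i - b]; this is its
    plateau, which also contains the two next indices. The excluded degree is the one in which the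
    contribution starts. *)
Lemma term_plateau i : (i.+1.*2 < m + a + b)%N -> b != i.+1 ->
  term a b f i = 0 -> term a b f i.+1 = 0.
Proof.
move=> le ne; rewrite !termE; case: (ltnP i b) => hb.
  have -> : (i.+1 < b)%N = true by lia.
  by have -> : (i.+1 < a)%N = true by lia.
have -> : (i.+1 < b)%N = false by lia.
case: (ltnP i a) => ha.
  rewrite subr0 => z; have hm : (m < i - b)%N.
    by rewrite ltnNge; apply/negP => /(trapez_gt0 tf); rewrite z.
  have -> : (i.+1 < a)%N = true by lia.
  rewrite subr0.
  by apply: (trapez_out tf); lia.
have -> : (i.+1 < a)%N = false by lia.
move/eqP; rewrite subr_eq0 => /eqP e; apply/eqP; rewrite subr_eq0; apply/eqP.
set k := (i - a)%N in e *; have ek : (i.+1 - a = k.+1)%N by rewrite /k; lia.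
have l1 : f`_k <= f`_k.+1 by apply: (trapez_le tf); rewrite /k; lia.
have l2 : f`_k.+1 <= f`_(i - b) by apply: (trapez_le tf); rewrite /k; lia.
have ee : f`_k = f`_k.+1 by apply: le_anti; rewrite l1 -e.
rewrite ek -ee; apply: (trapez_plateau tf) ee _ _; rewrite /k; lia.
Qed.

(** The subtracted coefficient has index [i + b - a], at most [i - 1], hence lies below the strict
    increment of [f]. *)
Lemma term_pos i : 0 < dl f i -> (i.*2 <= m)%N -> 0 < term a b f (i + b).
Proof.
rewrite termE ltnNge leq_addl /= addnK; case: i => [|i].
  by rewrite dl0 add0n lt_ba subr0.
rewrite dlS subr_gt0 => lt le; case: ltnP => h; first by rewrite subr0 (trapez_gt0 tf) //; lia.
rewrite subr_gt0; apply: le_lt_trans lt; apply: (trapez_le tf); lia.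
Qed.

Lemma term_anti i : (i <= m + a + b)%N -> term a b f (m + a + b - i) = - term a b f i.
Proof.
move=> le; rewrite !termE opprB; case: tf => _ sym _ _ _; congr (_ - _).
  case: ltnP => h1; case: ltnP => h2 //; try lia.
  - by rewrite (trapez_out tf) //; lia.
  - by rewrite (trapez_out tf) //; lia.
  have [h3|h3] := leqP (i - a) m; last by rewrite !(trapez_out tf) //; lia.
  by rewrite (sym _ h3); congr nth; lia.
case: ltnP => h1; case: ltnP => h2 //; try lia.
- by rewrite (trapez_out tf) //; lia.
- by rewrite (trapez_out tf) //; lia.
have [h3|h3] := leqP (i - b) m; last by rewrite !(trapez_out tf) //; lia.
by rewrite (sym _ h3); congr nth; lia.
Qed.

End Terms.

Section SumOfTerms.
Variables (I : finType) (P : pred I) (c a b : I -> nat) (f : I -> {poly int}).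
Variables (n N : nat) (p : {poly int}).
Hypotheses (N0 : (0 < N)%N)
  (ident : N%:R * (1 - 'X) * p = \sum_(k | P k) (c k)%:R * ('X^(b k) - 'X^(a k)) * f k)
  (terms : forall k, P k -> [/\ (0 < c k)%N, (b k < a k)%N, (a k + b k <= n.+1)%N
                           & trapez (n.+1 - (a k + b k)) (f k)]).

Lemma dl_sum i : N%:R * dl p i = \sum_(k | P k) (c k)%:R * term (a k) (b k) (f k) i.
Proof.
have := congr1 (fun q : {poly int} => q`_i) ident; rewrite /= coef_sum -mulrA mulr_natl coefMn => e.
rewrite mulr_natl /dl e; apply: eq_bigr => k _.
by rewrite -mulrA mulr_natl coefMn [RHS]mulr_natl.
Qed.

Lemma dl_term_ge0 i k : P k -> (i.*2 <= n)%N -> 0 <= (c k)%:R * term (a k) (b k) (f k) i.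
Proof.
case/terms => _ lt le tr h; rewrite mulr_ge0 //; apply: (term_ge0 lt tr); lia.
Qed.

Lemma dl_ge0 i : (i.*2 <= n)%N -> 0 <= dl p i.
Proof.
move=> h; rewrite -(@pmulr_rge0 _ N%:R) ?ltr0n // dl_sum.
by apply: sumr_ge0 => k Pk; apply: dl_term_ge0.
Qed.

Lemma dl_gt0 i k : P k -> (i.*2 <= n)%N -> 0 < term (a k) (b k) (f k) i -> 0 < dl p i.
Proof.
move=> Pk h t0; rewrite -(@pmulr_rgt0 _ N%:R) ?ltr0n // dl_sum (bigD1 k) //=.
apply: ltr_wpDr; first by apply: sumr_ge0 => k' /andP[Pk' _]; apply: dl_term_ge0.
by rewrite mulr_gt0 // ltr0n; case: (terms Pk).
Qed.

Lemma dl_eq0 i k : P k -> (i.*2 <= n)%N -> dl p i = 0 -> term (a k) (b k) (f k) i = 0.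
Proof.
move=> Pk h z; apply/eqP; have [c0 lt le tr] := terms Pk.
have ge : 0 <= term (a k) (b k) (f k) i by apply: (term_ge0 lt tr); lia.
move: ge; rewrite le_eqVlt => /predU1P[<- //|/(dl_gt0 Pk h)].
by rewrite z ltxx.
Qed.

(** A vanishing increment in degree [i + 1] forces all its nonnegative summands to vanish, and
    [term_plateau] passes this on to degree [i + 2] unless some [b k] equals [i + 2]. The last
    hypothesis excludes that. *)
Lemma trapez_sum : (size p <= n.+1)%N -> (exists2 k, P k & b k = 0%N) ->
  (forall k, P k -> (0 < b k)%N -> 0 < dl p (b k).-1) -> trapez n p.
Proof.
move=> sz [k0 Pk0 bk0] dlb.
have p0 : 0 < p`_0.
  rewrite -dl0; apply: (dl_gt0 Pk0) => //; have [_ lt _ tr] := terms Pk0.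
  by rewrite -bk0; apply: (term_head lt tr).
have anti i : (i <= n.+1)%N -> dl p (n.+1 - i) = - dl p i.
  move=> le; apply: (@mulfI _ N%:R); first by rewrite pnatr_eq0 -lt0n.
  rewrite mulrN !dl_sum -sumrN; apply: eq_bigr => k Pk.
  have [_ lt lek tr] := terms Pk.
  rewrite -mulrN -(term_anti lt tr); last by lia.
  by congr (_ * term _ _ _ _); lia.
(* Antisymmetric increments make this difference constant; since it changes sign between [0] and
   [n], it is zero. *)
have sym0 i : (i <= n)%N -> p`_i - p`_(n - i) = p`_0 - p`_n.
  elim: i => [|i IH] le; first by rewrite subn0.
  rewrite -IH 1?ltnW //; have := anti i.+1; rewrite dlS => /(_ _).
  rewrite (_ : (n.+1 - i.+1 = (n - i.+1).+1)%N); last by lia.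
  rewrite dlS (_ : (n - i.+1).+1 = (n - i)%N); last by lia.
  by lia.
split=> //.
- move=> i le; have := sym0 i le; have := sym0 n (leqnn n); rewrite subnn; lia.
- move=> i le; have := @dl_ge0 i.+1 le; rewrite dlS; lia.
- move=> i le e; apply/eqP; rewrite eq_sym -subr_eq0 -dlS.
  have z : dl p i.+1 = 0 by rewrite dlS e subrr.
  have le1 : (i.+1.*2 <= n)%N by lia.
  rewrite -(@mulrI_eq0 _ N%:R); last by apply/lregP; rewrite pnatr_eq0 -lt0n.
  rewrite dl_sum big1 // => k Pk; have [_ lt lek tr] := terms Pk.
  have [eb|ne] := eqVneq (b k) i.+2.
    by have := dlb k Pk; rewrite eb z ltxx => /(_ isT).
  rewrite (term_plateau lt tr _ ne) ?mulr0 ?(dl_eq0 Pk) //; lia.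
Qed.

End SumOfTerms.

(** * Eulerian digraphs *)

Section Counting.
Variables (V E : finType) (s t : E -> V).
Implicit Types (A : {set E}) (X : {set V}) (P K : {set E * bool}).

Lemma card_fwd_bwd K : (fwd K + bwd K)%N = #|K|.
Proof.
rewrite /fwd /bwd -(cardsID [set d | d.2] K); congr (_ + _)%N; apply: eq_card => d; rewrite !inE //.
by rewrite andbC.
Qed.

Lemma forest_card A X P : forest s t A X P -> #|P| = (#|V| - #|X|)%N.
Proof.
case/forestP => _ cP _; rewrite -(cardsC X) addKn -sum1_card.
rewrite (partition_big (fr s t) (mem (~: X))) /=; last first.
  move=> d dP; rewrite inE; apply/negP => dX; have := cP (fr s t d).
  by rewrite dX => /eqP; rewrite cards_eq0 => /eqP/setP/(_ d); rewrite !inE dP eqxx.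
rewrite -[RHS]sum1_card; apply: eq_bigr => v; rewrite inE => vX.
by rewrite sum1dep_card; have := cP v; rewrite vX.
Qed.

Lemma size_forest_sum A X : (size (forest_sum s t w1 A X) <= (#|V| - #|X|).+1)%N.
Proof.
apply: leq_trans (size_sum _ _ _) _; apply/bigmax_leqP => P /forest_card fP.
by rewrite w1_prod size_polyXn ltnS -fP -card_fwd_bwd leq_addl.
Qed.

Lemma scyc_size A c : scyc s t A c -> (1 < size c <= #|V|)%N.
Proof.
move=> sc; rewrite -{2}(scyc_card sc) max_card andbT.
case/and4P: sc => + cA cc uc; case: c cA cc uc => [//|d [|d' c]] //=.
by rewrite andbT inE => /andP[_ ne]; rewrite /link /= eq_sym (negbTE ne).
Qed.

Lemma count_fwd_bwd (c : seq (E * bool)) :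
  (count (fun d => d.2) c + count (fun d => ~~ d.2) c = size c)%N.
Proof. exact: count_predC. Qed.

Notation nf := (count (fun d : E * bool => d.2)).
Notation nb := (count (fun d : E * bool => ~~ d.2)).

Lemma scyc_half A c : scyc s t A c -> (nb c <= nf c)%N -> ((nb c).*2 <= #|V|)%N.
Proof. by move=> sc le; have := count_fwd_bwd c; have /andP[_] := scyc_size sc; lia. Qed.

Lemma scyc_rotation A c : scyc s t A c -> (nb c <= nf c)%N -> (0 < nb c)%N ->
  exists c0 c' : seq (E * bool), exists d : E * bool,
    [/\ c0 = d :: c', scyc s t A c0, nf c0 = nf c, nb c0 = nb c
      & forall c2 c1 : seq (E * bool), c0 = c2 ++ c1 -> (nb c1 <= nf c1)%N] /\ ~~ d.2.
Proof.
move=> sc le gt; have hc : has (predC (fun d : E * bool => d.2)) c by rewrite has_count.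
have [c0 [sc0 e1 e2 [d [c' [ec nd]]] suf]] :=
  cycle_lemma (fun i c => @scyc_rot _ _ s t A i c) sc hc le.
by exists c0, c', d.
Qed.

Lemma cyc_card A K : cyc s t A K -> (1 < fwd K + bwd K <= #|V|)%N /\ #|fr s t @: K| = (fwd K + bwd K)%N.
Proof.
case/cyc_scyc => c sc ->; rewrite (scyc_fwd sc) (scyc_bwd sc) count_fwd_bwd.
by rewrite (scyc_size sc) scyc_fr (scyc_card sc).
Qed.

Lemma cyc_fr0 A K : cyc s t A K -> fr s t @: K != set0.
Proof. by case/cycP => K0 *; rewrite imset_eq0. Qed.

End Counting.

(** Covers a cycle that meets [X] only where it starts, and an arc between two vertices of [X] with
    its interior outside: both close up in the contraction. A single step becomes a loop, whence the
    condition on [c']. *)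
Lemma scyc_ctr (V E : finType) (s t : E -> V) (A : {set E}) (X : {set V}) c d c' :
  let s' := fun e => ctr X (s e) in let t' := fun e => ctr X (t e) in
  c = d :: c' -> all (mem (live s t A)) c -> path (link s t) d c' ->
  (forall v, v \in X -> v \in map (fr s t) c' -> False) -> uniq (map (fr s t) c) ->
  ctr X (to s t (last d c')) = ctr X (fr s t d) ->
  uniq (map (fr s' t') c) /\ (c' != [::] -> scyc s' t' A c).
Proof.
move=> s' t' -> aL pth nX uc el.
have mapE e : map (fr s' t') e = map (ctr X) (map (fr s t) e).
  by rewrite -map_comp; apply: eq_map => z; apply: fr_ctr.
have uc' : uniq (map (fr s' t') (d :: c')).
  rewrite mapE map_inj_in_uniq // => x y; rewrite !inE.
  have inj u v : v \in map (fr s t) c' -> ctr X u = ctr X v -> u = v.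
    by move=> vc; apply: ctr_inj; apply/negP => /nX; apply.
  case/predU1P => [->|xc]; case/predU1P => [->|yc] // e; first exact: inj.
    exact/esym/inj/esym.
  exact: inj.
split=> // c0; apply/and4P; split=> //.
- apply/allP => z zc; have zA : z \in live s t A := allP aL z zc; rewrite /= live_ctrP zA /=.
  move: zc; rewrite inE => /predU1P[->|zc]; last first.
    by apply/orP; left; apply/negP => /nX; apply; apply: map_f.
  case: c' c0 pth nX {aL uc el uc' } => // d1 c' _ /= /andP[/eqP -> _] nX.
  by apply/orP; right; apply/negP => /nX; apply; rewrite mem_head.
- rewrite /= rcons_path /link /= to_ctr fr_ctr el eqxx andbT.
  apply: sub_path pth => x y /=; rewrite to_ctr fr_ctr => /eqP ->; exact: eqxx.
Qed.

Lemma forest_sum_card1 (V E : finType) (s t : E -> V) (A : {set E}) (v : V) :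
  #|V| = 1%N -> forest_sum s t w1 A [set v] = 1.
Proof.
move=> c1; have /fintype_le1P eqv : (#|V| <= 1)%N by rewrite c1.
rewrite /forest_sum (big_pred1 set0) ?big_set0 // => P /=; apply/idP/eqP => [fP|->].
  by apply/eqP; rewrite -cards_eq0 (forest_card fP) c1 cards1.
apply/forestP; split.
- exact: sub0set.
- move=> u; rewrite (eqv v u) set11; apply/eqP; rewrite cards_eq0; apply/eqP/setP => d.
  by rewrite !inE.
- by move=> u; exists v; rewrite ?set11 // (eqv v u) connect0.
Qed.

(* The last two clauses, strict increases forced by the cycles, are needed for the contracted
   graphs in the induction. *)
Definition good_poly (V E : finType) (s t : E -> V) (A : {set E}) m (p : {poly int}) : Prop :=
  [/\ trapez m p,
      forall c, scyc s t A c -> (count (fun d => ~~ d.2) c <= count (fun d => d.2) c)%N ->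
        (0 < count (fun d => ~~ d.2) c)%N -> 0 < dl p (count (fun d => ~~ d.2) c).-1
    & forall K, cyc s t A K -> (bwd K < fwd K)%N -> 0 < dl p (bwd K)].

Definition good_trees m := forall (V E : finType) (s t : E -> V) (A : {set E}) r,
  #|V| = m.+1 -> conn s t A -> eulerian s t predT A ->
  good_poly s t A m (forest_sum s t w1 A [set r]).

(** * The induction step: strict increments from ears *)

Section Step.
Variables (m : nat) (V E : finType) (s t : E -> V) (A : {set E}) (r : V).
Hypotheses (IH : forall m', (m' < m)%N -> good_trees m') (cV : #|V| = m.+1)
  (cA : conn s t A) (eA : eulerian s t predT A) (m0 : (0 < m)%N).

Notation phi := (forest_sum s t w1 A [set r]).

Lemma good_ctr K : cyc s t A K ->
  good_poly (fun e => ctr (fr s t @: K) (s e)) (fun e => ctr (fr s t @: K) (t e)) A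
    (m.+1 - (fwd K + bwd K)) (forest_sum s t w1 A (fr s t @: K)).
Proof.
move=> cK; have [/andP[gt1 leV] cF] := cyc_card cK; have f0 := cyc_fr0 cK.
rewrite -(forest_sum_ctr _ _ _ _ f0); apply: IH.
- by rewrite cV in leV; lia.
- by rewrite card_ctr cV cF.
- exact: conn_ctr.
- exact: eulerian_ctr.
Qed.

Lemma fwd_steps_gt0 : (0 < #|fwd_steps s t A|)%N.
Proof.
have [u [v uv]] : exists u v : V, u != v.
  have : (1 < #|[set: V]|)%N by rewrite cardsT cV.
  by case/card_gt1P => u [v [_ _ uv]]; exists u, v.
have /connectP[[|x p] /=] := cA u v; first by move=> _ e; rewrite e eqxx in uv.
case/andP => /nxtP[d [dA _ _]] _ _.
apply/card_gt0P; exists (if d.2 then d else rv d).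
by case: d dA => e [] dA; rewrite inE /= ?andbT // -live_rv.
Qed.

Lemma phi_ident :
  #|fwd_steps s t A|%:R * (1 - 'X) * phi =
  \sum_(K | cyc s t A K && (bwd K < fwd K)%N)
    (fwd K - bwd K)%:R * ('X^(bwd K) - 'X^(fwd K)) * forest_sum s t w1 A (fr s t @: K).
Proof. exact: cycle_identity. Qed.

Lemma phi_terms K : cyc s t A K && (bwd K < fwd K)%N ->
  [/\ (0 < fwd K - bwd K)%N, (bwd K < fwd K)%N, (fwd K + bwd K <= m.+1)%N
    & trapez (m.+1 - (fwd K + bwd K)) (forest_sum s t w1 A (fr s t @: K))].
Proof.
case/andP => cK lt; rewrite subn_gt0 lt; split=> //.
  by case: (cyc_card cK) => /andP[_]; rewrite cV.
by case: (good_ctr cK).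
Qed.

Lemma phi_dl_gt0 K i : cyc s t A K -> (bwd K < fwd K)%N -> (i.*2 <= m)%N ->
  0 < term (fwd K) (bwd K) (forest_sum s t w1 A (fr s t @: K)) i -> 0 < dl phi i.
Proof.
move=> cK lt; apply: (dl_gt0 fwd_steps_gt0 phi_ident phi_terms).
by rewrite cK.
Qed.

Lemma phi_dl_head K : cyc s t A K -> (bwd K < fwd K)%N -> 0 < dl phi (bwd K).
Proof.
move=> cK lt; have [_ _ le tr] := phi_terms (introT andP (conj cK lt)).
by apply: (phi_dl_gt0 cK lt); [lia | apply: term_head tr].
Qed.

Lemma fwd_steps_live : {subset fwd_steps s t A <= live s t A}.
Proof. by move=> d; rewrite inE => /andP[]. Qed.

Lemma all_fwd_steps_bwd c : all (mem (fwd_steps s t A)) c -> count (fun d => ~~ d.2) c = 0%N.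
Proof.
by elim: c => //= d c IHc /andP[+ /IHc ->]; rewrite inE => /andP[_ ->].
Qed.

Lemma all_fwd_steps_fwd c : all (mem (fwd_steps s t A)) c -> count (fun d => d.2) c = size c.
Proof.
by elim: c => //= d c IHc /andP[+ /IHc ->]; rewrite inE => /andP[_ ->].
Qed.

(** An ear attached to a single vertex is a directed cycle. *)
Lemma directed_cycle : exists2 K, cyc s t A K && (bwd K < fwd K)%N & bwd K = 0%N.
Proof.
have [d0 d0A] := card_gt0P fwd_steps_gt0.
have [d [R [ed [pR aR] lR _ uR]]] := ear eA (set11 (fr s t d0)) d0A (or_introl erefl).
have sc : scyc s t A (d :: R).
  apply/and4P; split=> //; first by apply/allP => z /(allP aR)/fwd_steps_live.
  by rewrite /= rcons_path pR /link /= (set1P lR) ed.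
exists [set x in d :: R]; last by rewrite (scyc_bwd sc) all_fwd_steps_bwd.
rewrite (scyc_bwd sc) (scyc_fwd sc) all_fwd_steps_bwd // (scyc_cyc sc) /=.
by move: aR; rewrite /= inE => /andP[/andP[_ ->]].
Qed.

Notation nf := (count (fun d : E * bool => d.2)).
Notation nb := (count (fun d : E * bool => ~~ d.2)).

(** Rotate [c] to begin with a backward step and to have no suffix with a backward majority. A
    directed ear then starts at [fr d]. Contracting the ear if it is closed, and otherwise the ear
    followed by the rest of [c], turns what remains of [c] into a cycle, whose strict increments
    carry over to [phi]. *)
Lemma phi_dl_cycle c : scyc s t A c -> (nb c <= nf c)%N -> (0 < nb c)%N ->
  0 < dl phi (nb c).-1.
Proof.
move=> sc0 le0 gt0.
have [c0 [c2' [d [[ec sc e1 e2 suf] nd]]]] := scyc_rotation sc0 le0 gt0.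
rewrite -e2 -?e1 in le0 gt0 *.
move: c0 sc e1 e2 ec le0 gt0 suf => {sc0} c sc _ _ ec le0 gt0 suf.
have cN := count_fwd_bwd c; have /andP[gt1 szV] := scyc_size sc.
have le2 : ((nb c).-1.*2 <= m)%N by have := scyc_half sc le0; rewrite cV; lia.
have /and4P[_ cA' cc uc] := sc.
have aL : {subset c <= live s t A} by move=> z /(allP cA').
pose S : {set V} := [set v in map (fr s t) c].
have dc : d \in c by rewrite ec mem_head.
have yS : fr s t d \in S by rewrite inE map_f.
(* The last step of [c] runs forward into the vertex [fr d]. *)
pose d0 := last d c2'.
have d0c : d0 \in c by rewrite ec mem_last.
have to0 : to s t d0 = fr s t d.
  by move: cc; rewrite ec /= rcons_path => /andP[_ /eqP].
have d0A : d0 \in fwd_steps s t A.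
  rewrite inE aL //=; have := suf (belast d c2') [:: d0].
  rewrite cats1 -lastI => /(_ ec) /=; by case: (d0.2).
have [r1 [R [er [pR aR] lR fR uR]]] := ear eA yS d0A (or_intror to0).
have rL : {subset r1 :: R <= live s t A} by move=> z /(allP aR)/fwd_steps_live.
have nbR : nb (r1 :: R) = 0%N by apply: all_fwd_steps_bwd.
have nfR : nf (r1 :: R) = (size R).+1 by apply: all_fwd_steps_fwd.
have fR' z : z \in R -> fr s t z \notin S := allP fR z.
(* If the ear returns to [fr d], its contraction leaves [c] intact, and [bwd = 0] means that no
   degree is shifted. *)
have [xy|xy] := eqVneq (to s t (last r1 R)) (fr s t d).
  have scR : scyc s t A (r1 :: R).
    apply/and4P; split=> //; first by apply/allP => z /rL.
    by rewrite /= rcons_path pR /link /= xy er.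
  have cK := scyc_cyc scR; have fK := scyc_fwd scR; have bK := scyc_bwd scR.
  rewrite nfR in fK; rewrite nbR in bK.
  have [tr dlK _] := good_ctr cK.
  have XE v : (v \in fr s t @: [set z in r1 :: R]) = (v \in map (fr s t) (r1 :: R)).
    by rewrite scyc_fr inE.
  have cap v : v \in fr s t @: [set z in r1 :: R] -> v \in S -> v = fr s t d.
    by rewrite XE /= inE => /predU1P[->|/mapP[z /fR' zS ->]] // ; rewrite (negbTE zS).
  have dX : fr s t d \in fr s t @: [set z in r1 :: R] by rewrite XE -er map_f ?mem_head.
  have pc : path (link s t) d c2' by move: cc; rewrite ec /= rcons_path => /andP[].
  have nd' : fr s t d \notin map (fr s t) c2' by move: uc; rewrite ec => /andP[].
  have nX v : v \in fr s t @: [set z in r1 :: R] -> v \in map (fr s t) c2' -> False.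
    move=> vX vc; have vS : v \in S by rewrite inE ec /= inE vc orbT.
    by have ev := cap v vX vS; rewrite -ev vc in nd'.
  have [_ scc] := scyc_ctr ec cA' pc nX uc (congr1 _ to0).
  have {}scc : scyc (fun e => ctr (fr s t @: [set z in r1 :: R]) (s e))
      (fun e => ctr (fr s t @: [set z in r1 :: R]) (t e)) A c.
    by apply: scc; move: gt1; rewrite ec; case: (c2').
  have lt : (bwd [set z in r1 :: R] < fwd [set z in r1 :: R])%N by rewrite fK bK.
  have := scyc_half scc le0; rewrite card_ctr cV (cyc_card cK).2 => le3.
  apply: (phi_dl_gt0 cK lt le2); rewrite -[_.-1]addn0 -[X in (_ + X)%N]bK.
  apply: (term_pos lt tr (dlK c scc le0 gt0)); by move: le3; clear; lia.
(* Otherwise the ear ends at another vertex [fr d1] of [c] and replaces the arc [d :: p]. The suffix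
   [d1 :: q] has no backward majority, so the new cycle [C1] has more forward than backward
   steps. *)
have [p [q [d1 [ec2 xd1]]]] : exists p q : seq (E * bool), exists d1 : E * bool,
    c2' = p ++ d1 :: q /\ to s t (last r1 R) = fr s t d1.
  move: lR; rewrite inE => /mapP[d1 d1c xd1].
  have {}d1c : d1 \in c2'.
    by move: d1c; rewrite ec inE => /predU1P[e|//]; rewrite xd1 e eqxx in xy.
  by case/splitPr: d1c => p q; exists p, q, d1.
rewrite /d0 ec2 in to0; rewrite ec2 in ec; clear d0A d0c d0 ec2 c2'.
rewrite last_cat /= in to0.
have : path (link s t) d (p ++ d1 :: q) by move: cc; rewrite ec /= rcons_path => /andP[].
rewrite cat_path /= => /and3P[pp lp pq].
have ucs := uc; rewrite ec /= map_cat mem_cat negb_or cat_uniq in ucs.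
have /and4P[/andP[dp dq] up ds uq] := ucs.
have sc1 : scyc s t A ((r1 :: R) ++ d1 :: q).
  apply/and4P; split=> //.
  - apply/allP => z; rewrite mem_cat => /orP[/rL //|zq]; apply: aL.
    by rewrite ec inE mem_cat zq !orbT.
  - rewrite /= rcons_cat cat_path pR /= rcons_path pq /=.
    by rewrite /link /= xd1 to0 er !eqxx.
  - rewrite map_cat cat_uniq uR (uq : uniq (map (fr s t) (d1 :: q))) andbT.
    apply/hasPn => v vq; rewrite [_ \in _]/= inE negb_or; apply/andP; split.
      by apply: contra dq => /eqP; rewrite er => <-.
    apply/mapP => -[z /fR' zS ev]; case/negP: zS; rewrite -ev inE ec /= map_cat.
    by rewrite inE mem_cat vq !orbT.
set C1 := (r1 :: R) ++ d1 :: q in sc1.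
have nbC : nb C1 = nb (d1 :: q) by rewrite count_cat nbR.
have nfC : nf C1 = ((size R).+1 + nf (d1 :: q))%N by rewrite count_cat nfR.
have nbc : nb c = (nb (d :: p) + nb (d1 :: q))%N by rewrite ec -cat_cons count_cat.
have nfc : nf c = (nf (d :: p) + nf (d1 :: q))%N by rewrite ec -cat_cons count_cat.
have le1 : (nb (d1 :: q) <= nf (d1 :: q))%N by apply: (suf (d :: p)).
have gt2 : (0 < nb (d :: p))%N by rewrite /= nd.
have cK := scyc_cyc sc1; have fK := scyc_fwd sc1; have bK := scyc_bwd sc1.
rewrite nfC in fK; rewrite nbC in bK.
have [tr dlK hdK] := good_ctr cK.
pose X := fr s t @: [set z in C1].
have XE v : (v \in X) = (v \in map (fr s t) C1) by rewrite /X scyc_fr inE.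
have nX v : v \in X -> v \in map (fr s t) p -> False.
  rewrite XE /C1 map_cat mem_cat /= inE -orbA => h vp.
  have vS : v \in S by rewrite inE ec /= inE map_cat mem_cat vp !orbT.
  case/or3P: h => [/eqP ev|/mapP[z /fR' zS ev]|vq].
  - by rewrite -er -ev vp in dp.
  - by rewrite -ev vS in zS.
  - by case/hasP: ds; exists v.
have el : ctr X (to s t (last d p)) = ctr X (fr s t d).
  have -> : to s t (last d p) = fr s t d1 := eqP lp.
  by rewrite !ctr_in // XE map_cat mem_cat ?mem_head ?orbT // -er mem_head.
have up' : uniq (map (fr s t) (d :: p)) by rewrite /= dp up.
have aL' : all (mem (live s t A)) (d :: p).
  by apply/allP => z zp; apply: aL; rewrite ec -cat_cons mem_cat zp.
have [u2 sc2] := scyc_ctr erefl aL' pp nX up' el.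
have lt : (bwd [set z in C1] < fwd [set z in C1])%N.
  by rewrite fK bK; move: le1; clear; lia.
have sz2 : (nf (d :: p) + nb (d :: p) <= (m.+1 - (fwd [set z in C1] + bwd [set z in C1])).+1)%N.
  have -> : (nf (d :: p) + nb (d :: p) = size (d :: p))%N.
    exact: (count_predC (fun d : E * bool => d.2)).
  have := max_card (mem (map (fr (fun e => ctr X (s e)) (fun e => ctr X (t e))) (d :: p))).
  by rewrite (card_uniqP u2) size_map card_ctr cV (cyc_card cK).2.
have szK : (fwd [set z in C1] + bwd [set z in C1] <= m.+1)%N.
  by have := (cyc_card cK).1; rewrite cV => /andP[].
(* The contraction of [C1] shifts degrees by [bwd C1], which leaves the degree [nb (d :: p) - 1] for
   the closed arc. *)
have e1 : ((nb c).-1 = (nb (d :: p)).-1 + bwd [set z in C1])%N.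
  by rewrite bK nbc; move: gt2; clear; lia.
apply: (phi_dl_gt0 cK lt le2); rewrite e1.
have [le3|lt3] := leqP (nb (d :: p)) (nf (d :: p)).
  apply: (term_pos lt tr); last by move: le3 gt2 sz2; clear; lia.
  apply: dlK => //; apply: sc2; case: (p) gt2 le3 => //=.
  by case: (d.2) nd.
rewrite term_shift.
set f := forest_sum s t w1 A _ in tr dlK hdK *.
(* If the arc has no forward steps, [nb c <= nf c] makes the subtracted index negative. *)
have [z|a2] := posnP (nf (d :: p)).
  have -> : ((nb (d :: p)).-1 + bwd [set z in C1] < fwd [set z in C1])%N = true.
    rewrite fK bK; move: le0 gt2 z; rewrite nfc nbc; clear; lia.
  by rewrite subr0; apply: (trapez_gt0 tr); move: gt2 sz2 z; clear; lia.
have {}sc2 : scyc (fun e => ctr X (s e)) (fun e => ctr X (t e)) A (d :: p).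
  by apply: sc2; case: (p) a2 => //=; case: (d.2) nd.
(* The reversed arc has a forward majority, so [f] increases strictly in degree [nf (d :: p)]; by
   [nb c <= nf c] the subtracted index lies below this degree. *)
have cK2 := cyc_rv (scyc_cyc sc2).
have := hdK _ cK2; rewrite fwd_rv bwd_rv (scyc_fwd sc2) (scyc_bwd sc2) => /(_ lt3).
case na2: (nf (d :: p)) a2 lt3 sz2 => [//|a2] _ lt3 sz2; rewrite dlS subr_gt0 => h.
have h1 : f`_a2.+1 <= f`_(nb (d :: p)).-1 by apply: (trapez_le tr); move: lt3 sz2; clear; lia.
rewrite subr_gt0; apply: lt_le_trans h1; case: ifP => _.
  by apply: (trapez_gt0 tr); move: lt3 sz2; clear; lia.
apply: le_lt_trans h; move: lt3 sz2 le0 gt2; rewrite nfc nbc na2 => lt3 sz2 le0 gt2.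
apply: (trapez_le tr); rewrite ?fK ?bK; move: lt3 sz2 le0 gt2 szK; rewrite ?fK ?bK; clear; lia.
Qed.

Lemma good_trees_step : good_poly s t A m phi.
Proof.
split; [|exact: phi_dl_cycle|exact: phi_dl_head].
apply: (trapez_sum fwd_steps_gt0 phi_ident phi_terms).
- by rewrite -[m.+1]cV (leq_trans (size_forest_sum _ _ _ _)) // cards1 cV subn1.
- exact: directed_cycle.
- move=> K /andP[/cyc_scyc[c sc ->]]; rewrite (scyc_bwd sc) (scyc_fwd sc) => lt gt0.
  by apply: phi_dl_cycle => //; apply: ltnW.
Qed.

End Step.

Theorem trapez_trees m : good_trees m.
Proof.
elim/ltn_ind: m => -[|m] IH V E s t A r cV cA eA; last exact: good_trees_step.
rewrite forest_sum_card1 //.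
have nc c : ~~ scyc s t A c.
  by apply/negP => /scyc_size; rewrite cV; case: size => [|[|]].
split=> [|c sc|K /cyc_scyc[c sc]].
split=> [|i|||]; rewrite ?size_poly1 ?coef1 ?leqn0 //.
- by move=> /eqP ->.
- by case/negP: (nc c).
- by case/negP: (nc c).
Qed.

(** * Undirected edges *)

Lemma trapez_add n p q : trapez n p -> trapez n q -> trapez n (p + q).
Proof.
move=> [szp symp p0 mp pp] [szq symq q0 mq pq]; split.
- by rewrite (leq_trans (size_polyD _ _)) // geq_max szp.
- by move=> i le; rewrite !coefD symp // symq.
- by rewrite coefD addr_gt0.
- by move=> i le; rewrite !coefD lerD ?mp ?mq.
- move=> i le; have le' : (i.+1.*2 <= n)%N by lia.
  have := mp _ le'; have := mq _ le'; rewrite !coefD => h1 h2 e.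
  have e1 : p`_i = p`_i.+1 by lia.
  by rewrite (pp _ le e1) (pq _ le) //; lia.
Qed.

Lemma trapez_neq0 n p : trapez n p -> p != 0.
Proof. by case=> _ _ + _ _; apply: contraTneq => ->; rewrite coef0 ltxx. Qed.

Section Deletion.
Variables (V E : finType) (s t : E -> V).
Implicit Types (A : {set E}) (X : {set V}) (P : {set E * bool}).

Lemma forest_cut A a P d : forest s t A [set a] P -> d \in P ->
  forest s t A [set a; fr s t d] (P :\ d).
Proof.
case/forestP => PA cP rP dP; apply/forestP; split.
- by apply: subset_trans PA; apply: subsetDl.
- move=> v; have := cP v; rewrite -{1}(setD1K dP) fiberU; last first.
    by rewrite disjoints1 !inE eqxx.
  rewrite !inE negb_or [v == fr _ _ _]eq_sym; case: (eqVneq (fr s t d) v) => [<-|ne] /=.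
    have -> : [set d' in [set d] | fr s t d' == fr s t d] = [set d].
      by apply/setP => d'; rewrite !inE; case: eqP => // ->; rewrite eqxx.
    by rewrite cards1 andbF; case: (_ != a) => // -[].
  have -> : [set d' in [set d] | fr s t d' == v] = set0.
    by apply/setP => d'; rewrite !inE; case: eqP => // ->; apply/negbTE.
  by rewrite cards0 andbT.
- move=> u; have [x /set1P -> c] := rP u.
  have := @connect_avoid _ _ s t (mem [set a; fr s t d]) (P :\ d) P u a _ c; apply; last first.
    by rewrite /= !inE eqxx.
  move=> d' d'P; rewrite /= !inE negb_or d'P andbT => /andP[_].
  by apply: contra => /eqP ->.
Qed.

Lemma forest_glue A X P d : forest s t A (fr s t d |: X) P ->
  d \in live s t A -> to s t d \in X -> fr s t d \notin X ->
  forest s t A X (d |: P) /\ d \notin P.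
Proof.
case/forestP => PA cP rP dA da ne.
have dP : d \notin P.
  apply/negP => dP; have := cP (fr s t d); rewrite !inE eqxx => /eqP.
  by rewrite cards_eq0 => /eqP/setP/(_ d); rewrite !inE dP eqxx.
split=> //; apply/forestP; split.
- by rewrite subUset sub1set dA.
- move=> v; rewrite fiberU ?disjoints1 // cP !inE negb_or [v == fr _ _ _]eq_sym.
  case: (eqVneq (fr s t d) v) => [<-|nv] /=.
    have -> : [set d' in [set d] | fr s t d' == fr s t d] = [set d].
      by apply/setP => d'; rewrite !inE; case: eqP => // ->; rewrite eqxx.
    by rewrite cards1 ne.
  have -> : [set d' in [set d] | fr s t d' == v] = set0.
    by apply/setP => d'; rewrite !inE; case: eqP => // ->; apply/negbTE.
  by rewrite cards0.
- move=> u; have [x + c] := rP u; have c' := sub_nxt (subsetUr [set d] P) c.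
  rewrite !inE => /orP[/eqP e|xX]; last by exists x.
  exists (to s t d) => //; apply: connect_trans c' _.
  by rewrite e; apply/connect1/nxt_step/setU11.
Qed.

Lemma live_del A e d : d.1 != e -> (d \in live s t (A :\ e)) = (d \in live s t A).
Proof. by rewrite !inE => ->. Qed.

(** No step leaves the root, so a tree rooted at [s e] can use [e] only backwards; removing this
    step makes [t e] a second root. *)
Lemma forest_sum_del_contr (R : comNzRingType) (w : E * bool -> R) A e :
  e \in A -> s e != t e ->
  forest_sum s t w A [set s e] =
  forest_sum s t w (A :\ e) [set s e] + w (e, false) * forest_sum s t w (A :\ e) [set s e; t e].
Proof.
move=> eA ne; pose d := (e, false).
have dA : d \in live s t A by rewrite inE eA /= eq_sym.
rewrite {1}/forest_sum (bigID (fun P => d \in P)) /= addrC; congr (_ + _).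
  apply: eq_bigl => P; apply/andP/idP => [[fP dP]|fP].
    have [PA cP rP] := forestP _ _ _ _ _ fP; apply/forestP; split=> //.
    apply/subsetP => d' d'P; rewrite live_del ?(subsetP PA) //.
    case: d' d'P => e' [] /= d'P; apply/eqP => ee; last by case/negP: dP; rewrite /d -ee.
    have := cP (s e); rewrite set11 => /eqP; rewrite cards_eq0 => /eqP/setP/(_ (e', true)).
    by rewrite !inE d'P ee eqxx.
  have [PA cP rP] := forestP _ _ _ _ _ fP; split.
    apply/forestP; split=> //; apply: subset_trans PA _.
    by apply/subsetP => d'; rewrite !inE -andbA => /and3P[_ -> ->].
  by apply/negP => /(subsetP PA); rewrite !inE eqxx.
rewrite /forest_sum mulr_sumr (reindex_onto (fun P => d |: P) (fun P => P :\ d)) /=; last first.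
  by move=> P /andP[_ dP]; rewrite setD1K.
have sub P : P \subset live s t (A :\ e) -> d \notin P /\ P \subset live s t A.
  move=> PA; split; first by apply/negP => /(subsetP PA); rewrite !inE eqxx.
  apply: subset_trans PA _.
  by apply/subsetP => d'; rewrite !inE -andbA => /and3P[_ -> ->].
have h P : forest s t (A :\ e) [set s e; t e] P ->
    forest s t A [set s e] (d |: P) /\ d \notin P.
  rewrite setUC => fP; apply: forest_glue => //; rewrite ?inE ?eqxx //; last by rewrite eq_sym.
  have [PA cP rP] := forestP _ _ _ _ _ fP; apply/forestP; split=> //.
  by case: (sub P PA).
apply: eq_big => [P|P]; last first.
  case/andP => /andP[fP _] /eqP e1.
  have dP : d \notin P by rewrite -e1 !inE eqxx.
  by rewrite big_setU1.
apply/idP/idP => [/andP[/andP[fP _] /eqP e1]|fP]; last first.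
  by have [-> dP] := h P fP; rewrite setU11 setU1K ?eqxx.
have := forest_cut fP (setU11 d P); rewrite e1 => fP'.
have [PA cP rP] := forestP _ _ _ _ _ fP'; apply/forestP; split=> //.
apply/subsetP => d' d'P; rewrite live_del ?(subsetP PA) //.
apply/eqP => ee; have : #|[set d'' in P | fr s t d'' == fr s t d']| = 0%N.
  by rewrite cP !inE; case: d' ee {d'P} => e' [] /= ->; rewrite eqxx ?orbT.
by move/eqP; rewrite cards_eq0 => /eqP/setP/(_ d'); rewrite !inE d'P eqxx.
Qed.

Lemma forest_sum_live (R : comNzRingType) (w : E * bool -> R) A A' X :
  live s t A = live s t A' -> forest_sum s t w A X = forest_sum s t w A' X.
Proof. by move=> e; apply: eq_bigl => P; rewrite /forest e. Qed.

End Deletion.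

(** * Sorting trees by their number of undirected edges *)

Section Rows.
Variables (E : finType) (pos : pred E).
Implicit Types (A : {set E}) (P : {set E * bool}).

Definition nund P : nat := #|[set d in P | ~~ pos d.1]|.
Definition nfwd P : nat := #|[set d in P | pos d.1 && d.2]|.
Definition nbwd P : nat := #|[set d in P | pos d.1 && ~~ d.2]|.

Lemma card_pos_und P : (nfwd P + nbwd P + nund P)%N = #|P|.
Proof.
rewrite -(cardsID [set d | pos d.1] P) -(cardsID [set d | d.2] (P :&: _)).
by congr (_ + _ + _)%N; apply: eq_card => d; rewrite !inE; case: (d \in P); case: pos; case: d.2.
Qed.

Lemma nund_del P d : d \in P -> nund P = (~~ pos d.1 + nund (P :\ d))%N.
Proof.
move=> dP; rewrite /nund (cardsD1 d) inE dP /=; congr (_ + _)%N.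
by apply: eq_card => d'; rewrite !inE andbA.
Qed.

Lemma wt_prod P : \prod_(d in P) wt pos d = ('X^(nbwd P))%:P * 'X^(nund P).
Proof.
rewrite (bigID (fun d => pos d.1)) /=; congr (_ * _); last first.
  rewrite (eq_bigr (fun=> 'X)) => [|d /andP[_ /negbTE h]]; last by rewrite /wt h.
  by rewrite prodr_const /nund cardsE.
rewrite (bigID (fun d => d.2)) /= big1 ?mul1r => [|d /andP[/andP[_ h1] h2]]; last first.
  by rewrite /wt h1 h2.
rewrite (eq_bigr (fun=> 'X%:P)) => [|d /andP[/andP[_ h1] /negbTE h2]]; last first.
  by rewrite /wt h1 h2.
rewrite prodr_const polyC_exp /nbwd cardsE; congr (_ ^+ _).
by apply: eq_card => d; rewrite !unfold_in /= -andbA.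
Qed.

Section Graph.
Variables (V : finType) (s t : E -> V).

Definition row A X l : {poly int} := (forest_sum s t (wt pos) A X)`_l.

Lemma rowE A X l : row A X l = \sum_(P | forest s t A X P && (nund P == l)) 'X^(nbwd P).
Proof.
rewrite /row /forest_sum coef_sum [RHS]big_mkcondr /=; apply: eq_bigr => P _.
by rewrite wt_prod coefCM coefXn eq_sym; case: eqP => _; rewrite ?mulr1 ?mulr0.
Qed.

Lemma row_coef A X l i :
  (row A X l)`_i = #|[set P | [&& forest s t A X P, nund P == l & nbwd P == i]]|%:Z.
Proof.
rewrite rowE coef_sum -natz -sum1dep_card natr_sum [RHS]big_mkcond [LHS]big_mkcond /=.
apply: eq_bigr => P _; rewrite coefXn [i == _]eq_sym; case: (forest _ _ _ _ _) => //=.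
by case: (_ == l) => //=; case: eqP.
Qed.

Lemma row_neq0 A X l :
  reflect (exists2 P, forest s t A X P & nund P = l) (row A X l != 0).
Proof.
apply: (iffP idP) => [h|[P fP e]].
  case: (pickP (fun P => forest s t A X P && (nund P == l))) => [P /andP[fP /eqP e]|h0].
    by exists P.
  by rewrite rowE big_pred0 ?eqxx in h.
apply/eqP => /(congr1 (fun p : {poly int} => p`_(nbwd P))); rewrite coef0 row_coef => /eqP.
by rewrite eqz_nat cards_eq0 => /eqP/setP/(_ P); rewrite !inE fP e !eqxx.
Qed.

End Graph.

Definition convex (I : nat -> Prop) : Prop :=
  forall i j k, (i <= j <= k)%N -> I i -> I k -> I j.

Definition good_rows (V : finType) (s t : E -> V) A r n : Prop :=
  (forall l, row s t A [set r] l != 0 -> (l <= n)%N /\ trapez (n - l) (row s t A [set r] l))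
  /\ convex (fun l => row s t A [set r] l != 0).

Lemma eulerian_del (V : finType) (s t : E -> V) A e : ~~ pos e ->
  eulerian s t pos A -> eulerian s t pos (A :\ e).
Proof.
move=> ne eA v; rewrite -[RHS](eA v) [RHS](bigID (fun d => d.1 == e)) /= [X in _ = X + _]big1 ?add0r.
  by apply: eq_bigl => d; rewrite !inE -andbA andbC.
by move=> d /andP[_ /eqP h]; rewrite /sg h (negbTE ne).
Qed.

(** Row [l] is the sum of row [l] of the deletion and row [l - 1] of the contraction. The latter has
    one vertex less, so both are centred at [(n - l) / 2]. *)
Lemma rows_good (V : finType) (s t : E -> V) A r n :
  #|V| = n.+1 -> eulerian s t pos A -> good_rows s t A r n.
Proof.
have [k] := ubnP #|[set e in A | ~~ pos e]|.
elim: k V s t A r n => // k IH V s t A r n ltk cV eA.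
case: (pickP (fun e => (e \in A) && ~~ pos e)) => [e /andP[eA' ne]|allpos]; last first.
  have posA e : e \in A -> pos e by move=> eA'; have := allpos e; rewrite eA' => /negbFE.
  have eF : forest_sum s t (wt pos) A [set r] = (forest_sum s t w1 A [set r])%:P.
    rewrite (forest_sum_rmorph s t (polyC : {rmorphism {poly int} -> {poly {poly int}}})).
    apply: eq_bigr => P /forestP[PA _ _]; apply: eq_bigr => d /(subsetP PA).
    by rewrite inE => /andP[/posA pd _]; rewrite /wt pd.
  have eA1 : eulerian s t predT A.
    move=> v; rewrite -[RHS](eA v); apply: eq_bigr => d /andP[/posA pd _].
    by rewrite /sg pd.
  have h l : row s t A [set r] l != 0 -> l = 0%N /\ trapez n (row s t A [set r] l).
    rewrite /row eF coefC; case: (l =P 0%N) => [->|_]; last by rewrite eqxx.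
    by move=> /forest_sum_nconn cA; split=> //; case: (trapez_trees r cV cA eA1).
  split=> [l /h[-> tr]|i j l /andP[le1 le2] /h[i0 _]]; first by rewrite subn0.
  move=> /[dup] nz /h[l0 _]; rewrite (_ : j = l) //; lia.
have ltk' : (#|[set x in A :\ e | ~~ pos x]| < k)%N.
  move: ltk; rewrite ltnS; apply: leq_trans; apply: proper_card.
  apply/properP; split; first by apply/subsetP => x; rewrite !inE -andbA => /and3P[_ -> ->].
  by exists e; rewrite !inE ?eA' ?ne ?eqxx.
have eD := eulerian_del ne eA.
have [loop|nloop] := eqVneq (s e) (t e).
  have eL : live s t A = live s t (A :\ e).
    apply/setP => d; rewrite !inE; case: (d.1 =P e) => //= ed.
    by rewrite ed eA' /to /fr /= ed; case: d.2; rewrite /= loop eqxx.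
  have [h1 h2] := IH _ s t (A :\ e) r n ltk' cV eD.
  have rE l : row s t A [set r] l = row s t (A :\ e) [set r] l.
    by congr (polyseq _)`_l; apply: forest_sum_live eL.
  by split=> [l|i j l]; rewrite !rE; [apply: h1 | apply: h2].
pose X : {set V} := [set s e; t e].
have X0 : X != set0 by apply/set0Pn; exists (s e); rewrite !inE eqxx.
have cX : #|X| = 2%N by rewrite cards2 nloop.
have [h1 h2] := IH _ s t (A :\ e) (s e) n ltk' cV eD.
have n0 : (0 < n)%N by have := max_card (mem X); rewrite cX cV.
have cV' : #|{: option {v | v \notin X}}| = n.-1.+1 by rewrite card_ctr cX cV; lia.
have [] := IH _ _ _ _ None _ ltk' cV' (eulerian_ctr (X := X) eD).
have rowX l : row (fun e => ctr X (s e)) (fun e => ctr X (t e)) (A :\ e) [set None] l =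
    row s t (A :\ e) X l by rewrite /row forest_sum_ctr.
move=> h3 h4; have {}h3 l : row s t (A :\ e) X l != 0 ->
    (l <= n.-1)%N /\ trapez (n.-1 - l) (row s t (A :\ e) X l).
  by rewrite -rowX; apply: h3.
have {}h4 : convex (fun l => row s t (A :\ e) X l != 0).
  by move=> i j l; rewrite -!rowX; apply: h4.
have rec l : row s t A [set r] l =
    row s t (A :\ e) [set s e] l + (if l is l'.+1 then row s t (A :\ e) X l' else 0).
  rewrite /row (forest_sum_root r (s e) eA) forest_sum_del_contr // coefD; congr (_ + _).
  by rewrite {1}/wt (negbTE ne) coefXM; case: l.
(* Cutting a tree of the deletion at the step out of [t e] loses at most one undirected edge. So
   each nonzero row of the deletion is next to one of the contraction, and no gap opens between the
   two supports. *)
have link l : row s t (A :\ e) [set s e] l != 0 ->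
    row s t (A :\ e) X l != 0 \/ exists2 l', l = l'.+1 & row s t (A :\ e) X l' != 0.
  case/row_neq0 => P fP eP; have [_ cP _] := forestP _ _ _ _ _ fP.
  have [|d [dP dt] _] := @fiber1 _ _ s t P (t e); first by rewrite cP !inE eq_sym nloop.
  have := forest_cut fP dP; rewrite dt -/X => fX.
  have := nund_del dP; rewrite eP; case: (pos d.1) => /= el.
    by left; apply/row_neq0; exists (P :\ d).
  by right; exists (nund (P :\ d)); [rewrite el | apply/row_neq0; exists (P :\ d)].
have nz l : (row s t A [set r] l != 0) <->
    row s t (A :\ e) [set s e] l != 0 \/ exists2 l', l = l'.+1 & row s t (A :\ e) X l' != 0.
  rewrite rec; split.
    have [->|] := eqVneq (row s t (A :\ e) [set s e] l) 0; last by left.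
    by rewrite add0r; case: l => [|l'] h; [rewrite eqxx in h | right; exists l'].
  case: l => [|l] h; first by case: h => [h|[]//]; rewrite addr0.
  have [z|/[dup] nz1 /h3[le3 t3]] := eqVneq (row s t (A :\ e) X l) 0.
    by rewrite z addr0; case: h => // -[l' [<-]]; rewrite z eqxx.
  have [->|/h1[_ t1]] := eqVneq (row s t (A :\ e) [set s e] l.+1) 0; first by rewrite add0r.
  have e3 : (n.-1 - l = n - l.+1)%N by lia.
  by rewrite e3 in t3; apply: trapez_neq0 (trapez_add t1 t3).
split=> [l|].
  move=> /nz h.
  have lel : (l <= n)%N.
    by case: h => [/h1[]//|[l' -> /h3[le3 _]]]; lia.
  split=> //; rewrite rec; case: l h lel => [|l] h lel.
    by rewrite addr0; case: h => [/h1[]|[]].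
  have e3 : (n.-1 - l = n - l.+1)%N by lia.
  have [z|/h3[_ t3]] := eqVneq (row s t (A :\ e) X l) 0.
    by rewrite z addr0; case: h => [/h1[]//|[l' [<-]]]; rewrite z eqxx.
  rewrite e3 in t3; have [->|/h1[_ t1]] := eqVneq (row s t (A :\ e) [set s e] l.+1) 0.
    by rewrite add0r.
  exact: trapez_add.
move=> i j l /andP[le1 le2] /nz hi /nz hl; apply/nz.
have {}link i' : row s t (A :\ e) [set s e] i' != 0 ->
    exists2 x, (x <= i' <= x.+1)%N & row s t (A :\ e) X x != 0.
  by case/link => [h|[x -> h]]; [exists i' | exists x]; rewrite ?leqnn ?leqnSn.
case: j le1 le2 => [|j] le1 le2.
  by left; move: hi; rewrite leqn0 in le1; rewrite (eqP le1) => -[//|[]].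
case: hi hl => [hi|[i' ei hi]] [hl|[l' el hl]].
- by left; apply: h2 hi hl; rewrite le1.
- have [x lex hx] := link _ hi; have [ei|ni] := eqVneq i j.+1; first by left; rewrite -ei.
  by right; exists j => //; apply: h4 hx hl; lia.
- by have [x lex hx] := link _ hl; right; exists j => //; apply: h4 hi hx; lia.
- by right; exists j => //; apply: h4 hi hl; lia.
Qed.

End Rows.

(** * Laurent coefficients *)

(** The shift by ['X] aligns the centres. No plateau starts in degree 0, where the constant
    coefficient of [q] forces an increase; later, both increments must vanish together. *)
Lemma trapez_addX n p q : trapez n.+2 p -> trapez n q -> trapez n.+2 (p + 'X * q).
Proof.
move=> tp tq; have [szp symp p0 mp pp] := tp; have [szq symq q0 mq pq] := tq.
have cE i : (p + 'X * q)`_i.+1 = p`_i.+1 + q`_i by rewrite coefD coefXM.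
have c0 : (p + 'X * q)`_0 = p`_0 by rewrite coefD coefXM addr0.
split.
- rewrite (leq_trans (size_polyD _ _)) // geq_max szp /=.
  have [->|nz] := eqVneq q 0; first by rewrite mulr0 size_poly0.
  by rewrite mulrC size_mulX // !ltnS ltnW // ltnS.
- case=> [|i] le; rewrite ?subn0 ?subSS ?c0 cE.
    by rewrite (trapez_out tq) // addr0 symp // subn0.
  have [e|lt] : i = n.+1 \/ (i <= n)%N by lia.
    by rewrite e subnn c0 (trapez_out tq) // addr0 symp // subnn.
  have -> : (n.+1 - i = (n - i).+1)%N by lia.
  rewrite cE symp // (symq i) //; congr (p`_ _ + _); lia.
- by rewrite c0.
- case=> [|i] le; rewrite !cE ?c0.
    by rewrite (le_trans (mp _ le)) // lerDl ltW.
  by rewrite lerD ?mp ?mq //; lia.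
- case=> [|i] le; rewrite !cE ?c0.
    by move=> e; have := mp 0%N isT; rewrite e gerDl leNgt q0.
  move=> e; have le1 : (i.+2.*2 <= n.+2)%N by lia.
  have le2 : (i.+1.*2 <= n)%N by lia.
  have := mp _ le1; have := mq _ le2 => h1 h2.
  have e1 : p`_i.+1 = p`_i.+2.
    by apply: le_anti; rewrite h2 -(lerD2r q`_i.+1) -e lerD2l h1.
  have e2 : q`_i = q`_i.+1 by move: e; rewrite e1 => /addrI.
  by rewrite (pp _ le e1) (pq _ _ e2) //; lia.
Qed.

Lemma trapez_trapezoidal n p : trapez n p -> trapezoidal (mkseq (nth 0 p) n.+1).
Proof.
move=> tp; have [sz sym p0 mono plat] := tp; pose s := mkseq (nth 0 p) n.+1.
have sE k : s`_k = p`_k.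
  have [lt|ge] := ltnP k n.+1; first by rewrite nth_mkseq.
  by rewrite nth_default ?size_mkseq // (trapez_out tp).
split=> [k|]; first by rewrite sE; apply: trapez_ge0 tp k.
(* The least [i] without a strict increase before the middle is where the plateau begins; by
   symmetry it ends at [n - i]. *)
right; pose Q i := ~~ ((i.+1.*2 <= n)%N && (p`_i < p`_i.+1)).
have exQ : exists i, Q i by exists n; rewrite /Q negb_and; apply/orP; left; lia.
case: (ex_minnP exQ) => i Qi mini.
have nQ k : (k < i)%N -> (k.+1.*2 <= n)%N && (p`_k < p`_k.+1).
  by move=> ltk; apply: contraLR ltk => /mini; rewrite -leqNgt.
have lei : (i.*2 <= n)%N by case: i nQ {Qi mini} => // i /(_ i (leqnn _))/andP[].
have lt k : (k < i)%N -> p`_k < p`_k.+1 by case/nQ/andP.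
exists i, (n - i)%N; rewrite size_mkseq; split.
- lia.
- by move=> k ltk; rewrite !sE; apply: lt.
- move=> k /andP[le1 le2]; rewrite !sE.
  have [h|h] := leqP i.+1.*2 n; last first.
    by rewrite sym; [congr (p`_ _); lia | lia].
  have e : p`_i = p`_i.+1.
    by apply: le_anti; rewrite mono // leNgt; move: Qi; rewrite /Q h.
  by rewrite !(trapez_plateau tp h e) //; lia.
- move=> k le1 le2; rewrite !sE (sym k); last by lia.
  rewrite (sym k.+1); last by lia.
  have -> : (n - k = (n - k.+1).+1)%N by lia.
  by apply: lt; lia.
Qed.

Section Laurent.
Variables (V E : finType) (s t : E -> V) (pos : pred E) (A : {set E}) (r : V) (n : nat).
Hypotheses (cV : #|V| = n.+1) (eA : eulerian s t pos A).
Local Notation frst := (forest s t A [set r]).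
Local Notation rw := (row pos s t A [set r]).

Definition stat (P : {set E * bool}) : int := (nbwd pos P)%:Z - (nfwd pos P)%:Z.
Definition stat_count j : int := #|[set P | frst P & stat P == j]|%:Z.

Lemma forest_count P : frst P -> (nfwd pos P + nbwd pos P + nund pos P)%N = n.
Proof. by move=> fP; rewrite card_pos_und (forest_card fP) cV cards1 subn1. Qed.

(** As the three kinds of steps add up to [n], the statistic is
    [2 * (nbwd + (nund - l) / 2) - (n - l)]. The exponent used here is thus the position of this
    degree among those of its parity, counted from [-(n - l)]. *)
Definition stack l : {poly int} :=
  \sum_(P | [&& frst P, (l <= nund pos P)%N & odd (nund pos P) == odd l])
    'X^(nbwd pos P + (nund pos P - l)./2).

Lemma stackE l : stack l = rw l + 'X * stack l.+2.
Proof.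
rewrite /stack (bigID (fun P => nund pos P == l)) /= mulr_sumr rowE; congr (_ + _).
  apply: eq_big => [P|P /andP[_ /eqP->]]; last by rewrite subnn addn0.
  by case: (frst P); case: (eqVneq (nund pos P) l) => [->|_]; rewrite ?leqnn ?eqxx ?andbF.
apply: eq_big => [P|P /andP[/and3P[_ le /eqP o] /eqP ne]].
  rewrite -!andbA; congr (_ && _).
  by move: (nund pos P) => u /=; rewrite negbK; apply/idP/idP; clear; lia.
rewrite -exprS -addnS; congr ('X^(_ + _)).
have : (l.+2 <= nund pos P)%N.
  by move: le o ne; move: (nund pos P) => u; clear; lia.
clear; lia.
Qed.

Lemma stack_coef l k : (stack l)`_k =
  #|[set P | [&& frst P, (l <= nund pos P)%N, odd (nund pos P) == odd l
     & (nbwd pos P + (nund pos P - l)./2)%N == k]]|%:Z.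
Proof.
rewrite coef_sum -natz -sum1dep_card natr_sum [RHS]big_mkcond [LHS]big_mkcond /=.
apply: eq_bigr => P _; rewrite coefXn [k == _]eq_sym; case: (frst P) => //=.
by case: (l <= _)%N => //=; case: (odd _ == _) => //=; case: eqP.
Qed.

(** Each row is added to the stack of shorter rows above it. If row [l + 2] vanishes, convexity
    leaves nothing beyond it. *)
Lemma trapez_stack l : rw l != 0 -> trapez (n - l) (stack l).
Proof.
have [h1 h2] := rows_good r cV eA.
have [k] := ubnP (n - l); elim: k l => // k IH l ltk nz.
have [leln tl] := h1 _ nz; rewrite stackE.
have [z|nz2] := eqVneq (rw l.+2) 0; last first.
  have [le2 _] := h1 _ nz2; have -> : (n - l = (n - l.+2).+2)%N by lia.
  apply: trapez_addX; last by apply: IH nz2; lia.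
  by have -> : ((n - l.+2).+2 = n - l)%N by lia.
rewrite /stack big_pred0 ?mulr0 ?addr0 // => P; apply/negP => /and3P[fP le _].
have : rw l.+2 != 0; last by rewrite z eqxx.
apply: h2 nz _; last by apply/row_neq0; exists P.
by rewrite le andbT; lia.
Qed.

Lemma stat_count_neq0 j : stat_count j != 0 -> exists2 P, frst P & stat P = j.
Proof.
by rewrite eqz_nat cards_eq0 => /set0Pn[P]; rewrite inE => /andP[fP /eqP]; exists P.
Qed.

Lemma laurent_stat_count : laurent_coefs (\sum_(P | frst P) tvar ^ stat P) stat_count.
Proof.
have bound P : frst P -> (`|stat P| <= n)%N.
  by move=> /forest_count; rewrite /stat; lia.
exists n; split=> [j lt|].
  apply/eqP/negPn/negP => /stat_count_neq0[P /bound le e]; move: le; rewrite e; lia.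
pose idx P : 'I_n.*2.+1 := inord `|stat P + n%:Z|.
rewrite (partition_big idx xpredT) //=; apply: eq_bigr => k _.
rewrite (eq_bigl (fun P => P \in [set P | frst P & stat P == k%:Z - n%:Z])) => [|P].
  rewrite (eq_bigr (fun=> tvar ^ (k%:Z - n%:Z))) => [|P]; last first.
    by rewrite inE => /andP[_ /eqP->].
  by rewrite sumr_const -mulr_natl /stat_count pmulrn.
rewrite inE; case fP: (frst P) => //=; have := bound P fP => le.
apply/eqP/eqP => [<-|e].
  by rewrite /idx inordK; lia.
by apply/val_inj; rewrite /idx /= e inordK; lia.
Qed.

Lemma stat_parity P : frst P -> odd `|stat P| = odd (n - nund pos P).
Proof. by move/forest_count; rewrite /stat; lia. Qed.

(** The least nonzero row [l0] of the right parity is the longest, so its stack contains all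
    coefficients and starts in degree [-(n - l0)]. *)
Lemma forest_trapezoidal b : trapezoidal_coefs b (\sum_(P | frst P) tvar ^ stat P).
Proof.
exists stat_count; have [h1 h2] := rows_good r cV eA.
pose I l := (rw l != 0) && (odd (n - l) == b).
have PI P : frst P -> odd `|stat P| = b -> I (nund pos P).
  move=> fP o; rewrite /I -stat_parity // o eqxx andbT.
  by apply/row_neq0; exists P.
case: (pickP (fun l : 'I_n.+1 => I l)) => [l Il|no]; last first.
  exists [::]; split; first exact: laurent_stat_count.
    exists (b : nat)%:Z; split=> //; first by case: b {I no PI}.
    move=> j o /stat_count_neq0[P fP e]; exfalso.
    have := PI P fP; rewrite e => /(_ o) h; have /andP[/h1[le _] _] := h.
    by have := no (Ordinal (le : (nund pos P < n.+1)%N)); rewrite /= h.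
  by split=> [k|]; [rewrite nth_nil | left].
case: (ex_minnP (ex_intro (fun l => I l) (l : nat) Il)) => l0 /andP[nz0 /eqP o0] min0.
have [le0 _] := h1 _ nz0; have tr := trapez_stack nz0.
have stackcE k : stat_count ((2 * k)%N%:Z - (n - l0)%N%:Z) = (stack l0)`_k.
  rewrite stack_coef; congr Posz; apply: eq_card => P; rewrite !inE.
  case fP: (frst P) => //=; have c := forest_count fP.
  apply/eqP/and3P => [e|[le /eqP o /eqP e]]; last by rewrite /stat; lia.
  have le : (l0 <= nund pos P)%N.
    apply: min0; apply: PI fP _; rewrite e -o0; clear; lia.
  by move: e le c; rewrite /stat; clear -le0; split; lia.
exists (mkseq (nth 0 (stack l0)) (n - l0).+1).
split; first exact: laurent_stat_count; last exact: trapez_trapezoidal.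
exists (- (n - l0)%N%:Z); split.
- by rewrite abszN.
- rewrite size_mkseq; apply/eq_mkseq => k; rewrite -stackcE; congr stat_count; lia.
- move=> j o /stat_count_neq0[P fP e].
  have c := forest_count fP; have le : (l0 <= nund pos P)%N.
    by apply: min0; apply: PI fP _; rewrite e.
  have o1 := stat_parity fP; rewrite e o -o0 in o1.
  exists (nbwd pos P + (nund pos P - l0)./2)%N; rewrite ?size_mkseq.
    by move: c le; clear; lia.
  by move: e c le o1; rewrite /stat; clear; lia.
- move=> _; have [_ sym p0 _ _] := tr; split.
    by rewrite /= gt_eqF.
  by rewrite -nth_last size_mkseq nth_mkseq //= gt_eqF // (trapez_gt0 tr).
Qed.

End Laurent.

(** * Cuts, cycles and spanning trees *)

Section Trees.
Local Open Scope nat_scope.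
Variables (V E : finType) (s t : E -> V).
Implicit Types (A C : {set E}) (X Y : {set V}) (P : {set E * bool}).
Local Notation fr := (fr s t).
Local Notation to := (to s t).
Local Notation nxt := (nxt s t).

Definition edges P : {set E} := fst @: P.

(** The cut around [Y]; for the dual end points it is the boundary of a union of faces. *)
Definition bd Y : {set E} := [set e | (s e \in Y) != (t e \in Y)].

Definition deg C v : nat := #|[set e in C | s e == v]| + #|[set e in C | t e == v]|.

(** The cycle space modulo 2; a loop counts twice in [deg]. *)
Definition even C : Prop := forall v, ~~ odd (deg C v).

Definition dsc P v : {set V} := [set u | connect (nxt P) u v].

Lemma mem_edges P d : d \in P -> d.1 \in edges P.
Proof. exact: imset_f. Qed.

Lemma bd_step Y d : (d.1 \in bd Y) = ((fr d \in Y) != (to d \in Y)).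
Proof. by case: d => e []; rewrite inE // eq_sym. Qed.

Lemma sum_deg C Y : \sum_(v in Y) deg C v = #|C :&: bd Y| + 2 * #|[set e in C | (s e \in Y) && (t e \in Y)]|.
Proof.
have half (f : E -> V) : \sum_(v in Y) #|[set e in C | f e == v]| = #|[set e in C | f e \in Y]|.
  rewrite -[RHS]sum1dep_card (partition_big f (mem Y)) /=; last by move=> e /andP[].
  apply: eq_bigr => v vY; rewrite -sum1dep_card; apply: eq_bigl => e.
  by rewrite -andbA; congr (_ && _); case: eqP => [->|]; rewrite ?vY ?andbF.
rewrite big_split /= !half mul2n -addnn addnA.
rewrite -(cardsID [set e | t e \in Y] [set e in C | s e \in Y]).
rewrite -(cardsID [set e | s e \in Y] [set e in C | t e \in Y]).
rewrite -(cardsID [set e | s e \in Y] (C :&: bd Y)).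
set a := #|_ :&: _|; set b := #|_ :\: _|; set c := #|_ :&: _|; set d := #|_ :\: _|.
set a' := #|_ :&: _|; set b' := #|_ :\: _|; set g := #|_|.
have -> : a = g by apply: eq_card => e; rewrite !inE andbA.
have -> : c = g by apply: eq_card => e; rewrite !inE -andbA [(t e \in Y) && _]andbC.
have -> : a' = b.
  by apply: eq_card => e; rewrite !inE; case: (s e \in Y); case: (t e \in Y); case: (e \in C).
have -> : b' = d.
  by apply: eq_card => e; rewrite !inE; case: (s e \in Y); case: (t e \in Y); case: (e \in C).
lia.
Qed.

Lemma even_bd C Y : even C -> ~~ odd #|C :&: bd Y|.
Proof.
move=> eC; have : ~~ odd (\sum_(v in Y) deg C v).
  apply: (big_ind (fun n => ~~ odd n)) => // m n.
  by rewrite oddD => /negbTE -> /negbTE ->.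
by rewrite sum_deg oddD mul2n odd_double addbF.
Qed.

Section Forest.
Variables (A : {set E}) (X : {set V}) (P : {set E * bool}).
Hypothesis fP : forest s t A X P.

Lemma forest_inj d d' : d \in P -> d' \in P -> fr d = fr d' -> d = d'.
Proof.
case/forestP: fP => _ cP _ dP d'P e; have := cP (fr d).
case: (_ \notin X) => [|/eqP]; last first.
  by rewrite cards_eq0 => /eqP/setP/(_ d); rewrite !inE dP eqxx.
case/fiber1 => d0 _ h; exact: etrans (h d dP erefl) (esym (h d' d'P (esym e))).
Qed.

Lemma forest_root d : d \in P -> fr d \notin X.
Proof.
case/forestP: fP => _ cP _ dP; apply/negP => fX; have := cP (fr d); rewrite fX => /eqP.
by rewrite cards_eq0 => /eqP/setP/(_ d); rewrite !inE dP eqxx.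
Qed.

Lemma forest_det d v : d \in P -> fr d != v -> connect (nxt P) (fr d) v -> connect (nxt P) (to d) v.
Proof.
move=> dP ne /connectP[[|x p] /= ].
  by move=> _ e; rewrite e eqxx in ne.
case/andP => /nxtP[d' [d'P e <-]] pth ->; rewrite -(forest_inj d'P dP e).
by apply/connectP; exists p.
Qed.

Lemma forest_acyc d : d \in P -> to d \notin dsc P (fr d).
Proof.
move=> dP; rewrite inE; apply/negP => c.
have [x xX] : exists2 x, x \in X & connect (nxt P) (fr d) x.
  by case/forestP: fP => _ _; apply.
have stp d' : d' \in P -> connect (nxt P) (fr d') (fr d) -> connect (nxt P) (to d') (fr d).
  move=> d'P c'; have [e|ne] := eqVneq (fr d') (fr d); first by rewrite (forest_inj d'P dP e).
  exact: forest_det.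
have stay u : connect (nxt P) (fr d) u -> connect (nxt P) u (fr d).
  case/connectP => p + ->; elim/last_ind: p => [|p y IH] /=; first by rewrite connect0.
  rewrite rcons_path last_rcons => /andP[/IH {}IH /nxtP[d' [d'P e <-]]].
  by apply: stp; rewrite ?e.
move/stay/connectP => [[|y p] /=]; first by move=> _ e; case/negP: (forest_root dP); rewrite e.
by case/andP => /nxtP[d' [d'P e _]] _ _; case/negP: (forest_root d'P); rewrite e.
Qed.

Lemma dsc_root d x : d \in P -> x \in X -> x \notin dsc P (fr d).
Proof.
move=> dP xX; rewrite inE; apply/negP => /connectP[[|y p] /=].
  by move=> _ e; case/negP: (forest_root dP); rewrite e.
by case/andP => /nxtP[d' [d'P e _]] _ _; case/negP: (forest_root d'P); rewrite e.
Qed.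

Lemma dsc_cut d d' : d \in P -> d' \in P -> (d'.1 \in bd (dsc P (fr d))) = (d' == d).
Proof.
move=> dP d'P; rewrite bd_step; case: (eqVneq d' d) => [->|ne].
  by rewrite (negbTE (forest_acyc dP)) inE connect0.
apply/negbTE; rewrite negbK; apply/eqP; apply/idP/idP; rewrite !inE => c.
  by apply: forest_det => //; apply: contra ne => /eqP /(forest_inj d'P dP) ->.
by apply: connect_trans c; apply/connect1/nxt_step.
Qed.

(** Two steps along the same edge cross the same cuts, and only [d] crosses the cut around the
    descendants of [fr d]. *)
Lemma edges_inj : {in P &, injective fst}.
Proof.
move=> d d' dP d'P e; apply/eqP; rewrite eq_sym -(dsc_cut dP d'P) -e.
by rewrite (dsc_cut dP dP).
Qed.

Lemma card_edges : #|edges P| = #|P|.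
Proof. exact: card_in_imset edges_inj. Qed.

Lemma edges_bd d : d \in P -> edges P :&: bd (dsc P (fr d)) = [set d.1].
Proof.
move=> dP; apply/setP => e; apply/setIP/set1P => [[/imsetP[d' d'P ->]]|->].
  by rewrite dsc_cut // => /eqP ->.
by rewrite mem_edges // dsc_cut.
Qed.

(* The cut around the descendants of a vertex contains a single edge of the tree, so by the
   handshake lemma that edge is not in [C]. *)
Lemma even_forest C : even C -> C \subset edges P -> C = set0.
Proof.
move=> eC CP; apply/eqP; rewrite -subset0; apply/subsetP => e eC'.
have /imsetP[d dP ed] := subsetP CP e eC'.
have := even_bd (dsc P (fr d)) eC; rewrite (_ : C :&: _ = [set e]) ?cards1 //.
have -> : [set e] = C :&: [set e] by apply/esym/setIidPr; rewrite sub1set.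
by rewrite ed -(edges_bd dP) setIA (setIidPl CP).
Qed.

Lemma connect_off_dsc d u : d \in P -> u \notin dsc P (fr d) ->
  exists2 x, x \in X & connect (nxt [set d' in P | fr d' \notin dsc P (fr d)]) u x.
Proof.
move=> dP; case/forestP: fP => _ _ /(_ u)[x xX /connectP[p pth ex]]; exists x => //.
elim: p u pth ex H => [|y p IH] u /=; first by move=> _ -> _; exact: connect0.
case/andP => /nxtP[d' [d'P <- <-]] pth ex nd.
apply: connect_trans (IH _ pth ex _); first by apply/connect1/nxt_step; rewrite inE d'P.
by move: nd; rewrite !inE; apply: contra => c; apply: connect_trans c; apply/connect1/nxt_step.
Qed.

End Forest.

(** Induction on the number of non-roots: the start of a step into [X] is made a root, and the step
    is glued back afterwards. *)
Lemma forest_ex A X : (forall v, exists2 x, x \in X & connect (nxt (live s t A)) v x) ->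
  exists P, forest s t A X P.
Proof.
have [k] := ubnP #|~: X|; elim: k X => // k IH X ltk cX.
case: (pickP (fun d => [&& d \in live s t A, fr d \notin X & to d \in X])) => [d /and3P[dA fX tX]|no].
  have [|v|P fP] := IH (fr d |: X).
  - move: ltk; rewrite ltnS; apply: leq_trans; apply: proper_card; apply/properP.
    split; first by rewrite setCS subsetUr.
    by exists (fr d); rewrite !inE ?eqxx.
  - by have [x xX c] := cX v; exists x; rewrite // inE xX orbT.
  by exists (d |: P); case: (forest_glue fP dA tX fX).
exists set0; apply/forestP.
have all0 v : v \in X.
  have [x + /connectP[p + ex]] := cX v; rewrite ex.
  elim: p v {ex} => [|y p IHp] v //= yX /andP[/nxtP[d [dA <- ey]] pth].
  have := no d; rewrite dA ey (IHp _ yX pth) andbT /=.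
  by move/negbFE.
split; first exact: sub0set.
  move=> v; rewrite all0; apply/eqP; rewrite cards_eq0; apply/eqP/setP => d.
  by rewrite !inE.
by move=> v; exists v.
Qed.

End Trees.

(** * Rooted trees as spanning trees with activities *)

Section SpanningTrees.
Local Open Scope nat_scope.
Variable G : plane_digraph.
Hypotheses (srcV : forall e : esort G, src e \in vertices G)
  (tgtV : forall e : esort G, tgt e \in vertices G).
Local Notation s := (@src G).
Local Notation t := (@tgt G).
Implicit Types (S T C : {set esort G}) (e : esort G) (P K : {set esort G * bool}).
Local Notation fr := (fr s t).
Local Notation to := (to s t).
Local Notation nxt := (nxt s t).

(* The points outside [vertices G] are isolated; a forest rooted at all of them
   and at [r] is a tree on [vertices G]. *)
Definition roots_at r : {set vsort G} := r |: ~: vertices G.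

Definition rooted r P : bool := forest s t setT (roots_at r) P.

Lemma frV d : fr d \in vertices G.
Proof. by case: d => e []; [exact: srcV | exact: tgtV]. Qed.

Lemma toV d : to d \in vertices G.
Proof. exact: frV. Qed.

Lemma nxtV P u v : connect (nxt P) u v -> u \in vertices G -> v \in vertices G.
Proof.
case/connectP => p + ->; elim: p u => [|y p IH] u //= /andP[/nxtP[d [_ _ <-]] pth] _.
by apply: IH pth _; apply: toV.
Qed.

Lemma roots_atV r v : v \in roots_at r -> v \in vertices G -> v = r.
Proof. by rewrite !inE => /orP[/eqP|/negbTE ->]. Qed.

Lemma adj_sym S : symmetric (@adj G S).
Proof. by move=> u v; apply/exists_inP/exists_inP => -[e eS h]; exists e; rewrite // orbC. Qed.

Lemma adj_connect_sym S : connect_sym (@adj G S).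
Proof. exact/sym_connect_sym/adj_sym. Qed.

Lemma step_adj S d : d.1 \in S -> @adj G S (fr d) (to d).
Proof. by case: d => e b dS; apply/exists_inP; exists e => //; case: b {dS}; rewrite !eqxx ?orbT. Qed.

Lemma nxt_adj S P u v : edges P \subset S -> connect (nxt P) u v -> connect (@adj G S) u v.
Proof.
move=> /subsetP PS; apply: connect_sub => x y /nxtP[d [dP <- <-]].
by apply/connect1/step_adj/PS/mem_edges.
Qed.

Lemma adj_live S u v : connect (@adj G S) u v -> connect (nxt (live s t S)) u v.
Proof.
apply: connect_sub => x y /exists_inP[e eS h].
have [b [<- <-]] : exists b, fr (e, b) = x /\ to (e, b) = y.
  by case/orP: h => /andP[/eqP <- /eqP <-]; [exists true | exists false].
have [->|ne] := eqVneq (fr (e, b)) (to (e, b)); first exact: connect0.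
by apply/connect1/nxt_step; rewrite inE eS.
Qed.

Lemma edges_live P S : P \subset live s t S -> edges P \subset S.
Proof.
move=> /subsetP PS; apply/subsetP => _ /imsetP[d /PS + ->].
by rewrite inE => /andP[].
Qed.

Lemma live_edges P A : P \subset live s t A -> P \subset live s t (edges P).
Proof.
move=> /subsetP PA; apply/subsetP => d dP.
by have := PA _ dP; rewrite !inE mem_edges // => /andP[].
Qed.

Lemma degree_edges K v : {in K &, injective fst} ->
  degree (edges K) v = #|[set d in K | fr d == v]| + #|[set d in K | to d == v]|.
Proof.
move=> iK; have h (T : finType) (S : {set T}) (Q : pred T) : #|[set e in S | Q e]| = \sum_(e in S) Q e.
  by rewrite -sum1dep_card big_mkcondr.
rewrite /degree !h -!big_split /= big_imset //=; apply: eq_bigr => -[e []] _ //=.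
by rewrite addnC.
Qed.

Lemma cyc_is_cycle A K : cyc s t A K -> {in K &, injective fst} -> is_cycle (edges K).
Proof.
move=> cK iK; have [iT e] := cyc_img cK; case/cycP: (cK) => K0 KA iF nK rK.
apply/and3P; split.
- by rewrite /edges imset_eq0.
- apply/forallP => v; rewrite degree_edges //.
  have h (f : esort G * bool -> vsort G) : {in K &, injective f} ->
      #|[set d in K | f d == v]| = (v \in f @: K).
    move=> fI; case: imsetP => [[d dK ->]|no].
      apply/eqP/cards1P; exists d; apply/setP => d'; rewrite !inE.
      by apply/andP/eqP => [[d'K /eqP /fI -> //]|->]; rewrite ?dK.
    apply/eqP; rewrite cards_eq0; apply/eqP/setP => d; rewrite !inE.
    by apply/negP => /andP[dK /eqP dv]; case: no; exists d.
  by rewrite !h // e; case: (_ \in _).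
- have hub d : d \in K -> connect (@adj G (edges K)) (src d.1) (fr d).
    move=> dK; have := step_adj (mem_edges dK); case: d dK => e' [] dK h; first exact: connect0.
    by rewrite adj_connect_sym; apply: connect1.
  apply/forall_inP => _ /imsetP[d dK ->]; apply/forall_inP => _ /imsetP[d' d'K ->].
  apply: connect_trans (hub _ dK) _; rewrite adj_connect_sym.
  apply: connect_trans (hub _ d'K) _.
  by apply: nxt_adj (subxx _) (rK _ _ d'K dK).
Qed.

Lemma is_cycle_even C : is_cycle C -> even s t C.
Proof.
case/and3P => _ /forallP h _ v; have := h v.
by rewrite -[degree C v]/(deg s t C v) => /orP[/eqP->|/eqP->].
Qed.

Section Rooted.
Variables (r : vsort G) (P : {set esort G * bool}).
Hypothesis fP : rooted r P.

Lemma rooted_live : P \subset live s t (edges P).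
Proof. by have [/live_edges] := forestP _ _ _ _ _ fP. Qed.

Lemma rooted_connect v : v \in vertices G -> connect (nxt P) v r.
Proof.
move=> vV; have [_ _ /(_ v)[x xX c]] := forestP _ _ _ _ _ fP.
by rewrite -(roots_atV xX (nxtV c vV)).
Qed.

Lemma rooted_spanning : spanning_tree (edges P).
Proof.
apply/andP; split.
  have h u : u \in vertices G -> connect (@adj G (edges P)) u r.
    by move=> uV; apply: nxt_adj (subxx _) (rooted_connect uV).
  apply/forall_inP => u /h uV; apply/forall_inP => v /h vV.
  by apply: connect_trans uV _; rewrite adj_connect_sym.
apply/forallP => C; apply/implyP => cC; apply/negP => CP.
have := even_forest fP (is_cycle_even cC) CP; move: cC.
by case/and3P => /negP C0 _ _ e; apply: C0; apply/eqP.
Qed.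

(** Without [d.1], the descendants [Y] of [fr d] are separated from [r]. The edge points away from
    [r] exactly when its source is outside [Y], that is, when the step towards the root runs against
    it. *)
Lemma int_active_step d : d \in P -> int_active r (edges P) d.1 = ~~ d.2.
Proof.
move=> dP; set Y := dsc s t P (fr d).
have -> : ~~ d.2 = (src d.1 \notin Y).
  have := forest_acyc fP dP; rewrite -/Y; case: d dP @Y => e [] dP Y /=; last by move=> ->.
  by rewrite (_ : s e \in Y) ?inE ?connect0.
apply/idP/idP => [|nY]; last first.
  have [x xX c] := connect_off_dsc fP dP nY.
  rewrite /int_active adj_connect_sym -(roots_atV xX (nxtV c (srcV _))).
  apply: nxt_adj c; apply/subsetP => _ /imsetP[d' + ->]; rewrite inE => /andP[d'P nf].
  rewrite !inE mem_edges // andbT; apply: contra nf => /eqP /(edges_inj fP d'P dP) ->.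
  by rewrite inE connect0.
case/connectP => p pth ->.
have : r \notin Y by apply: (dsc_root fP dP); rewrite !inE eqxx.
move: r pth => u; elim: p u => [|y p IH] u //= /andP[/exists_inP[e + h] pth] uY.
rewrite in_setD1 => /andP[ne /imsetP[d' d'P ed]]; apply: (IH _ pth).
have : d'.1 \notin bd s t Y.
  by rewrite (dsc_cut fP dP d'P); apply: contra ne; rewrite ed => /eqP ->.
rewrite -ed inE negbK; case/orP: h => /andP[/eqP -> /eqP ->] /eqP; first by move=> <-.
by move=> ->.
Qed.

(** Unless [e] is a loop, the tree is rooted again at [src e]; then [e] and the walk from [tgt e] to
    the new root form a cycle. *)
Lemma fundamental_cycle e : e \notin edges P ->
  exists C, is_cycle C && (C \subset e |: edges P).
Proof.
move=> eP; have [loop|nloop] := eqVneq (src e) (tgt e).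
  exists [set e]; rewrite subsetUl andbT; apply/and3P; split.
  - by apply/set0Pn; exists e; rewrite inE.
  - apply/forallP => v.
    have h (f : esort G -> vsort G) : #|[set e' in [set e] | f e' == v]| = (f e == v).
      case: eqVneq => [<-|ne].
        by apply/eqP/cards1P; exists e; apply/setP => e'; rewrite !inE andb_idr // => /eqP ->.
      apply/eqP; rewrite cards_eq0; apply/eqP/setP => e'; rewrite !inE.
      by case: eqP => // ->; apply/negbTE.
    by rewrite /degree !h loop; case: (_ == v).
  - by apply/forall_inP => _ /set1P ->; apply/forall_inP => _ /set1P ->; exact: connect0.
have live_sym := @conn_sym _ _ s t (edges P).
have conn_e v : exists2 x, x \in roots_at (src e) & connect (nxt (live s t (edges P))) v x.
  have [vV|vV] := boolP (v \in vertices G); last by exists v; rewrite // !inE vV orbT.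
  exists (src e); first by rewrite !inE eqxx.
  have h u : u \in vertices G -> connect (nxt (live s t (edges P))) u r.
    by move=> /rooted_connect; apply: sub_nxt rooted_live.
  exact: connect_trans (h _ vV) (live_sym _ _ (h _ (srcV e))).
have [P' fP'] := forest_ex conn_e.
have [/[dup] P'A /edges_live P'P cP' rP'] := forestP _ _ _ _ _ fP'.
have next u : u \in vertices G -> u != src e -> exists2 d, d \in P' & fr d = u.
  move=> uV ne; have := cP' u; rewrite !inE uV (negbTE ne) /= => /fiber1[d [dP du] _].
  by exists d.
pose reach := connect (nxt P') (tgt e).
pose K := (e, true) |: [set d in P' | reach (fr d)].
have walk u v : reach u -> connect (nxt P') u v -> connect (nxt K) u v.
  move=> ru /connectP[p + ->]; elim: p u ru => [|y p IH] u ru /=; first by rewrite connect0.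
  case/andP => /nxtP[d [dP du dy]] pth; apply: connect_trans (IH y _ pth).
    by rewrite -du -dy; apply/connect1/nxt_step; rewrite !inE dP du ru orbT.
  by apply: connect_trans ru _; rewrite -du -dy; apply/connect1/nxt_step.
have to_root u : u \in vertices G -> connect (nxt P') u (src e).
  by move=> uV; have [x xX c] := rP' u; rewrite -(roots_atV xX (nxtV c uV)).
have cK : cyc s t setT K.
  apply/cycP; split.
  - by apply/set0Pn; exists (e, true); rewrite !inE eqxx.
  - apply/subsetP => d; rewrite !inE => /orP[/eqP -> //|/andP[/(subsetP P'A)]].
    by rewrite inE => /andP[].
  - move=> d d'; rewrite !inE => /orP[/eqP->|/andP[dP _]] /orP[/eqP->|/andP[d'P _]] // ed.
    + by have := forest_root fP' d'P; rewrite -ed !inE eqxx.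
    + by have := forest_root fP' dP; rewrite ed !inE eqxx.
    exact: (forest_inj fP').
  - have nx u : reach u -> u \in vertices G -> exists2 d, d \in K & fr d = u.
      move=> ru uV; have [->|ne] := eqVneq u (src e); first by exists (e, true); rewrite // !inE eqxx.
      by have [d dP du] := next u uV ne; exists d; rewrite // !inE dP du ru orbT.
    move=> d; rewrite !inE => /orP[/eqP->|/andP[dP rd]]; apply: nx; rewrite ?toV //.
      exact: connect0.
    by apply: connect_trans rd _; apply/connect1/nxt_step.
  - have hub d : d \in K -> connect (nxt K) (fr d) (src e) /\ connect (nxt K) (src e) (fr d).
      rewrite !inE => /orP[/eqP->|/andP[dP rd]]; first by split; exact: connect0.
      split; first by apply: walk (to_root _ (frV d)).
      apply: (@connect_trans _ _ (tgt e)); last by apply: walk => //; exact: connect0.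
      by apply/connect1/(@nxt_step _ _ s t K (e, true)); rewrite !inE eqxx.
    by move=> d d' /hub[h _] /hub[_]; apply: connect_trans.
exists (edges K); apply/andP; split.
  apply: (cyc_is_cycle cK) => d d'; rewrite !inE.
  move=> /orP[/eqP->|/andP[dP _]] /orP[/eqP->|/andP[d'P _]] //=.
  - by move=> ed; case/negP: eP; rewrite ed (subsetP P'P) ?mem_edges.
  - by move=> ed; case/negP: eP; rewrite -ed (subsetP P'P) ?mem_edges.
  exact: (edges_inj fP').
apply/subsetP => _ /imsetP[d + ->]; rewrite !inE => /orP[/eqP->|/andP[dP _]]; first by rewrite eqxx.
by rewrite (subsetP P'P) ?orbT ?mem_edges.
Qed.

End Rooted.

Lemma rooted_ex r A : (forall v, v \in vertices G -> connect (nxt (live s t A)) v r) ->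
  exists2 P, rooted r P & edges P \subset A.
Proof.
move=> c; have [v|P fP] := @forest_ex _ _ s t A (roots_at r).
  have [/c vV|vV] := boolP (v \in vertices G); first by exists r; rewrite // !inE eqxx.
  by exists v; rewrite // !inE vV orbT.
have [PA cP rP] := forestP _ _ _ _ _ fP; exists P; last exact: edges_live.
apply/forestP; split=> //; apply: subset_trans PA _.
by apply/subsetP => d; rewrite !inE => /andP[].
Qed.

(** Connectivity gives a rooted tree inside [T], and a further edge of [T] would close a cycle in
    [T]. *)
Lemma spanning_rooted r T : r \in vertices G -> spanning_tree T ->
  exists2 P, rooted r P & edges P = T.
Proof.
move=> rV /andP[/forall_inP cT /forallP acT].
have [v vV|P fP PT] := @rooted_ex r T.
  by apply: adj_live; move/forall_inP: (cT v vV); apply.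
exists P => //; apply/eqP; rewrite eqEsubset PT /=; apply/subsetP => e eT.
apply/negPn/negP => eP; have [C /andP[cC CP]] := fundamental_cycle fP eP.
have := acT C; rewrite cC /= => /negP; apply; apply: subset_trans CP _.
by rewrite subUset sub1set eT.
Qed.

Lemma card_rooted r P : r \in vertices G -> rooted r P -> #|edges P|.+1 = #|vertices G|.
Proof.
move=> rV fP; rewrite (card_edges fP) (forest_card fP) /roots_at cardsU1 !inE rV /=.
have := cardsC (vertices G); have : 0 < #|vertices G| by apply/card_gt0P; exists r.
by move=> w0 <-; rewrite add1n subnS addnK prednK.
Qed.

End SpanningTrees.

(** * Planar duality *)

Lemma even_symdiff (V E : finType) (s t : E -> V) (C D : {set E}) :
  even s t C -> even s t D -> even s t ((C :\: D) :|: (D :\: C)).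
Proof.
move=> eC eD v; have h (f : E -> V) :
    odd #|[set e in (C :\: D) :|: (D :\: C) | f e == v]| =
    odd (#|[set e in C | f e == v]| + #|[set e in D | f e == v]|)%N.
  rewrite -(cardsID D [set e in C | _]) -(cardsID C [set e in D | _]).
  rewrite -(cardsID C [set e in _ | _]) !oddD.
  set a := #|_|; set b := #|_|; set c := #|_|; set d := #|_|; set x := #|_|; set y := #|_|.
  have -> : a = d by apply: eq_card => e; rewrite !inE; case: (e \in C); case: (e \in D); case: eqP.
  have -> : b = y by apply: eq_card => e; rewrite !inE; case: (e \in C); case: (e \in D); case: eqP.
  have -> : x = c by apply: eq_card => e; rewrite !inE; case: (e \in C); case: (e \in D); case: eqP.
  by case: (odd c); case: (odd d); case: (odd y).
rewrite /deg oddD !h -oddD; have := eC v; have := eD v; rewrite /deg !oddD.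
by do 4!case: (odd _).
Qed.

(** A dual edge crosses its edge from right to left, into the face that [ext_active] tests. With
    this choice, dualising twice restores all incidences. *)
Definition dual (G : plane_digraph) : plane_digraph := {|
  vertices := faces G;
  faces := vertices G;
  src := @rface G;
  tgt := @lface G;
  lface := @tgt G;
  rface := @src G;
  epos := predC (@epos G)
|}.

(** The third clause is planarity in algebraic form: the boundary of a set of faces has even degree
    everywhere. With its dual and Euler's formula, it replaces topological arguments. *)
Definition tame (G : plane_digraph) : Prop :=
  [/\ forall e : esort G, src e \in vertices G,
      forall e : esort G, tgt e \in vertices G,
      forall Y : {set fsort G}, even (@src G) (@tgt G) (bd (@rface G) (@lface G) Y)
    & {in vertices G &, forall u v, connect (@adj G setT) u v}].

Definition sphere (G : plane_digraph) : Prop :=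
  [/\ tame G, tame (dual G) & (#|vertices G| + #|faces G| = #|esort G| + 2)%N].

Lemma sphere_dual G : sphere G -> sphere (dual G).
Proof.
case=> -[h1 h2 h3 h4] h5 h6; split=> //; last by rewrite addnC.
Qed.

Section Dual.
Variable G : plane_digraph.
Hypothesis sG : sphere G.
Implicit Types (T C : {set esort G}) (P : {set esort G * bool}).

(** The faces joined to [q] across edges outside the tree have their boundary in the tree; being
    even, it is empty, so all faces are joined. The complement thus contains a dual spanning tree,
    and equality follows from Euler's formula. *)
Lemma cotree r q P : r \in vertices G -> q \in faces G -> rooted r P ->
  exists2 P', @rooted (dual G) q P' & edges P' = ~: edges P.
Proof.
case: sG => -[srcV tgtV evF cV] [rfF lfF evV cF] euler rV qF fP.
have [f fF|P' fP' sub] := @rooted_ex (dual G) q (~: edges P).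
  pose Y := [set g | connect (nxt (@rface G) (@lface G) (live (@rface G) (@lface G) (~: edges P))) g q].
  have bdY : bd (@rface G) (@lface G) Y = set0.
    apply: (even_forest fP (evF Y)); apply/subsetP => e; apply: contraLR => eP.
    have st b : to (@rface G) (@lface G) (e, b) \in Y -> fr (@rface G) (@lface G) (e, b) \in Y.
      have [->//|ne] := eqVneq (fr (@rface G) (@lface G) (e, b)) (to (@rface G) (@lface G) (e, b)).
      rewrite !inE; apply: connect_trans; apply/connect1/nxt_step.
      by rewrite !inE eP.
    rewrite inE negbK; apply/eqP; apply/idP/idP; [exact: (st false) | exact: (st true)].
  suff : f \in Y by rewrite inE.
  have /connectP[p + ->] := cF _ _ qF fF.
  have : q \in Y by rewrite inE connect0.
  move: {1 2 3}q; elim: p => [|g p IH] u //= uY /andP[/exists_inP[e _ h]]; apply: IH.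
  have : e \notin bd (@rface G) (@lface G) Y by rewrite bdY inE.
  rewrite in_set negbK => /eqP e1; move: uY e1.
  by case/orP: h => /andP[/eqP <- /eqP <-] /= => [->|h ->] //.
exists P' => //; apply/eqP; rewrite eqEcard sub /=.
have c1 := card_rooted rV fP; have c2 := @card_rooted (dual G) _ _ qF fP'.
have := cardsC (edges P); rewrite /= in c2; lia.
Qed.

End Dual.

Section DualTrees.
Variable G : plane_digraph.
Hypothesis sG : sphere G.
Variables (r : vsort G) (q : fsort G).
Hypotheses (rV : r \in vertices G) (qF : q \in faces G).
Implicit Types (T C : {set esort G}) (P : {set esort G * bool}).

Lemma rooted_cospanning P : @rooted (dual G) q P -> spanning_tree (~: edges P).
Proof.
move=> fP; have [[srcV tgtV _ _] _ _] := sG.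
have [P' fP' <-] := @cotree (dual G) (sphere_dual sG) _ _ _ qF rV fP.
exact: (@rooted_spanning G srcV tgtV r P' fP').
Qed.

Lemma cospanning_rooted T : spanning_tree T ->
  exists2 P, @rooted (dual G) q P & T = ~: edges P.
Proof.
move=> sT; have [[srcV tgtV _ _] _ _] := sG.
have [P fP <-] := spanning_rooted srcV tgtV rV sT.
have [P' fP' e] := cotree sG rV qF fP.
by exists P'; rewrite // e setCK.
Qed.

Section Activity.
Variable P : {set esort G * bool}.
Hypothesis fP : @rooted (dual G) q P.
Variable d : esort G * bool.
Hypothesis dP : d \in P.
Let Y := dsc (@rface G) (@lface G) P (fr (@rface G) (@lface G) d).

(** A fundamental cycle is a fundamental cut of the dual tree. Outside the tree both sides consist
    of [d.1] alone, so their symmetric difference is an even set inside the tree, hence empty. *)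
Lemma Cyc_dsc : Cyc (~: edges P) d.1 = bd (@rface G) (@lface G) Y.
Proof.
have [[srcV tgtV evF _] _ _] := sG.
have [P' fP' eP'] := @cotree (dual G) (sphere_dual sG) _ _ _ qF rV fP.
have dP' : d.1 \notin edges P' by rewrite eP' inE negbK mem_edges.
have [C0 cC0] := @fundamental_cycle G srcV tgtV r P' fP' d.1 dP'.
rewrite eP' in cC0; rewrite /Cyc; case: pickP => [C /andP[cC CP]|/(_ C0)]; last by rewrite cC0.
rewrite /=; have eC := is_cycle_even cC.
have null D : even (@src G) (@tgt G) D -> D \subset ~: edges P -> D = set0.
  by rewrite -eP'; apply: (even_forest fP').
have eY := edges_bd fP dP; rewrite -/Y in eY.
have dC : d.1 \in C.
  apply/negPn/negP => nd; have C0' : C = set0.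
    apply: null => //; apply/subsetP => e eC'; have := subsetP CP e eC'.
    by rewrite !inE => /orP[/eqP ee|//]; rewrite -ee eC' in nd.
  by case/and3P: cC; rewrite C0' eqxx.
have YP e : e \in bd (@rface G) (@lface G) Y -> e \in edges P -> e = d.1.
  by move=> h1 h2; apply/set1P; rewrite -eY in_setI h1 h2.
have dY : d.1 \in bd (@rface G) (@lface G) Y.
  by have := set11 d.1; rewrite -eY => /setIP[].
have := null _ (even_symdiff eC (evF Y)) => /(_ _)/eqP.
rewrite setU_eq0 !setD_eq0 -eqEsubset => h; apply/eqP/h.
apply/subsetP => e; rewrite !in_setU !in_setD in_setC => /orP[/andP[h1 h2]|/andP[h1 h2]].
  have := subsetP CP e h2; rewrite !inE => /orP[/eqP ee|//].
  by rewrite ee dY in h1.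
by apply/negP => /(YP _ h2) ee; rewrite ee dC in h1.
Qed.

Lemma same_side_adj C f g : same_side C f g = connect (@adj (dual G) (~: C)) f g.
Proof.
apply: eq_connect => x y; apply/existsP/exists_inP => [[e /andP[eC h]]|[e eC h]].
  by exists e; rewrite ?inE //=; case/orP: h => /andP[-> ->]; rewrite ?orbT.
by exists e; rewrite inE in eC; rewrite eC /=; case/orP: h => /andP[/= -> ->]; rewrite ?orbT.
Qed.

(** By [Cyc_dsc], the side of [q] is the complement of [Y]. It lies to the left of [d.1] exactly
    when the dual step towards [q] crosses from right to left, that is, forwards. *)
Lemma ext_active_step : ext_active q (~: edges P) d.1 = d.2.
Proof.
have [_ [rfF lfF _ _] _] := sG.
rewrite /ext_active Cyc_dsc same_side_adj.
have -> : d.2 = (lface d.1 \notin Y).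
  rewrite /Y; have := forest_acyc fP dP; case: d dP => e [] eP /=; first by move=> ->.
  by move=> _; rewrite inE connect0.
apply/idP/idP => [|nY]; last first.
  have [x xX c] := connect_off_dsc fP dP nY.
  rewrite adj_connect_sym -(@roots_atV (dual G) _ _ xX (@nxtV (dual G) rfF lfF _ _ _ c (lfF _))).
  apply: (@nxt_adj (dual G)) c; apply/subsetP => _ /imsetP[d' + ->]; rewrite inE => /andP[d'P nf].
  rewrite inE (dsc_cut fP dP d'P); apply: contra nf => /eqP ->.
  by rewrite inE connect0.
case/connectP => p pth ->.
have : q \notin Y by apply: (dsc_root fP dP); rewrite !inE eqxx.
move: q pth => u; elim: p u => [|g p IH] u //= /andP[/exists_inP[e + h] pth] uY.
rewrite in_setC in_set negbK => e1; apply: (IH _ pth); move: e1 uY.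
by case/orP: h => /andP[/eqP <- /eqP <-] /eqP => [<-|->].
Qed.

End Activity.

End DualTrees.

Section Sums.
Variable G : plane_digraph.
Hypothesis sG : sphere G.
Variables (r : vsort G) (q : fsort G).
Hypotheses (rV : r \in vertices G) (qF : q \in faces G).

Lemma card_edge_steps (E : finType) (P : {set E * bool}) (b : bool) (Q : pred E) :
  #|[set e | (e, b) \in P & Q e]| = #|[set d in P | Q d.1 && (d.2 == b)]|.
Proof.
rewrite -(card_imset (mem [set e | (e, b) \in P & Q e]) (f := fun e => (e, b))); last by move=> ? ? [].
apply: eq_card => d; rewrite !inE; apply/imsetP/idP => [[e + ->]|/and3P[dP Qd /eqP db]].
  by rewrite !inE => /andP[-> ->] /=.
by exists d.1; rewrite ?inE -db -surjective_pairing ?dP.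
Qed.

Lemma reindex_trees (F : fieldType) (E : finType) (f : pred {set E * bool}) (Q : pred {set E})
    (h : {set E * bool} -> {set E}) (k : {set E} -> {set E * bool}) (g : {set E} -> F) :
  (forall P, f P -> Q (h P)) -> (forall P, f P -> k (h P) = P) ->
  (forall T, Q T -> exists2 P, f P & T = h P) ->
  \sum_(T | Q T) g T = \sum_(P | f P) g (h P).
Proof.
move=> fQ kh Qf; rewrite (reindex_onto h k) => [|T /Qf[P fP ->]]; last by rewrite kh.
apply: eq_bigl => P; apply/andP/idP => [[/Qf[P' fP' ->] /eqP <-]|fP]; first by rewrite kh.
by rewrite fQ ?kh ?eqxx.
Qed.

Lemma tree_poly_int : @tree_poly G {fraction {poly int}} r q tvar^-1 tvar 1 1 =
  \sum_(P | rooted r P) tvar ^ stat (@epos G) P.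
Proof.
have [[srcV tgtV _ _] _ _] := sG.
have act P : rooted r P -> forall d, (d \in P) = (d.1 \in edges P) && (d.2 == ~~ int_active r (edges P) d.1).
  move=> fP d; apply/idP/andP => [dP|[/imsetP[d' d'P e1] /eqP]].
    by rewrite mem_edges // (int_active_step srcV tgtV fP dP) negbK.
  by rewrite e1 (int_active_step srcV tgtV fP d'P) negbK; case: d e1 => e b /= -> ->;
    rewrite -surjective_pairing.
rewrite /tree_poly (reindex_trees (f := rooted r) (h := @edges _)
  (k := fun T => [set d | (d.1 \in T) && (d.2 == ~~ int_active r T d.1)])).
- apply: eq_bigr => P fP; rewrite !expr1n !mulr1 exprVn invrK.
  have -> : iota_pos r (edges P) = nbwd (@epos G) P.
    rewrite /nbwd (_ : [set d in P | _] = [set d in P | epos d.1 && (d.2 == false)]); last first.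
      by apply/setP => d; rewrite !inE eqbF_neg.
    rewrite -card_edge_steps; apply: eq_card => e; rewrite !inE act //=.
    by case: (int_active _ _ _); rewrite ?andbF ?andbT.
  have -> : iotabar_pos r (edges P) = nfwd (@epos G) P.
    rewrite /nfwd (_ : [set d in P | _] = [set d in P | epos d.1 && (d.2 == true)]); last first.
      by apply/setP => d; rewrite !inE eqb_id.
    rewrite -card_edge_steps; apply: eq_card => e; rewrite !inE act //=.
    by case: (int_active _ _ _); rewrite ?andbF ?andbT.
  rewrite /stat expfzDr ?exprnP ?exprnN //.
  by rewrite tofrac_eq0 polyX_eq0.
- by move=> P fP; apply: rooted_spanning fP.
- by move=> P fP; apply/setP => d; rewrite inE -act.
- by move=> T sT; have [P fP <-] := spanning_rooted srcV tgtV rV sT; exists P.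
Qed.

(** Compared with [tree_poly_int], the active edges are now the forward ones, and the exponents of
    [z] and [w] carry no minus sign. The two changes cancel and leave the same statistic. *)
Lemma tree_poly_ext : @tree_poly G {fraction {poly int}} r q 1 1 tvar^-1 tvar =
  \sum_(P | @rooted (dual G) q P) tvar ^ stat (predC (@epos G)) P.
Proof.
have act P : @rooted (dual G) q P -> forall d,
    (d \in P) = (d.1 \in edges P) && (d.2 == ext_active q (~: edges P) d.1).
  move=> fP d; apply/idP/andP => [dP|[/imsetP[d' d'P e1] /eqP]].
    by rewrite mem_edges // (ext_active_step sG rV qF fP dP).
  rewrite e1 (ext_active_step sG rV qF fP d'P); case: d e1 => e b /= -> ->.
  by rewrite -surjective_pairing.
rewrite /tree_poly (reindex_trees (f := @rooted (dual G) q) (h := fun P => ~: edges P)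
  (k := fun T => [set d | (d.1 \notin T) && (d.2 == ext_active q T d.1)])).
- apply: eq_bigr => P fP; rewrite !expr1n invr1 !mul1r exprVn.
  have -> : epsbar_neg q (~: edges P) = nbwd (predC (@epos G)) P.
    rewrite /nbwd (_ : [set d in P | _] = [set d in P | ~~ @epos G d.1 && (d.2 == false)]); last first.
      by apply/setP => d; rewrite !inE /= eqbF_neg.
    rewrite -(@card_edge_steps _ _ _ (fun e => ~~ @epos G e)); apply: eq_card => e; rewrite !inE act //= negbK.
    by case: (ext_active _ _ _); rewrite ?andbF ?andbT.
  have -> : eps_neg q (~: edges P) = nfwd (predC (@epos G)) P.
    rewrite /nfwd (_ : [set d in P | _] = [set d in P | ~~ @epos G d.1 && (d.2 == true)]); last first.
      by apply/setP => d; rewrite !inE /= eqb_id.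
    rewrite -(@card_edge_steps _ _ _ (fun e => ~~ @epos G e)); apply: eq_card => e; rewrite !inE act //= negbK.
    by case: (ext_active _ _ _); rewrite ?andbF ?andbT.
  rewrite mulrC /stat expfzDr ?exprnP ?exprnN //.
  by rewrite tofrac_eq0 polyX_eq0.
- by move=> P fP; apply: (rooted_cospanning sG rV qF fP).
- by move=> P fP; apply/setP => d; rewrite !inE negbK -act.
- by move=> T sT; have [P fP ->] := cospanning_rooted sG rV qF sT; exists P.
Qed.

End Sums.

(** * Tait digraphs *)

Lemma balance_eulerian (V E : finType) (s t : E -> V) (pos : pred E) :
  (forall v, #|[set e | pos e & s e == v]| = #|[set e | pos e & t e == v]|) ->
  eulerian s t pos setT.
Proof.
move=> bal v.
have h (f : E -> V) b : #|[set e | pos e & f e == v]| =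
    #|[set d : E * bool | [&& pos d.1, f d.1 == v & d.2 == b]]|.
  rewrite -(card_imset (mem [set e | pos e & f e == v]) (f := fun e => (e, b))); last by move=> ? ? [].
  apply: eq_card => -[e b']; rewrite !inE /=; apply/imsetP/and3P => [[e' + [-> ->]]|[pe fe /eqP->]].
    by rewrite inE => /andP[-> ->].
  by exists e; rewrite ?inE ?pe.
have hs := h s true; have ht := h t false; have b := bal v.
rewrite (bigID (fun d => pos d.1)) /= [X in (_ + X)%R]big1 ?addr0; last first.
  by move=> d /andP[_ /negbTE np]; rewrite /sg np.
rewrite (bigID (fun d => d.2)) /=.
rewrite (eq_bigr (fun=> 1%R)) => [|d /andP[/andP[_ p] b2]]; last by rewrite /sg p b2.
rewrite [X in (_ + X)%R](eq_bigr (fun=> (-1)%R)) => [|d /andP[/andP[_ p] /negbTE b2]]; last first.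
  by rewrite /sg p b2.
rewrite !sumr_const mulNrn; apply/eqP; rewrite subr_eq0; apply/eqP; congr (1 *+ _)%R.
apply: etrans _ (etrans (etrans (esym hs) (etrans b ht)) _).
  by apply: eq_card => -[e []]; rewrite !inE /= unfold_in /= ?inE /= ?andbF ?andbT // andbC.
by apply: eq_card => -[e []]; rewrite !inE /= unfold_in /= ?inE /= ?andbF ?andbT // andbC.
Qed.

Section Tait.
Local Open Scope nat_scope.
Variable D : pd_code.
Local Notation rot := Defs.rot.
Local Notation over := Defs.over.
Hypotheses (hD : link_diagram D) (hconn : connected_diagram D) (halt : alternating D).
Implicit Types (d : dart D) (c : crossing D) (v : {set dart D}) (Y : {set {set dart D}}).
Local Notation rot2 d := (rot (rot d)).
Local Notation rot3 d := (rot (rot (rot d))).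

Lemma over_rot d : over (rot d) = ~~ over d. Proof. by []. Qed.

Lemma rot2E d : rot2 d = (cross d, over d, ~~ outgoing d).
Proof.
case: d => -[c o] b; rewrite /rot /cross /over /outgoing /= negbK.
by case: (positive c); case: o; case: b.
Qed.

Lemma rot4 d : rot (rot3 d) = d.
Proof. by rewrite !rot2E /cross /over /outgoing /= negbK; case: d => -[]. Qed.

Lemma glueK : involutive (@glue D). Proof. by case: hD. Qed.

Lemma rot_inj : injective (@Defs.rot D).
Proof. by apply: (can_inj (g := fun d => rot3 d)) => d; exact: rot4. Qed.

Lemma face_inj : injective (@face D).
Proof. by move=> d d' /= /rot_inj/rot_inj/rot_inj; exact: (can_inj glueK). Qed.

(** Alternation enters here: all corners of a region have the same colour. *)
Lemma over_face d : over (face d) = over d.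
Proof. by rewrite /face /= !over_rot halt !negbK. Qed.

Lemma region_face d : region (face d) = region d.
Proof.
apply/setP => d'; rewrite !inE; apply/esym/same_fconnect1.
exact: face_inj.
Qed.

Lemma region_self d : d \in region d.
Proof. by rewrite inE connect0. Qed.

Lemma region_glue d : region (glue d) = region (rot3 d).
Proof. by rewrite -region_face /face /= glueK. Qed.

Lemma region_rot_face d : region (rot (face d)) = region (rot3 d).
Proof. by rewrite /face /= rot4 region_glue. Qed.

Lemma region_over d d' : region d = region d' -> over d = over d'.
Proof.
move=> e; have := region_self d'; rewrite -e inE => /connectP[p + ->].
elim: p d {e} => //= x p IH d /andP[/eqP <- /IH <-].
by rewrite over_face.
Qed.

(* An edge of a Tait graph corresponds to two opposite corners at its crossing; [x] selects one. *)
Lemma card_corners (o : bool) (x : crossing D -> bool) (Q : pred (dart D)) :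
  #|[set d | (over d == o) && Q d]| =
  #|[set c | Q (c, o, x c)]| + #|[set c | Q (c, o, ~~ x c)]|.
Proof.
have h (y : crossing D -> bool) : #|[set c | Q (c, o, y c)]| =
    #|[set d | [&& over d == o, Q d & outgoing d == y (cross d)]]|.
  rewrite -(card_imset (mem [set c | Q (c, o, y c)]) (f := fun c => (c, o, y c))); last by move=> ? ? [].
  apply: eq_card => -[[c o'] b]; rewrite !inE; apply/imsetP/idP => [[c' + [-> -> ->]]|].
    by rewrite inE /over /outgoing /= !eqxx => ->.
  rewrite /over /outgoing /cross /= => /and3P[/eqP eo Qd /eqP eb].
  by exists c; rewrite ?inE -eo -eb.
rewrite -(cardsID [set d | outgoing d == x (cross d)]) !h; congr (_ + _).
  by apply: eq_card => d; rewrite !inE -!andbA.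
apply: eq_card => d; rewrite !inE andbC -!andbA; congr [&& _, _ & _].
by case: (outgoing d); case: (x _).
Qed.

Lemma card_face (Q : pred (dart D)) : #|[set d | Q (face d)]| = #|[set d | Q d]|.
Proof.
rewrite -(card_imset (mem [set d | Q (face d)]) face_inj); apply: eq_card => d.
have [g gK Kg] := injF_bij face_inj.
rewrite -[d]Kg (mem_imset _ _ face_inj) !inE //.
Qed.

(** On the way around a region, membership of the neighbouring region in [Y] changes an even number
    of times. At the corner [d] the neighbour changes from the region of [rot d] to that of
    [rot3 d], the two faces beside the Tait edge. *)
Lemma region_cut_even (o : bool) v Y :
  ~~ odd #|[set d | (over d == o) && ((region d == v) &&
                    ((region (rot d) \in Y) != (region (rot3 d) \in Y)))]|.
Proof.
pose Q d := [&& over d == o, region d == v & region (rot d) \in Y].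
have := card_face Q; rewrite -(cardsID [set d | Q d] [set d | Q (face d)]).
rewrite -(cardsID [set d | Q (face d)] [set d | Q d]) setIC => /addnI e.
rewrite -(cardsID [set d | Q d]).
rewrite (_ : #|_| = #|[set d | Q d] :\: [set d | Q (face d)]|); last first.
  apply: eq_card => d; rewrite !inE /Q over_face region_face region_rot_face.
  by case: (over d == o); case: (region d == v); case: (_ \in Y); case: (_ \in Y).
rewrite -e [X in odd (_ + X)](_ : _ = #|[set d | Q (face d)] :\: [set d | Q d]|).
  by rewrite addnn odd_double.
apply: eq_card => d; rewrite !inE /Q over_face region_face region_rot_face.
by case: (over d == o); case: (region d == v); case: (_ \in Y); case: (_ \in Y).
Qed.

(** Along the boundary of a region of colour [o], the strand direction reverses exactly at crossings
    of sign [o], where both ends beside the corner are outgoing or both incoming. These two kinds of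
    reversal alternate. *)
Lemma region_balance (o : bool) v :
  #|[set d | (over d == o) && [&& region d == v, positive (cross d) == o & outgoing d]]| =
  #|[set d | (over d == o) && [&& region d == v, positive (cross d) == o & ~~ outgoing d]]|.
Proof.
pose Q d := [&& over d == o, region d == v & outgoing (rot d)].
have := card_face Q; rewrite -(cardsID [set d | positive (cross d) == o] [set d | Q (face d)]).
rewrite -(cardsID [set d | positive (cross d) == o] [set d | Q d]) => h.
have out d : outgoing (rot (face d)) = ~~ outgoing d.
  by rewrite -[face d]/(rot3 (glue d)) rot4; case: hD.
(* At crossings of the other sign, [Q d] and [Q (face d)] agree, so these corners cancel. *)
have e : #|[set d | Q (face d)] :\: [set d | positive (cross d) == o]| =
         #|[set d | Q d] :\: [set d | positive (cross d) == o]|.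
  apply: eq_card => d; rewrite !inE /Q out over_face region_face.
  have [eo|//] := eqVneq (over d) o; rewrite -eo /outgoing /rot /=.
  by case: (_ == over d); rewrite ?andbF //.
rewrite e in h; move/addIn: h => h.
apply: etrans (etrans _ (esym h)) _.
- apply: eq_card => d; rewrite !inE /Q; have [eo|//] := eqVneq (over d) o.
  by rewrite -eo /outgoing /rot /=; case: (_ == over d); rewrite ?andbF ?andbT.
- apply: eq_card => d; rewrite !inE /Q out over_face region_face.
  by case: (over d == o); case: (_ == o); rewrite ?andbF ?andbT.
Qed.

(** Colours alternate around a crossing, so [f] finds a corner of colour [o] there. Opposite corners
    are joined by hypothesis, and an arc of the diagram stays along one region of this colour. *)
Lemma regions_connect (o : bool) (e : rel {set dart D}) : symmetric e ->
  (forall d, over d = o -> connect e (region d) (region (rot2 d))) ->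
  forall d d', over d = o -> over d' = o -> connect e (region d) (region d').
Proof.
move=> es h; have ces := sym_connect_sym es.
pose f d := region (if over d == o then d else rot d).
have same d d' : over d = o -> over d' = o -> cross d = cross d' -> connect e (region d) (region d').
  move=> od od' cd; suff [->|->] : d' = d \/ d' = rot2 d by [exact: connect0 | exact: h].
  rewrite rot2E; have {od od'} : over d = over d' by rewrite od.
  move: cd; case: d d' => -[c o1] b [[c' o2] b'].
  by rewrite /cross /over /outgoing /= => -> ->; case: b; case: b'; [left | right | right | left].
have flip (b b' : bool) : b != b' -> ~~ b = b' by case: b; case: b'.
have ovf d : over (if over d == o then d else rot d) = o.
  by case: eqP => // /eqP /flip.
have crf d : cross (if over d == o then d else rot d) = cross d by case: ifP.
have glu d : over d = o -> connect e (f d) (f (glue d)).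
  move=> od; rewrite /f od eqxx -region_face; apply: same; rewrite ?ovf ?over_face //.
  by rewrite crf.
have lnk d d' : linked d d' -> connect e (f d) (f d').
  case/orP => [/eqP cd|/eqP ->]; first by apply: same; rewrite ?ovf ?crf.
  have [od|od] := eqVneq (over d) o; first exact: glu.
  rewrite ces -{2}[d]glueK; apply: glu; rewrite halt.
  exact: flip.
move=> d d' od od'; have := hconn d d'; suff g u w : connect (@linked D) u w -> connect e (f u) (f w).
  by move/g; rewrite /f od od' eqxx.
case/connectP => p + ->; elim: p u => [|x p IH] u /=; first by rewrite connect0.
by case/andP => /lnk c /IH; apply: connect_trans.
Qed.

Lemma over_cases d : over d -> d = over_in (cross d) \/ d = over_out (cross d).
Proof. by case: d => -[c []] [] // _; [right | left]. Qed.

Lemma rot_over_in c : rot (over_in c) = (c, false, ~~ positive c).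
Proof. by rewrite /rot /over_in /= eqb_id; case: positive. Qed.

Lemma rot_over_out c : rot (over_out c) = (c, false, positive c).
Proof. by rewrite /rot /over_out /= eqb_id; case: positive. Qed.

Lemma rot2_over_in c : rot2 (over_in c) = over_out c.
Proof. by rewrite rot2E. Qed.

Lemma rot2_over_out c : rot2 (over_out c) = over_in c.
Proof. by rewrite rot2E. Qed.

Lemma mem_regions d : region d \in regions D (over d).
Proof.
rewrite /regions; case: eqP => [c0|_]; last by apply/imsetP; exists d; rewrite ?inE.
by have := card0_eq c0 (cross d); rewrite inE.
Qed.

Lemma tame_tait : tame (tait D).
Proof.
split=> /= [c|c|Y v|u v].
- exact: (mem_regions (over_in c)).
- exact: (mem_regions (over_out c)).
- have := region_cut_even true v Y; rewrite (card_corners true (fun=> false)) /deg /=.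
  congr (~~ odd (_ + _)); apply: eq_card => c; rewrite !inE andbC; congr (_ && _).
    by rewrite -/(over_in c) rot2_over_in.
  by rewrite -/(over_out c) rot2_over_out eq_sym.
- rewrite /regions; case: eqP => _; first by move=> /set1P -> /set1P ->.
  case/imsetP => d + -> /imsetP[d' + ->]; rewrite !inE => /eqP od /eqP od'.
  apply: (@regions_connect true) => // [|{}d {}od]; first exact: (@adj_sym (tait D) setT).
  apply/connect1/exists_inP; exists (cross d); rewrite ?inE //=.
  by case: (over_cases od) => ->; rewrite ?rot2_over_in ?rot2_over_out !eqxx ?orbT.
Qed.

Lemma tame_dual_tait : tame (dual (tait D)).
Proof.
split=> /= [c|c|Y v|u v].
- exact: (mem_regions (rot (over_in c))).
- exact: (mem_regions (rot (over_out c))).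
- have := region_cut_even false v Y; rewrite (card_corners false (fun c => ~~ positive c)) /deg /=.
  congr (~~ odd (_ + _)); apply: eq_card => c; rewrite !inE andbC ?negbK.
    by rewrite -rot_over_in rot4 rot2_over_in eq_sym.
  by rewrite -rot_over_out rot4 rot2_over_out.
- rewrite /regions; case: eqP => _; first by move=> /set1P -> /set1P ->.
  case/imsetP => d + -> /imsetP[d' + ->]; rewrite !inE => /eqP od /eqP od'.
  apply: (@regions_connect false) => // [|{}d {}od]; first exact: (@adj_sym (dual (tait D)) setT).
  apply/connect1/exists_inP; exists (cross d); rewrite ?inE //=.
  have : over (rot3 d) by rewrite !over_rot od.
  case/over_cases => e; have ed := rot4 d; rewrite e in ed; rewrite -ed /=.
    by rewrite rot2_over_in !eqxx.
  by rewrite rot2_over_out !eqxx orbT.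
Qed.

(** Euler's formula of the diagram becomes that of the Tait digraph: there are twice as many arcs as
    crossings, and the regions split by colour into vertices and faces. *)
Lemma sphere_tait : sphere (tait D).
Proof.
split; [exact: tame_tait | exact: tame_dual_tait | rewrite /=].
have [c0|c0] := eqVneq #|crossing D| 0; first by rewrite /regions c0 /= !cards1.
have [_ outg euler] := hD.
have lsym : connect_sym (@linked D).
  apply: sym_connect_sym => d d'; rewrite /linked /= [cross d == _]eq_sym; congr (_ || _).
  by apply/eqP/eqP => ->; rewrite glueK.
have n1 : n_comp (@linked D) {: dart D} = 1.
  have /card_gt0P[c _] : 0 < #|crossing D| by rewrite lt0n.
  rewrite -(n_comp_connect lsym (over_in c)); apply: eq_n_comp_r => d.
  by rewrite !inE; apply/esym/hconn.
have n2 : fcard (@glue D) {: dart D} = 2 * #|crossing D|.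
  have : fcard (@glue D) {: dart D} * 2 = #|{: dart D}|.
    apply: fcard_order_set; [exact: (can_inj glueK) | | by []].
    apply/subsetP => d _; rewrite inE; apply/eqP.
    have ne : glue d != d by apply/eqP => e; have := outg d; rewrite e; case: outgoing.
    by rewrite (@order_cycle _ _ [:: d; glue d]) //= ?glueK ?eqxx // inE ?eqxx ?andbT // eq_sym.
  rewrite !card_prod card_bool; lia.
have n3 : fcard (@face D) {: dart D} = #|regions D true| + #|regions D false|.
  have fs := fconnect_sym face_inj.
  have -> : fcard (@face D) {: dart D} = #|[set region d | d in [set: dart D]]|.
    pose S := [set d | froots (@face D) d].
    have regE d d' : (region d == region d') = fconnect (@face D) d d'.
      apply/eqP/idP => [e|c]; last by apply/setP => x; rewrite !inE (same_connect fs c).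
      by have := region_self d'; rewrite -e inE.
    rewrite -(_ : @region D @: S = [set region d | d in [set: dart D]]).
      rewrite card_in_imset => [|d d']; first by apply: eq_card => d; rewrite !inE andbT.
      rewrite !inE => /eqP rd /eqP rd' /eqP; rewrite regE => /(fingraph.rootP fs).
      by rewrite rd rd'.
    apply/setP => Y; apply/imsetP/imsetP => -[d dS ->]; first by exists d.
    exists (froot (@face D) d); first by rewrite inE; exact: (roots_root fs).
    by apply/eqP; rewrite regE connect_root.
  rewrite /regions (negbTE c0) -(cardsID [set region d | d : dart D & over d]).
  congr (_ + _); apply: eq_card => Y; rewrite !inE.
    apply/andP/imsetP => [[_ /imsetP[d + ->]]|[d + ->]]; rewrite !inE => od.
      by exists d; rewrite ?inE ?od.
    by move: od; rewrite eqb_id => od; split; apply/imsetP; exists d; rewrite ?inE.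
  apply/andP/imsetP => [[no /imsetP[d _ eY]]|[d + ->]].
    exists d; rewrite ?inE // eqbF_neg; apply: contra no => od.
    by apply/imsetP; exists d; rewrite ?inE.
  rewrite inE => /eqP od; split; last by apply/imsetP; exists d; rewrite ?inE.
  by apply/imsetP => -[d' + /region_over]; rewrite inE od => + e; rewrite -e.
by move: euler; rewrite n1 n2 n3 mul2n -addnn -addnA => /addnI ->.
Qed.

Lemma tait_balance (o : bool) v :
  #|[set c | (positive c == o) && (region ((c, o, false) : dart D) == v)]| =
  #|[set c | (positive c == o) && (region ((c, o, true) : dart D) == v)]|.
Proof.
have := region_balance o v; rewrite !(card_corners o (fun=> true)) /outgoing /cross /=.
set a := #|_|; set b := #|_|; set c := #|_|; set d := #|_|.
have -> : b = 0 by apply/eqP; rewrite cards_eq0; apply/eqP/setP => e; rewrite !inE !andbF.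
have -> : c = 0 by apply/eqP; rewrite cards_eq0; apply/eqP/setP => e; rewrite !inE !andbF.
rewrite addn0 add0n /a /d => e; apply: etrans _ (etrans (esym e) _).
  by apply: eq_card => x; rewrite !inE andbT andbC.
by apply: eq_card => x; rewrite !inE andbT andbC.
Qed.

Lemma eulerian_tait : eulerian (@src (tait D)) (@tgt (tait D)) (@epos (tait D)) setT.
Proof.
apply: balance_eulerian => v; apply: etrans _ (etrans (tait_balance true v) _);
by apply: eq_card => c; rewrite !inE eqb_id.
Qed.

Lemma eulerian_dual_tait :
  eulerian (@rface (tait D)) (@lface (tait D)) (predC (@epos (tait D))) setT.
Proof.
apply: balance_eulerian => v; apply: etrans _ (etrans (esym (tait_balance false v)) _);
by apply: eq_card => c; rewrite !inE /= eqbF_neg ?rot_over_in ?rot_over_out; case: (positive c).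
Qed.

End Tait.

(** Contraction merges the root with the isolated points outside the graph, so that a single root
    remains. *)
Lemma forest_trapezoidal_roots (V E : finType) (s t : E -> V) pos (A : {set E}) (X : {set V}) b :
  X != set0 -> eulerian s t pos A ->
  trapezoidal_coefs b (\sum_(P | forest s t A X P) tvar ^ stat pos P).
Proof.
move=> X0 /(eulerian_ctr (X := X)) eX.
have -> : \sum_(P | forest s t A X P) tvar ^ stat pos P =
    \sum_(P | forest (fun e => ctr X (s e)) (fun e => ctr X (t e)) A [set None] P) tvar ^ stat pos P.
  by apply: eq_bigl => P; rewrite forest_ctr.
exact: forest_trapezoidal (card_ctr X) eX b.
Qed.

Lemma roots_at_neq0 G r : @roots_at G r != set0.
Proof. by apply/set0Pn; exists r; rewrite !inE eqxx. Qed.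

Theorem theorem1p5 (D : pd_code) (r q : {set dart D})
    (hD : link_diagram D) (hconn : connected_diagram D) (halt : alternating D)
    (hr : r \in vertices (tait D)) (hq : q \in faces (tait D))
    (hrq : @on_boundary (tait D) r q) :
  let P := @tree_poly (tait D) {fraction {poly int}} r q in
  let t := tvar in
  [/\ trapezoidal_coefs false (P t^-1 t 1 1),
      trapezoidal_coefs true (P t^-1 t 1 1),
      trapezoidal_coefs false (P 1 1 t^-1 t)
    & trapezoidal_coefs true (P 1 1 t^-1 t)].
Proof.
have sG := sphere_tait hD hconn halt.
have h1 b : trapezoidal_coefs b (@tree_poly (tait D) {fraction {poly int}} r q tvar^-1 tvar 1 1).
  rewrite (tree_poly_int sG) //; apply: forest_trapezoidal_roots (roots_at_neq0 _) _.
  exact: eulerian_tait.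
have h2 b : trapezoidal_coefs b (@tree_poly (tait D) {fraction {poly int}} r q 1 1 tvar^-1 tvar).
  rewrite (tree_poly_ext sG hr) //; apply: forest_trapezoidal_roots (@roots_at_neq0 (dual (tait D)) q) _.
  exact: eulerian_dual_tait.
by split.
Qed.
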